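(* Let $k$ be a field, $I$ a multihomogeneous ideal of $k[\mathbf x]$, $M=k[\mathbf x]/I$, $r=\operatorname{rdim}_k(M)\ge 0$, and let $\mathbf d=(d^{(0)},\dots,d^{(r)})$ be a collection of nonzero multidegrees. Let $\mathbf u$ be the collection of generic coefficients and $\underline U=(U_0,\dots,U_r)$ the sequence of generic polynomials of multidegrees $d^{(0)},\dots,d^{(r)}$, and let $M[\mathbf u]=M\otimes_kk[\mathbf u]$. Then Rémond's resultant form of index $\mathbf d$ attached to $I$ coincides with the $M[\mathbf u]$-resultant of $\underline U$ computed from Koszul complexes: $$\operatorname{res}_{\mathbf d}(I)=\operatorname{Res}_{k[\mathbf u]}(\underline U,M[\mathbf u])\pmod{k^\times}.$$
   Context: Rings are commutative with $1$. Fix $q\ge1$, $n_1,\dots,n_q\ge1$, variables $\mathbf x=(x_{p,i})_{1\le p\le q,0\le i\le n_p}$. For a ring $A$, $A[\mathbf x]$ is $\mathbb N^q$-graded with coefficients in multidegree $0$ and $x_{p,i}$ of multidegree $\mathbf e_p$ (canonical basis vector). $\mathbb N^q$ is ordered componentwise and ''for $\nu$ large enough'' means for all $\nu\ge\nu_0$, some $\nu_0\in\mathbb N^q$. Multigraded modules are graded by $\mathbb N^q$; one is eventually zero if its components vanish for large multidegree. A componentwise free $A[\mathbf x]$-module is a finitely generated multigraded $A[\mathbf x]$-module whose components are free $A$-modules of finite rank. For a Noetherian domain $A$ with fraction field $K$ and a finitely generated multigraded $A[\mathbf x]$-module $M$, $\operatorname{rdim}_A(M)$ is the total degree of the polynomial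 $H_M$ with $H_M(d)=\dim_K(M_d\otimes_AK)$ for $d$ large enough ($-1$ if $H_M=0$). Generic polynomials: for $i=0,\dots,r$ and each monomial $\mathfrak m$ of multidegree $d^{(i)}$ in $\mathbf x$, $u^{(i)}_{\mathfrak m}$ is a new variable; $\mathbf u$ is the collection of all of them and $U_i=\sum_{\mathfrak m}u^{(i)}_{\mathfrak m}\mathfrak m\in k[\mathbf u][\mathbf x]$. Rémond's resultant form: $\mathcal M(I)=M[\mathbf u]/(\underline U)M[\mathbf u]$. It is known that $\mathcal M(I)_\nu$ is a torsion $k[\mathbf u]$-module for $\nu$ large enough and that the content $\chi_{k[\mathbf u]}(\mathcal M(I)_\nu)$ is, for $\nu$ large enough, a fixed element, denoted $\operatorname{res}_{\mathbf d}(I)\in k[\mathbf u]$. Here, for a UFD $A$ and a finitely generated torsion $A$-module $N$, $\chi_A(N)=\prod_\pi\pi^{\ell(N_{(\pi)})}$, with $\pi$ running over representatives of irreducible elements of $A$ and $\ell$ the length over $A_{(\pi)}$. $M$-resultant: a multihomogeneous $f$ is filter-regular for a multigraded module $M$ if $(0:_Mf)$ is eventually zero; $(f_0,\dots,f_r)$ is a filter-regular sequence for $M$ if each $f_i$ is filter-regular for $M/(f_0,\dots,f_{i-1})M$. For multihomogeneous $f_i$ of multidegree $d^{(i)}$ the Koszul complex $\mathbf K_\bullet(\underline f,M)$, with terms $\bigwedge^p(A[\mathbf x]^{r+1})\otimes_{A[\mathbf x]} M$ and differential $e_{i_1}\wedge\dots\wedge e_{i_p}\otimes m\mapsto\sum_s(-1)^{s+1}f_{i_s}e_{i_1}\wedge\dots\widehat{e_{i_s}}\dots\wedge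 e_{i_p}\otimes m$, is graded by $\deg(e_{i_1}\wedge\dots\wedge e_{i_p}\otimes m)=d^{(i_1)}+\dots+d^{(i_p)}+\deg m$; $\mathbf K^\nu_\bullet$ is its multidegree-$\nu$ part. For a generically exact (exact after $\otimes_AK$) finite complex $C_\bullet$ of finite free $A$-modules, choose bases of the $C_i$ partitioned as $b_i=b_i'\cup b_i''$ ($b_0''=b_s'=\emptyset$) so that the block $\phi_i$ of $d_i:C_i\to C_{i-1}$ from the span of $b_i''$ to the span of $b_{i-1}'$ is square with nonzero determinant; the Cayley determinant is $\det_A(C_\bullet)=\prod_{i=1}^s\det(\phi_i)^{(-1)^{i+1}}\in K^\times/A^\times$, independent of choices. For $A$ a Noetherian UFD, $M$ componentwise free with $\operatorname{rdim}_A(M)=r$ and $\underline f=(f_0,\dots,f_r)$ a filter-regular sequence for $M$, $\operatorname{Res}_A(\underline f,M)\in A/A^\times$ is defined as $\det_A(\mathbf K^\nu_\bullet(\underline f,M))$ for $\nu$ large enough (the complex is generically exact and the value is constant for $\nu$ large enough). Part of the assertion is that $\underline U$ is a filter-regular sequence for $M[\mathbf u]$, so that the right-hand side is defined. *)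

(* Defs.v *)
From HB Require Import structures.
From mathcomp Require Import all_boot all_order all_algebra.
From mathcomp Require Import generic_quotient fraction.
From mathcomp Require Import boolp.
From mathcomp Require Import ring.
From mathcomp Require Import mpoly.

Set Implicit Arguments.
Unset Strict Implicit.
Unset Printing Implicit Defensive.

Import GRing.Theory.
Local Open Scope ring_scope.
Local Open Scope quotient_scope.

(* Submodules and ideals are arbitrary (not necessarily decidable) subsets.   *)

Record submodule (R : nzRingType) (V : lmodType R) := Submodule {
  submod_set :> V -> Prop;
  submod0 : submod_set 0;
  submodD : forall x y, submod_set x -> submod_set y -> submod_set (x + y);
  submodZ : forall a x, submod_set x -> submod_set (a *: x) }.

Record ideal (R : comNzRingType) := Ideal {
  ideal_set :> R -> Prop;
  ideal0 : ideal_set 0;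
  idealD : forall x y, ideal_set x -> ideal_set y -> ideal_set (x + y);
  idealM : forall a x, ideal_set x -> ideal_set (a * x) }.

Section GeneratedIdeal.
Variables (R : comNzRingType) (G : R -> Prop).

Definition in_ideal_gen (x : R) : Prop :=
  exists (m : nat) (a g : 'I_m -> R),
    (forall i, G (g i)) /\ x = \sum_(i < m) a i * g i.

Lemma in_ideal_gen0 : in_ideal_gen 0.
Proof.
exists 0, (fun=> 0), (fun=> 0); split; first by case.
by rewrite big_ord0.
Qed.

Lemma in_ideal_genD x y :
  in_ideal_gen x -> in_ideal_gen y -> in_ideal_gen (x + y).
Proof.
move=> [m [a [g [Gg ->]]]] [m' [a' [g' [Gg' ->]]]].
exists (m + m')%N, (fun i => match split i with inl j => a j | inr j => a' j end),
  (fun i => match split i with inl j => g j | inr j => g' j end).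
split=> [i|]; first by case: (split i).
rewrite big_split_ord /=; congr (_ + _); apply: eq_bigr => i _.
  by rewrite (unsplitK (inl i)).
by rewrite (unsplitK (inr i)).
Qed.

Lemma in_ideal_genM b x : in_ideal_gen x -> in_ideal_gen (b * x).
Proof.
move=> [m [a [g [Gg ->]]]]; exists m, (fun i => b * a i), g; split=> //.
by rewrite mulr_sumr; apply: eq_bigr => i _; rewrite mulrA.
Qed.

Definition ideal_gen : ideal R :=
  Ideal in_ideal_gen0 in_ideal_genD in_ideal_genM.

End GeneratedIdeal.

Section SubmoduleType.
Variables (R : nzRingType) (V : lmodType R) (T : submodule V).

Definition submod_pred : {pred V} := fun x => `[< T x >].

Lemma submod_pred_closed : GRing.submod_closed submod_pred.
Proof.
split=> [|a x y /asboolP Tx /asboolP Ty]; apply/asboolP; first exact: submod0.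
by apply: submodD => //; apply: submodZ.
Qed.

HB.instance Definition _ :=
  GRing.isSubmodClosed.Build R V submod_pred submod_pred_closed.

Record submod_type := SubmodType {
  submod_val :> V; submod_valP : submod_val \in submod_pred }.

HB.instance Definition _ := [isSub for submod_val].
HB.instance Definition _ := [Choice of submod_type by <:].
HB.instance Definition _ := [SubChoice_isSubLmodule of submod_type by <:].

End SubmoduleType.

Section QuotientModule.
Variables (R : nzRingType) (V : lmodType R) (S : submodule V).

Definition qmod_rel (x y : V) : bool := `[< S (x - y) >].

Lemma submodN x : S x -> S (- x).
Proof. by move=> Sx; rewrite -scaleN1r; apply: submodZ. Qed.

Lemma qmod_rel_refl : reflexive qmod_rel.
Proof. by move=> x; apply/asboolP; rewrite subrr; apply: submod0. Qed.

Lemma qmod_rel_sym : ssrbool.symmetric qmod_rel.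
Proof.
by move=> x y; apply/asboolP/asboolP => /submodN; rewrite opprB.
Qed.

Lemma qmod_rel_trans : transitive qmod_rel.
Proof.
move=> y x z /asboolP Sxy /asboolP Syz; apply/asboolP.
by rewrite -(subrKA y); apply: submodD.
Qed.

Canonical qmod_equiv :=
  EquivRel qmod_rel qmod_rel_refl qmod_rel_sym qmod_rel_trans.

Definition qmod := {eq_quot qmod_rel}.

HB.instance Definition _ := Choice.on qmod.
HB.instance Definition _ : EqQuotient V qmod_rel qmod := EqQuotient.on qmod.

Definition qmod_pi (x : V) : qmod := \pi_qmod x.

Lemma qmod_piP x y : qmod_pi x = qmod_pi y <-> S (x - y).
Proof.
split=> [/eqmodP/asboolP //|Sxy]; apply/eqmodP; exact/asboolP.
Qed.

Lemma qmod_repr (x : V) : S (repr (qmod_pi x) - x).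
Proof. by apply/qmod_piP; rewrite /qmod_pi reprK. Qed.

Lemma qmod_ind (P : qmod -> Prop) : (forall x, P (qmod_pi x)) -> forall x, P x.
Proof. by move=> Ppi x; rewrite -[x]reprK; apply: Ppi. Qed.

Definition qmod_add (x y : qmod) : qmod := qmod_pi (repr x + repr y).
Definition qmod_opp (x : qmod) : qmod := qmod_pi (- repr x).
Definition qmod_scale (a : R) (x : qmod) : qmod := qmod_pi (a *: repr x).

Lemma qmod_addE x y : qmod_add (qmod_pi x) (qmod_pi y) = qmod_pi (x + y).
Proof.
apply/qmod_piP; rewrite opprD addrACA.
by apply: submodD; apply: qmod_repr.
Qed.

Lemma qmod_oppE x : qmod_opp (qmod_pi x) = qmod_pi (- x).
Proof. by apply/qmod_piP; rewrite -opprD; apply/submodN/qmod_repr. Qed.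

Lemma qmod_scaleE a x : qmod_scale a (qmod_pi x) = qmod_pi (a *: x).
Proof. by apply/qmod_piP; rewrite -scalerBr; apply/submodZ/qmod_repr. Qed.

Lemma qmod_addA : associative qmod_add.
Proof.
elim/qmod_ind=> x; elim/qmod_ind=> y; elim/qmod_ind=> z.
by rewrite !qmod_addE addrA.
Qed.

Lemma qmod_addC : commutative qmod_add.
Proof.
by elim/qmod_ind=> x; elim/qmod_ind=> y; rewrite !qmod_addE addrC.
Qed.

Lemma qmod_add0 : left_id (qmod_pi 0) qmod_add.
Proof. by elim/qmod_ind=> x; rewrite qmod_addE add0r. Qed.

Lemma qmod_addN : left_inverse (qmod_pi 0) qmod_opp qmod_add.
Proof. by elim/qmod_ind=> x; rewrite qmod_oppE qmod_addE addNr. Qed.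

HB.instance Definition _ :=
  GRing.isZmodule.Build qmod qmod_addA qmod_addC qmod_add0 qmod_addN.

Lemma qmod_scaleA a b v :
  qmod_scale a (qmod_scale b v) = qmod_scale (a * b) v.
Proof. by elim/qmod_ind: v => v; rewrite !qmod_scaleE scalerA. Qed.

Lemma qmod_scale1 : left_id 1 qmod_scale.
Proof. by elim/qmod_ind=> v; rewrite qmod_scaleE scale1r. Qed.

Lemma qmod_scaleDr : right_distributive qmod_scale +%R.
Proof.
move=> a; elim/qmod_ind=> x; elim/qmod_ind=> y.
by rewrite [x in qmod_scale _ x]qmod_addE !qmod_scaleE
           [RHS]qmod_addE scalerDr.
Qed.

Lemma qmod_scaleDl v : {morph qmod_scale^~ v : a b / a + b}.
Proof.
elim/qmod_ind: v => v a b.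
by rewrite !qmod_scaleE [RHS]qmod_addE scalerDl.
Qed.

HB.instance Definition _ := GRing.Zmodule_isLmodule.Build R qmod
  qmod_scaleA qmod_scale1 qmod_scaleDr qmod_scaleDl.

End QuotientModule.

(* T / (S :&: T), for submodules S and T of V *)
Section Subquotient.
Variables (R : nzRingType) (V : lmodType R) (T S : submodule V).

Definition submod_restr : submodule (submod_type T).
Proof.
apply: (@Submodule R (submod_type T) (fun x => S (val x))).
- by rewrite raddf0; apply: submod0.
- by move=> x y Sx Sy; rewrite raddfD; apply: submodD.
- by move=> a x Sx; rewrite linearZ; apply: submodZ.
Defined.

Definition subquot := qmod submod_restr.
HB.instance Definition _ := GRing.Lmodule.on subquot.

End Subquotient.

Local Notation "x %:F" := (FracField.tofrac x).

(* Multiplicative subsets D of a domain A, the localization A_D as a subring  *)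
(* of the fraction field, and the localization V_D of an A-module V.          *)

Record mulset (A : idomainType) := Mulset {
  mulset_set :> A -> Prop;
  mulset1 : mulset_set 1;
  mulsetM : forall x y, mulset_set x -> mulset_set y -> mulset_set (x * y);
  mulset_n0 : forall x, mulset_set x -> x != 0 }.

Section LocalizedRing.
Variables (A : idomainType) (D : mulset A).

Definition locring_pred : {pred {fraction A}} :=
  fun x => `[< exists a s : A, D s /\ x = a%:F / s%:F >].

Lemma locring_closed : GRing.subring_closed locring_pred.
Proof.
split.
- by apply/asboolP; exists 1, 1; rewrite tofrac1 divr1; split=> //; apply: mulset1.
- move=> _ _ /asboolP[a [s [Ds ->]]] /asboolP[b [t [Dt ->]]]; apply/asboolP.
  exists (a * t - b * s), (s * t); split; first exact: mulsetM.
  have s0 : s%:F != 0 by rewrite tofrac_eq0 (mulset_n0 Ds).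
  have t0 : t%:F != 0 by rewrite tofrac_eq0 (mulset_n0 Dt).
  by rewrite tofracB !tofracM -mulNr addf_div // mulNr.
- move=> _ _ /asboolP[a [s [Ds ->]]] /asboolP[b [t [Dt ->]]]; apply/asboolP.
  exists (a * b), (s * t); split; first exact: mulsetM.
  by rewrite !tofracM mulf_div.
Qed.

HB.instance Definition _ :=
  GRing.isSubringClosed.Build {fraction A} locring_pred locring_closed.

Record locring := Locring {
  locring_val :> {fraction A}; locring_valP : locring_val \in locring_pred }.

HB.instance Definition _ := [isSub for locring_val].
HB.instance Definition _ := [Choice of locring by <:].
HB.instance Definition _ := [SubChoice_isSubComNzRing of locring by <:].

Lemma locring_fracP (x : locring) :
  exists p : A * A, D p.2 /\ val x = p.1%:F / p.2%:F.
Proof. by have /asboolP[a [s xE]] := valP x; exists (a, s). Qed.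

Definition locring_frac (x : locring) : A * A := sval (cid (locring_fracP x)).

Lemma locring_fracE x :
  D (locring_frac x).2 /\
  val x = (locring_frac x).1%:F / (locring_frac x).2%:F.
Proof. exact: svalP (cid (locring_fracP x)). Qed.

End LocalizedRing.

Section LocalizedModule.
Variables (A : idomainType) (D : mulset A) (V : lmodType A).

Record locpair := Locpair {
  locpair_val :> V * A; locpair_valP : `[< D locpair_val.2 >] }.

HB.instance Definition _ := [isSub for locpair_val].
HB.instance Definition _ := [Choice of locpair by <:].

Lemma locpairP (p : locpair) : D p.2.
Proof. by case: p => p Dp; apply: asboolW Dp. Qed.

Definition locmod_rel (p p' : locpair) : bool :=
  `[< exists u, D u /\ u *: (p'.2 *: p.1 - p.2 *: p'.1) = 0 >].

Lemma locmod_rel_refl : reflexive locmod_rel.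
Proof.
move=> p; apply/asboolP; exists 1; split; first exact: mulset1.
by rewrite subrr scaler0.
Qed.

Lemma locmod_rel_sym : ssrbool.symmetric locmod_rel.
Proof.
by move=> p p'; apply/asboolP/asboolP => -[u [Du uE]]; exists u; split=> //;
  apply/eqP; rewrite -opprB scalerN oppr_eq0 uE.
Qed.

Lemma locmod_rel_trans : transitive locmod_rel.
Proof.
move=> p' p p'' /asboolP[u [Du uE]] /asboolP[u' [Du' u'E]]; apply/asboolP.
have {}uE : u *: (p'.2 *: p.1) = u *: (p.2 *: p'.1).
  by apply/eqP; rewrite -subr_eq0 -scalerBr uE.
have {}u'E : u' *: (p''.2 *: p'.1) = u' *: (p'.2 *: p''.1).
  by apply/eqP; rewrite -subr_eq0 -scalerBr u'E.
exists (u * u' * p'.2); split; first exact: mulsetM (mulsetM Du Du') (locpairP p').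
apply/eqP; rewrite scalerBr subr_eq0; apply/eqP.
have -> : (u * u' * p'.2) *: (p''.2 *: p.1) =
          (u' * p''.2) *: (u *: (p'.2 *: p.1)).
  by rewrite !scalerA; congr (_ *: _); ring.
rewrite uE.
have -> : (u' * p''.2) *: (u *: (p.2 *: p'.1)) =
          (u * p.2) *: (u' *: (p''.2 *: p'.1)).
  by rewrite !scalerA; congr (_ *: _); ring.
by rewrite u'E !scalerA; congr (_ *: _); ring.
Qed.

Canonical locmod_equiv :=
  EquivRel locmod_rel locmod_rel_refl locmod_rel_sym locmod_rel_trans.

Definition locmod := {eq_quot locmod_rel}.

HB.instance Definition _ := Choice.on locmod.
HB.instance Definition _ : EqQuotient locpair locmod_rel locmod :=
  EqQuotient.on locmod.

Lemma asboolI (P : Prop) : P -> `[< P >].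
Proof. by move/asboolP. Qed.

Definition locmk_pair (v : V) (s : A) (Ds : D s) : locpair :=
  @Locpair (v, s) (asboolI Ds).

(* the fraction v / s *)
Definition locmk (v : V) (s : A) (Ds : D s) : locmod :=
  \pi_locmod (locmk_pair v Ds).

Definition locnum (x : locmod) : V := (repr x).1.
Definition locden (x : locmod) : A := (repr x).2.

Lemma locdenP x : D (locden x). Proof. exact: locpairP. Qed.

Lemma locmkP v s (Ds : D s) w t (Dt : D t) :
  locmk v Ds = locmk w Dt <->
  exists u, D u /\ u *: (t *: v) = u *: (s *: w).
Proof.
split=> [/eqmodP/asboolP[u [Du /= uE]]|[u [Du uE]]].
  by exists u; split=> //; apply/eqP; rewrite -subr_eq0 -scalerBr uE.
by apply/eqmodP/asboolP; exists u; rewrite /= scalerBr uE subrr.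
Qed.

Lemma locmk_eq v s (Ds : D s) w t (Dt : D t) :
  t *: v = s *: w -> locmk v Ds = locmk w Dt.
Proof.
move=> E; apply/locmkP; exists 1; split; first exact: mulset1.
by rewrite E.
Qed.

Lemma locmkK x : locmk (locnum x) (locdenP x) = x.
Proof.
rewrite -[RHS]reprK /locmk; congr (\pi _); apply: val_inj.
by rewrite /= /locnum /locden; case: (val (repr x)).
Qed.

Lemma locmod_ind (P : locmod -> Prop) :
  (forall v s (Ds : D s), P (locmk v Ds)) -> forall x, P x.
Proof. by move=> Pmk x; rewrite -[x]locmkK. Qed.

Lemma locmk_repr v s (Ds : D s) :
  exists u, D u /\
    u *: (s *: locnum (locmk v Ds)) = u *: (locden (locmk v Ds) *: v).
Proof. by apply/(locmkP _ (locdenP _)); rewrite locmkK. Qed.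

Definition locmod_add (x y : locmod) : locmod :=
  locmk (locden y *: locnum x + locden x *: locnum y)
        (mulsetM (locdenP x) (locdenP y)).
Definition locmod_opp (x : locmod) : locmod :=
  locmk (- locnum x) (locdenP x).
Definition locmod_scale (a : locring D) (x : locmod) : locmod :=
  locmk ((locring_frac a).1 *: locnum x)
        (mulsetM (proj1 (locring_fracE a)) (locdenP x)).

Lemma locmod_addE v s (Ds : D s) w t (Dt : D t) :
  locmod_add (locmk v Ds) (locmk w Dt) =
  locmk (t *: v + s *: w) (mulsetM Ds Dt).
Proof.
have [u [Du uE]] := locmk_repr v Ds; have [u' [Du' u'E]] := locmk_repr w Dt.
apply/locmkP; exists (u * u'); split; first exact: mulsetM.
move: uE u'E; move: (locnum (locmk v Ds)) (locden (locmk v Ds)).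
move: (locnum (locmk w Dt)) (locden (locmk w Dt)) => w' t' v' s' uE u'E; rewrite !scalerDr.
congr (_ + _).
  transitivity ((u' * t * t') *: (u *: (s *: v'))).
    by rewrite !scalerA; congr (_ *: _); ring.
  by rewrite uE !scalerA; congr (_ *: _); ring.
transitivity ((u * s * s') *: (u' *: (t *: w'))).
  by rewrite !scalerA; congr (_ *: _); ring.
by rewrite u'E !scalerA; congr (_ *: _); ring.
Qed.

Lemma locmod_oppE v s (Ds : D s) : locmod_opp (locmk v Ds) = locmk (- v) Ds.
Proof.
have [u [Du uE]] := locmk_repr v Ds.
by apply/locmkP; exists u; split; rewrite // !scalerN uE.
Qed.

Lemma locmod_scaleE (a : locring D) b t (Dt : D t) v s (Ds : D s) :
  val a = b%:F / t%:F ->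
  locmod_scale a (locmk v Ds) = locmk (b *: v) (mulsetM Dt Ds).
Proof.
have [Da aE] := locring_fracE a; move=> aE'.
have [u [Du uE]] := locmk_repr v Ds.
have fE : (locring_frac a).1 * t = b * (locring_frac a).2.
  apply/eqP; rewrite -tofrac_eq !tofracM -eqr_div ?tofrac_eq0 ?(mulset_n0 Da)//.
    by rewrite -aE -aE'.
  exact: mulset_n0 Dt.
apply/locmkP; exists u; split=> //.
move: fE uE; move: (locring_frac a).1 (locring_frac a).2 => b' t'.
move: (locnum (locmk v Ds)) (locden (locmk v Ds)) => v' s' fE uE.
transitivity ((b' * t) *: (u *: (s *: v'))).
  by rewrite !scalerA; congr (_ *: _); ring.
by rewrite uE fE !scalerA; congr (_ *: _); ring.
Qed.

Lemma locmod_addA : associative locmod_add.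
Proof.
elim/locmod_ind=> x r Dr; elim/locmod_ind=> y s Ds; elim/locmod_ind=> z t Dt.
rewrite !locmod_addE; apply: locmk_eq.
by rewrite !scalerDr !scalerA -addrA; congr (_ *: _ + (_ *: _ + _ *: _)); ring.
Qed.

Lemma locmod_addC : commutative locmod_add.
Proof.
elim/locmod_ind=> x r Dr; elim/locmod_ind=> y s Ds.
by rewrite !locmod_addE; apply: locmk_eq; rewrite addrC mulrC.
Qed.

Lemma locmod_add0 : left_id (locmk 0 (mulset1 D)) locmod_add.
Proof.
elim/locmod_ind=> x r Dr; rewrite locmod_addE; apply: locmk_eq.
by rewrite scaler0 add0r scale1r mul1r.
Qed.

Lemma locmod_addN : left_inverse (locmk 0 (mulset1 D)) locmod_opp locmod_add.
Proof.
elim/locmod_ind=> x r Dr; rewrite locmod_oppE locmod_addE; apply: locmk_eq.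
by rewrite scalerN addNr !scaler0.
Qed.

HB.instance Definition _ := GRing.isZmodule.Build locmod
  locmod_addA locmod_addC locmod_add0 locmod_addN.

Lemma locmod_scaleA a b x :
  locmod_scale a (locmod_scale b x) = locmod_scale (a * b) x.
Proof.
have [Da aE] := locring_fracE a; have [Db bE] := locring_fracE b.
elim/locmod_ind: x => v s Ds.
rewrite (locmod_scaleE Db _ _ bE) (locmod_scaleE Da _ _ aE).
have abE : val (a * b) = ((locring_frac a).1 * (locring_frac b).1)%:F /
                         ((locring_frac a).2 * (locring_frac b).2)%:F.
  by rewrite rmorphM /= aE bE !tofracM mulf_div.
rewrite (locmod_scaleE (mulsetM Da Db) _ _ abE); apply: locmk_eq.
by rewrite !scalerA; congr (_ *: _); ring.
Qed.

Lemma locmod_scale1 : left_id 1 locmod_scale.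
Proof.
elim/locmod_ind=> v s Ds.
have E1 : val (1 : locring D) = 1%:F / 1%:F by rewrite rmorph1 tofrac1 divr1.
by rewrite (locmod_scaleE (mulset1 D) _ _ E1); apply: locmk_eq;
   rewrite scale1r mul1r.
Qed.

Lemma locmod_scaleDr : right_distributive locmod_scale +%R.
Proof.
move=> a; have [Da aE] := locring_fracE a.
elim/locmod_ind=> x r Dr; elim/locmod_ind=> y s Ds.
rewrite [z in locmod_scale _ z]locmod_addE !(locmod_scaleE Da _ _ aE) [RHS]locmod_addE.
apply: locmk_eq; rewrite !scalerDr !scalerA.
by congr (_ *: _ + _ *: _); ring.
Qed.

Lemma locmod_scaleDl x : {morph locmod_scale^~ x : a b / a + b}.
Proof.
move=> a b; have [Da aE] := locring_fracE a; have [Db bE] := locring_fracE b.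
elim/locmod_ind: x => v s Ds.
rewrite (locmod_scaleE Db _ _ bE) (locmod_scaleE Da _ _ aE) [RHS]locmod_addE.
set a1 := (locring_frac a).1 in aE *; set a2 := (locring_frac a).2 in Da aE *.
set b1 := (locring_frac b).1 in bE *; set b2 := (locring_frac b).2 in Db bE *.
have abE : val (a + b) = (a1 * b2 + b1 * a2)%:F / (a2 * b2)%:F.
  rewrite rmorphD /= aE bE tofracD !tofracM addf_div //.
    by rewrite tofrac_eq0 (mulset_n0 Da).
  by rewrite tofrac_eq0 (mulset_n0 Db).
rewrite (locmod_scaleE (mulsetM Da Db) _ _ abE); apply: locmk_eq.
rewrite !scalerDr !scalerA -scalerDl; congr (_ *: _); ring.
Qed.

HB.instance Definition _ := GRing.Zmodule_isLmodule.Build (locring D) locmod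
  locmod_scaleA locmod_scale1 locmod_scaleDr locmod_scaleDl.

End LocalizedModule.

(* The map f_D : V_D -> W_D induced by f, which is meant to be linear: only   *)
(* then is the value independent of the representative.                       *)
Definition locmap (A : idomainType) (D : mulset A) (V W : lmodType A)
    (f : V -> W) (x : locmod D V) : locmod D W :=
  locmk (f (locnum x)) (locdenP x).

Section SubquotientMap.
Variables (R : nzRingType) (V V' : lmodType R).
Variables (T S : submodule V) (T' S' : submodule V') (f : {linear V -> V'}).
Hypothesis fT : forall x, T x -> T' (f x).
Hypothesis fS : forall x, S x -> S' (f x).

Lemma subquot_map_subproof (x : submod_type T) : f (val x) \in submod_pred T'.
Proof. by apply/asboolP/fT; apply: asboolW (submod_valP x). Qed.

Definition subquot_map (x : subquot T S) : subquot T' S' :=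
  qmod_pi (submod_restr T' S') (SubmodType (subquot_map_subproof (repr x))).

Lemma subquot_mapE (x : submod_type T) :
  subquot_map (qmod_pi _ x) = qmod_pi _ (SubmodType (subquot_map_subproof x)).
Proof.
apply/qmod_piP; rewrite /= -linearB; apply: fS.
have : S (val (repr (qmod_pi (submod_restr T S) x) - x)) :=
  qmod_repr (submod_restr T S) x.
by rewrite raddfB.
Qed.

Lemma subquot_map_is_linear : linear subquot_map.
Proof.
move=> a; elim/qmod_ind=> x; elim/qmod_ind=> y.
have -> : a *: qmod_pi (submod_restr T S) x + qmod_pi _ y
          = qmod_pi _ (a *: x + y).
  by rewrite [a *: qmod_pi _ _]qmod_scaleE [LHS]qmod_addE.
rewrite !subquot_mapE [a *: qmod_pi _ _]qmod_scaleE [RHS]qmod_addE.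
by congr (qmod_pi _ _); apply: val_inj; rewrite /= !linearP.
Qed.

End SubquotientMap.

Section ModuleNotions.
Variables (R : nzRingType) (V : lmodType R).

Definition is_basis (B : finType) (b : B -> V) : Prop :=
  forall v, exists! c : {ffun B -> R}, v = \sum_j c j *: b j.

Definition free_of_rank (h : nat) : Prop := exists b : 'I_h -> V, is_basis b.

Definition has_chain (l : nat) : Prop :=
  exists W : nat -> submodule V, forall i, (i < l)%N ->
    (forall x, W i x -> W i.+1 x) /\ (exists2 x, W i.+1 x & ~ W i x).

Definition has_length (l : nat) : Prop :=
  has_chain l /\ forall l', has_chain l' -> (l' <= l)%N.

End ModuleNotions.

Section Divisibility.
Variable A : idomainType.
Implicit Types a b c p : A.

Definition divides a b : Prop := exists c, b = c * a.

Definition associated a b : Prop := exists2 u, u \is a GRing.unit & a = u * b.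

Definition irreducible_elt p : Prop :=
  [/\ p != 0, p \isn't a GRing.unit &
      forall a b, p = a * b -> a \is a GRing.unit \/ b \is a GRing.unit].

Definition prime_elt p : Prop :=
  [/\ p != 0, p \isn't a GRing.unit &
      forall a b, divides p (a * b) -> divides p a \/ divides p b].

Definition nonzero_mulset : mulset A :=
  @Mulset A (fun x => x != 0) (oner_neq0 A)
    (fun x y x0 y0 => mulf_neq0 x0 y0) (fun x x0 => x0).

(* A \ (p), so that locring and locmod yield the localizations at (p) *)
Definition prime_mulset p (pP : prime_elt p) : mulset A.
Proof.
case: pP => p0 pU pM; apply: (@Mulset A (fun x => ~ divides p x)).
- case=> c c1; move/negP: pU; apply; apply/unitrPr; exists c.
  by rewrite mulrC.
- by move=> x y px py /pM[].
- by move=> x px; apply/eqP => x0; apply: px; exists 0; rewrite x0 mul0r.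
Defined.

Definition torsion_module (V : lmodType A) : Prop :=
  forall x : V, exists2 a, a != 0 & a *: x = 0.

Definition has_local_length (V : lmodType A) p (l : nat) : Prop :=
  exists pP : prime_elt p, has_length (locmod (prime_mulset pP) V) l.

(* c represents chi_A(V) in A / A^x. The sequence s lists representatives of  *)
(* finitely many classes of irreducible elements, including all those at      *)
(* which V has nonzero local length.                                          *)
Definition is_content (V : lmodType A) c : Prop :=
  exists (s : seq A) (l : A -> nat),
    [/\ uniq s
          /\ (forall p p', p \in s -> p' \in s -> associated p p' -> p = p'),
        forall p, p \in s -> irreducible_elt p /\ has_local_length V p (l p),
        forall p, irreducible_elt p ->
          (forall p', p' \in s -> ~ associated p p') -> has_local_length V p 0
      & associated c (\prod_(p <- s) p ^+ l p)].

End Divisibility.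

Record complex (A : nzRingType) := Complex {
  cplx_mod :> nat -> lmodType A;
  cplx_diff : forall p, {linear cplx_mod p.+1 -> cplx_mod p};
  cplx_diffK : forall p x, cplx_diff p (cplx_diff p.+1 x) = 0 }.

Section CayleyDeterminant.
Variables (A : idomainType) (C : complex A).

(* C \otimes_A K is exact; C \otimes_A K is the localization at A \ {0}. *)
Definition generically_exact : Prop :=
  (forall x : locmod (nonzero_mulset A) (C 0),
     exists y, locmap (cplx_diff C 0) y = x) /\
  (forall p (x : locmod (nonzero_mulset A) (C p.+1)),
     locmap (cplx_diff C p) x = 0 ->
     exists y, locmap (cplx_diff C p.+1) y = x).

(* x represents det_A(C) in K^x / A^x, for C concentrated in degrees <= s.    *)
(* The basis b p of C p is the disjoint union of b' p (the left summand) and  *)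
(* b'' p (the right summand). Its block phi p being square, of size rho p,    *)
(* b'' p and b' p.-1 have the same cardinality rho p. Vectors are rows, so    *)
(* phi p is the transpose of the block, with the same determinant.            *)
Definition is_cayley_det (s : nat) (x : {fraction A}) : Prop :=
  exists (rho : nat -> nat) (b : forall p, 'I_(rho p.+1) + 'I_(rho p) -> C p)
         (phi : forall p, 'M[A]_(rho p)),
    [/\ rho 0%N = 0%N /\ rho s.+1 = 0%N,
        forall p, (p <= s)%N -> is_basis (b p),
        forall p i, (p < s)%N -> exists c : 'I_(rho p) -> A,
          cplx_diff C p (b p.+1 (inr i)) =
            \sum_j phi p.+1 i j *: b p (inl j) + \sum_j c j *: b p (inr j),
        forall p, (0 < p <= s)%N -> \det (phi p) != 0
      & exists2 u : A, u \is a GRing.unit &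
          x = u%:F * \prod_(1 <= p < s.+1) (\det (phi p))%:F ^ ((-1) ^+ p.+1)].

End CayleyDeterminant.

(* The multigraded A[x]-modules involved are all cyclic, and are represented   *)
(* by their annihilators J: the module is A[x]/J, its quotient by polynomials *)
(* (f_j) is A[x]/(J, f_j), and the base change of k[x]/I to k[u] is           *)
(* k[u][x]/I.k[u][x]. Multidegrees are elements of 'X_{1..q}, whose order     *)
(* (_ <= _)%MM is componentwise.                                              *)
Section Multigraded.
Variables (q : nat) (n : 'I_q -> nat).

(* the number of variables x_(p,i) with p in 'I_q and 0 <= i <= n p *)
Definition nvars : nat := #|{: {p : 'I_q & 'I_(n p).+1}}|.

Definition block (v : 'I_nvars) : 'I_q :=
  tag (enum_val v : {p : 'I_q & 'I_(n p).+1}).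

Definition multideg (m : 'X_{1..nvars}) : 'X_{1..q} :=
  [multinom (\sum_(v | block v == p) m v)%N | p < q].

Lemma multidegD m1 m2 :
  multideg (m1 + m2)%MM = (multideg m1 + multideg m2)%MM.
Proof.
apply/mnmP => p; rewrite mnmDE !mnmE -big_split.
by apply: eq_bigr => v _; rewrite mnmDE.
Qed.

(* "for nu large enough" *)
Definition eventually (P : 'X_{1..q} -> Prop) : Prop :=
  exists nu0 : 'X_{1..q}, forall nu, (nu0 <= nu)%MM -> P nu.

Section Ring.
Variable A : idomainType.
Local Notation P := {mpoly A[nvars]}.
Implicit Types (f g : P) (nu : 'X_{1..q}) (J : ideal P).

Definition multihomog nu f : Prop := forall m, m \in msupp f -> multideg m = nu.

Definition multihomog_part nu f : P :=
  \sum_(m <- msupp f | multideg m == nu) f@_m *: 'X_[m].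

Definition multihomog_ideal J : Prop :=
  forall f, J f -> forall nu, J (multihomog_part nu f).

Definition homog_submod nu : submodule P.
Proof.
apply: (@Submodule A P (multihomog nu)).
- by move=> m; rewrite msupp0.
- by move=> f g Hf Hg m /msuppD_le; rewrite mem_cat => /orP[/Hf|/Hg].
- by move=> a f Hf m /msuppZ_le /Hf.
Defined.

Definition ideal_submod J : submodule P.
Proof.
apply: (@Submodule A P J); [exact: ideal0 | exact: idealD | ].
by move=> a x; rewrite -mul_mpolyC; apply: idealM.
Defined.

(* the component of multidegree nu of A[x]/J, for J multihomogeneous *)
Definition gcomp J nu : lmodType A :=
  subquot (homog_submod nu) (ideal_submod J).

Definition ideal_add J (G : P -> Prop) : ideal P :=
  ideal_gen (fun g => J g \/ G g).

Definition componentwise_free J : Prop :=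
  multihomog_ideal J /\ forall nu, exists h, free_of_rank (gcomp J nu) h.

(* rdim_A(A[x]/J) = e; msize is one more than the total degree *)
Definition has_rdim J (e : int) : Prop :=
  exists2 H : {mpoly rat[q]}, (msize H)%:Z - 1 = e &
    eventually (fun nu => exists2 h : nat,
      free_of_rank (locmod (nonzero_mulset A) (gcomp J nu)) h &
      H.@[fun p => (nu p)%:R] = h%:R).

(* f is filter-regular for A[x]/J: (0 : f) vanishes in large multidegrees *)
Definition filter_regular J f : Prop :=
  eventually (fun nu => forall g, multihomog nu g -> J (f * g) -> J g).

Section Sequence.
Variables (r : nat) (d : 'I_r.+1 -> 'X_{1..q}) (f : 'I_r.+1 -> P).

Definition filter_regular_seq J : Prop :=
  forall i : 'I_r.+1,
    filter_regular (ideal_add J (fun g => exists2 j : 'I_r.+1, (j < i)%N & g = f j)) (f i).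

(* The Koszul complex K(f, A[x]): a chain is the family of its coordinates on *)
(* the e_S = e_(i_1) /\ ... /\ e_(i_p), with S = {i_1 < ... < i_p}.           *)
Local Notation chain := {ffun {set 'I_r.+1} -> P}.

Definition koszul_sign (i : 'I_r.+1) (S : {set 'I_r.+1}) : P :=
  (-1) ^+ #|[set j in S | (j < i)%N]|.

Definition koszul_diff (w : chain) : chain :=
  [ffun S : {set 'I_r.+1} => \sum_(i | i \notin S) koszul_sign i S * f i * w (i |: S)].

Lemma koszul_diff_is_linear : linear koszul_diff.
Proof.
move=> a w w'; apply/ffunP => S; rewrite !ffunE scaler_sumr -big_split /=.
apply: eq_bigr => i _; rewrite !ffunE mulrDr; congr (_ + _).
by rewrite scalerAr.
Qed.

HB.instance Definition _ :=
  GRing.isLinear.Build A chain chain _ koszul_diff koszul_diff_is_linear.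

Lemma koszul_signU (i j : 'I_r.+1) (S : {set 'I_r.+1}) :
  i \notin S -> j \notin S -> i != j ->
  koszul_sign i S * koszul_sign j (i |: S) =
  - (koszul_sign j S * koszul_sign i (j |: S)).
Proof.
wlog ltij : i j / (i < j)%N.
  move=> Hw iS jS ij; have [ltij|ltji|/val_inj eij] := ltngtP i j.
  - exact: Hw.
  - by rewrite (Hw j i) ?opprK // eq_sym.
  - by rewrite eij eqxx in ij.
move=> iS jS _; rewrite /koszul_sign.
have -> : [set k in i |: S | (k < j)%N] = i |: [set k in S | (k < j)%N].
  by apply/setP=> k; rewrite !inE; case: eqP => // ->; rewrite ltij.
have -> : [set k in j |: S | (k < i)%N] = [set k in S | (k < i)%N].
  apply/setP=> k; rewrite !inE; case: eqP => //= ->.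
  by rewrite ltnNge (ltnW ltij) andbF.
by rewrite cardsU1 !inE (negbTE iS) /= exprS mulN1r mulrN mulrC.
Qed.

Lemma koszul_diffK w : koszul_diff (koszul_diff w) = 0.
Proof.
apply/ffunP => S; rewrite !ffunE.
pose G i j : P := koszul_sign i S * f i *
  (koszul_sign j (i |: S) * f j * w (j |: (i |: S))).
pose c i j := [&& i \notin S, j \notin S & i != j].
have -> : \sum_(i | i \notin S) koszul_sign i S * f i * koszul_diff w (i |: S)
          = \sum_i \sum_(j | c i j) G i j.
  rewrite big_mkcond; apply: eq_bigr => i _; rewrite /c.
  case: ifP => iS /=; last by rewrite big_pred0.
  rewrite ffunE mulr_sumr; apply: eq_bigl => j.
  by rewrite in_setU1 negb_or andbC eq_sym.
have GN i j : c i j -> G i j = - G j i.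
  case/and3P=> iS jS ij; rewrite /G setUCA.
  have E := koszul_signU iS jS ij.
  transitivity ((koszul_sign i S * koszul_sign j (i |: S)) *
                (f i * f j * w (j |: (i |: S)))); first by rewrite setUCA; ring.
  by rewrite E setUCA; ring.
have cC i j : c i j = c j i by rewrite /c andbCA eq_sym.
pose lt i j := c i j && (i < j)%N.
have splitE : \sum_i \sum_(j | c i j) G i j =
   \sum_i \sum_(j | lt i j) G i j + \sum_i \sum_(j | lt j i) G i j.
  rewrite -big_split; apply: eq_bigr => i _ /=.
  rewrite (bigID (fun j : 'I_r.+1 => (i < j)%N)) /=; congr (_ + _).
  apply: eq_bigl => j; rewrite /lt [c j i]cC -leqNgt; case cij: (c i j) => //=.
  by rewrite leq_eqVlt; case: eqP => // /val_inj ji;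
     move: cij; rewrite /c ji eqxx !andbF.
rewrite splitE [X in _ + X](exchange_big_dep predT) //= -big_split /=.
apply: big1 => i _; rewrite -big_split /=; apply: big1 => j /andP[cij _].
by rewrite (GN _ _ cij) addNr.
Qed.

(* chains of K_p(f, A[x]) of multidegree nu, e_S being of multidegree         *)
(* \sum_(i in S) d i                                                          *)
Definition koszul_term (nu : 'X_{1..q}) (p : nat) : submodule chain.
Proof.
apply: (@Submodule A chain (fun w => forall S : {set 'I_r.+1},
  (#|S| <> p -> w S = 0) /\
  (forall m, m \in msupp (w S) -> (\sum_(i in S) d i + multideg m)%MM = nu))).
- by move=> S; rewrite ffunE; split=> // m; rewrite msupp0.
- move=> w w' Hw Hw' S; have [w0 wnu] := Hw S; have [w'0 w'nu] := Hw' S.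
  rewrite ffunE; split=> [Sp|m]; first by rewrite w0 ?w'0 ?addr0.
  by move/msuppD_le; rewrite mem_cat => /orP[/wnu|/w'nu].
- move=> a w Hw S; have [w0 wnu] := Hw S.
  rewrite ffunE; split=> [Sp|m]; first by rewrite w0 ?scaler0.
  by move/msuppZ_le/wnu.
Defined.

(* the kernel of K(f, A[x]) -> K(f, A[x]/J) *)
Definition koszul_rel J : submodule chain.
Proof.
apply: (@Submodule A chain (fun w => forall S : {set 'I_r.+1}, J (w S))).
- by move=> S; rewrite ffunE; apply: ideal0.
- by move=> w w' Hw Hw' S; rewrite ffunE; apply: idealD.
- move=> a w Hw S; rewrite ffunE -mul_mpolyC; exact: idealM.
Defined.

Hypothesis fd : forall i, multihomog (d i) (f i).

Lemma koszul_diff_term nu p w :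
  koszul_term nu p.+1 w -> koszul_term nu p (koszul_diff w).
Proof.
move=> Hw S; rewrite ffunE; split=> [Sp|].
  rewrite big1 // => i iS; rewrite (proj1 (Hw (i |: S))) ?mulr0 //.
  by rewrite cardsU1 iS => -[].
move=> m mS; apply: contrapT => mnu.
move: mS; rewrite mcoeff_msupp raddf_sum /= => /eqP; apply.
apply: big1 => i iS; apply: contrapT => /eqP; rewrite -mcoeff_msupp => mS.
apply: mnu; have [_ wnu] := Hw (i |: S).
have {}mS : m \in msupp (f i * w (i |: S)).
  move: mS; rewrite /koszul_sign -signr_odd; case: (odd _).
    by rewrite expr1 mulN1r mulNr (perm_mem (msuppN _)).
  by rewrite expr0 mul1r.
have /allpairsP[[m1 m2] [/= m1f m2w ->]] := msuppM_le mS.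
rewrite -(wnu _ m2w) big_setU1 //= multidegD (fd m1f).
by rewrite [LHS]addmA; congr (_ + _)%MM; exact: addmC.
Qed.

Lemma koszul_diff_rel J w : koszul_rel J w -> koszul_rel J (koszul_diff w).
Proof.
move=> Hw S; rewrite ffunE; elim/big_ind: _ => [|x y|].
- exact: ideal0.
- exact: idealD.
- by move=> i iS; apply: idealM.
Qed.

(* the multidegree nu part of the Koszul complex K(f, A[x]/J) *)
Section Koszul.
Variables (J : ideal P) (nu : 'X_{1..q}).

Definition koszul_mod (p : nat) : lmodType A :=
  subquot (koszul_term nu p) (koszul_rel J).

Definition koszul_map (p : nat) : koszul_mod p.+1 -> koszul_mod p :=
  @subquot_map A chain chain (koszul_term nu p.+1) (koszul_rel J)
    (koszul_term nu p) (koszul_rel J) koszul_diff (@koszul_diff_term nu p).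

Lemma koszul_map_is_linear p : linear (@koszul_map p).
Proof. exact: subquot_map_is_linear (@koszul_diff_rel J). Qed.

HB.instance Definition _ p :=
  GRing.isLinear.Build A (koszul_mod p.+1) (koszul_mod p) _ (@koszul_map p)
    (@koszul_map_is_linear p).

Lemma koszul_mapK p (x : koszul_mod p.+2) : koszul_map (koszul_map x) = 0.
Proof.
elim/qmod_ind: x => x; rewrite /koszul_map !(subquot_mapE _ (@koszul_diff_rel J)).
by congr (qmod_pi _ _); apply: val_inj; rewrite /= koszul_diffK.
Qed.

Definition koszul : complex A :=
  @Complex A koszul_mod (fun p => @koszul_map p) koszul_mapK.

End Koszul.

(* c represents Res_A(f, A[x]/J) in A / A^x *)
Definition is_resultant J (c : A) : Prop :=
  [/\ componentwise_free J,
      has_rdim J r,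
      filter_regular_seq J
    & eventually (fun nu => generically_exact (koszul J nu) /\
                            is_cayley_det (koszul J nu) r.+1 c%:F)].

End Sequence.
End Ring.

Section Generic.
Variables (k : fieldType) (r : nat) (d : 'I_r.+1 -> 'X_{1..q}).

(* the monomials of multidegree nu, which have total degree mdeg nu *)
Definition mon_of (nu : 'X_{1..q}) :=
  {m : 'X_{1..nvars < (mdeg nu).+1} | multideg m == nu}.

Definition uidx := {i : 'I_r.+1 & mon_of (d i)}.

Definition num_u : nat := #|{: uidx}|.

Local Notation ku := {mpoly k[num_u]}.

Definition uvar (i : 'I_r.+1) (m : mon_of (d i)) : ku :=
  'X_(enum_rank (Tagged (fun i => mon_of (d i)) m)).

Definition generic_poly (i : 'I_r.+1) : {mpoly ku[nvars]} :=
  \sum_(m : mon_of (d i)) uvar m *: 'X_[val m].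

Lemma generic_poly_multihomog i : multihomog (d i) (generic_poly i).
Proof.
move=> m; rewrite mcoeff_msupp raddf_sum /= => /eqP; apply: contra_notP => mi.
apply: big1 => m' _; rewrite mcoeffZ mcoeffX.
case: eqP => [m'm|_]; last by rewrite mulr0.
by case: mi; rewrite -m'm; apply/eqP/(valP m').
Qed.

(* For M = k[x]/I, the module M[u] is k[u][x]/(base_change I). *)
Definition base_change (I : ideal {mpoly k[nvars]}) : ideal {mpoly ku[nvars]} :=
  ideal_gen (fun g => exists2 f, I f & g = map_mpoly (@mpolyC num_u k) f).

(* the component of multidegree nu of M[u]/(U)M[u] *)
Definition remond_comp (I : ideal {mpoly k[nvars]}) (nu : 'X_{1..q}) :
    lmodType ku :=
  gcomp (ideal_add (base_change I) (fun g => exists i, g = generic_poly i)) nu.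

(* c represents res_d(I) in k[u] / k^x *)
Definition is_resultant_form (I : ideal {mpoly k[nvars]}) (c : ku) : Prop :=
  eventually (fun nu =>
    torsion_module (remond_comp I nu) /\ is_content (remond_comp I nu) c).

End Generic.
End Multigraded.

Arguments generic_poly {q} n k {r} d i.
Arguments generic_poly_multihomog {q} n k {r} d i.
Arguments base_change {q n k r} d I.
Arguments remond_comp {q n k r} d I nu.
Arguments is_resultant_form {q n k r} d I c.
Arguments is_resultant {q n A r d f} fd J c.

(* Main.v *)
(* For nu large the Koszul complex of the generic polynomials U on M[u] is exact
   in positive degrees, and its cokernel in degree 0 is the component of
   multidegree nu of M[u]/(U)M[u]. Filter-regularity comes from solving
   U_j = 0 (j < i) for one of its coefficients, after localization at a product
   of variables; exactness then follows by the mapping cone argument.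

   Let pi be an irreducible element of k[u]. As long as pi divides one of the
   determinants entering the Cayley determinant of the complex, replacing a row
   of the corresponding matrix divides two consecutive determinants by pi. At
   the end, the cokernel is, locally at pi, the cokernel of a single square
   matrix, whose length is the multiplicity of pi in the determinant. Hence the
   Cayley determinant c_nu is the content of the cokernel.

   It remains to see that c_nu does not depend on nu. The Koszul matrices are
   linear in u, so the degree of c_nu is an alternating sum of values of the
   Hilbert function, which is constant because the Hilbert polynomial has
   degree r. Moreover c_nu divides c_(nu + e_p), as multiplication by a linear
   form in the x_(p,i) with new indeterminate coefficients is injective on the
   cokernels, after extension of scalars, and so lengths can only increase. *)
From HB Require Import structures.
From mathcomp Require Import all_boot all_order all_algebra.
From mathcomp Require Import generic_quotient ring_quotient fraction perm.
From mathcomp Require Import boolp.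
From mathcomp Require Import ring zify.
From mathcomp Require Import mpoly.
Require Import Defs.

Set Implicit Arguments.
Unset Strict Implicit.
Unset Printing Implicit Defensive.

Import GRing.Theory.
Local Open Scope ring_scope.

Local Notation "x %:F" := (FracField.tofrac x).

(** * Noetherian rings *)

(** Independence of the Cayley determinant of the chosen bases is never proved directly: any such
    determinant is tied to the local lengths of the cokernel, which involve no bases, and unique
    factorization in [k[u]] recovers it up to a unit. The lengths also show that it lies in [k[u]],
    although it is defined as a fraction. The Hilbert polynomial has degree [r], so its iterated
    difference along the [r.+1] multidegrees [d i] vanishes and the Koszul complex has Euler
    characteristic zero; with exactness in positive degrees this gives generic exactness in degree
    0. Monomials that are standard for [I] give bases both over [k] and over [k[u]], so all ranks
    are values of one Hilbert function. To compare consecutive multidegrees, a variable would not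
    do: on [k[x_0,x_1]/(x_0 x_1)] with one generic linear form, [x_0] kills the nonzero class of
    every power of [x_1]. New coefficients make a linear form regular in large multidegrees, and a
    prime of [k[u]] stays prime, with the same multiplicities, when they are adjoined. *)

Section IdealGen.
Variable R : comNzRingType.
Implicit Types (J : ideal R) (G : R -> Prop).

Lemma ideal_gen_mem G g : G g -> ideal_gen G g.
Proof.
move=> Gg; exists 1%N, (fun=> 1), (fun=> g); split=> //.
by rewrite big_ord1 mul1r.
Qed.

Lemma ideal_sum J (I : Type) (s : seq I) (P : pred I) (F : I -> R) :
  (forall i, P i -> J (F i)) -> J (\sum_(i <- s | P i) F i).
Proof.
by move=> JF; apply: big_ind => //; [exact: ideal0 | exact: idealD].
Qed.

Lemma ideal_gen_min G J : (forall g, G g -> J g) -> forall x, ideal_gen G x -> J x.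
Proof.
move=> GJ x [m [a [g [Gg ->]]]].
by apply: ideal_sum => i _; apply/idealM/GJ.
Qed.

Lemma idealN J x : J x -> J (- x).
Proof. by move=> Jx; rewrite -mulN1r; apply: idealM. Qed.

Lemma idealB J x y : J x -> J y -> J (x - y).
Proof. by move=> Jx Jy; apply: idealD => //; apply: idealN. Qed.

Lemma ideal_mulr J x a : J x -> J (x * a).
Proof. by rewrite mulrC; apply: idealM. Qed.

Lemma ideal_trans J x y : J (x - y) -> J y -> J x.
Proof. by move=> Jxy Jy; rewrite -(subrK y x); apply: idealD. Qed.

Definition finitely_generated J : Prop :=
  exists s : seq R, (forall g, g \in s -> J g) /\
    forall x, J x -> ideal_gen (fun g => g \in s) x.

Definition noetherian : Prop := forall J, finitely_generated J.

End IdealGen.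

Definition ideal_preim (R S : comNzRingType) (f : {rmorphism R -> S}) (J : ideal S) :
  ideal R.
Proof.
apply: (@Ideal R (fun x => J (f x))).
- by rewrite rmorph0; apply: ideal0.
- by move=> x y Jx Jy; rewrite rmorphD; apply: idealD.
- by move=> a x Jx; rewrite rmorphM; apply: idealM.
Defined.

Lemma noetherian_surj (R S : comNzRingType) (f : {rmorphism R -> S}) :
  (forall y, exists x, f x = y) -> noetherian R -> noetherian S.
Proof.
move=> fsurj noethR J; have [s [sJ Js]] := noethR (ideal_preim f J).
exists (map f s); split=> [_ /mapP[x xs ->]|y]; first exact: sJ.
have [x <-] := fsurj y; move=> /Js.
apply: (@ideal_gen_min _ _ (ideal_preim f (ideal_gen (fun g => g \in map f s)))).
by move=> g gs; apply: ideal_gen_mem; apply: map_f.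
Qed.

Lemma noetherian_field (F : fieldType) : noetherian F.
Proof.
move=> J; have [[x Jx x0]|J0] := pselect (exists2 x, J x & x != 0).
  exists [:: x]; split=> [_ /[!inE]/eqP ->//|y _].
  have -> : y = y / x * x by rewrite divfK.
  by apply: idealM; apply: ideal_gen_mem; rewrite inE.
exists [::]; split=> // x Jx; have [->|x0] := eqVneq x 0; first exact: ideal0.
by case: J0; exists x.
Qed.

Lemma choice_seq (T U : eqType) (s : seq T) (P : T -> U -> Prop) :
  (forall x, x \in s -> exists y, P x y) ->
  exists t : seq U, (forall y, y \in t -> exists2 x, x \in s & P x y) /\
                    (forall x, x \in s -> exists2 y, y \in t & P x y).
Proof.
elim: s => [|x s IHs] HP; first by exists [::].
have [|t [t1 t2]] := IHs; first by move=> z zs; apply: HP; rewrite inE zs orbT.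
have [|y Pxy] := HP x; first by rewrite inE eqxx.
exists (y :: t); split=> z; rewrite inE => /orP[/eqP->|].
- by exists x; rewrite ?inE ?eqxx.
- by move=> /t1[w ws Pw]; exists w; rewrite ?inE ?ws ?orbT.
- by exists y; rewrite ?inE ?eqxx.
- by move=> /t2[w ws Pw]; exists w; rewrite ?inE ?ws ?orbT.
Qed.

Section HilbertBasis.
Variable R : comNzRingType.
Implicit Types (J : ideal {poly R}).

(** A bound on [size f], rather than degree exactly [n], lets 0 and cancellations in, so that this
    set is an ideal. *)
Definition lead_ideal J (n : nat) : ideal R.
Proof.
apply: (@Ideal R (fun c => exists f, [/\ J f, (size f <= n.+1)%N & f`_n = c])).
- by exists 0; rewrite size_poly0 coef0; split=> //; apply: ideal0.
- move=> _ _ [f [Jf sf <-]] [g [Jg sg <-]]; exists (f + g); split.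
  + exact: idealD.
  + by apply: leq_trans (size_polyD _ _) _; rewrite geq_max sf sg.
  + by rewrite coefD.
- move=> a _ [f [Jf sf <-]]; exists (a%:P * f); split; first exact: idealM.
  + by rewrite mul_polyC; apply: leq_trans (size_scale_leq _ _) _.
  + by rewrite coefCM.
Defined.

Lemma lead_idealS J n m c : (n <= m)%N -> lead_ideal J n c -> lead_ideal J m c.
Proof.
move=> nm [f [Jf sf <-]]; exists ('X^(m - n) * f); split; first exact: idealM.
  apply: leq_trans (size_polyMleq _ _) _; rewrite size_polyXn addSn /=.
  by rewrite -(leq_add2l (m - n)) addnS subnK in sf.
by rewrite coefXnM ltnNge leq_subr /= subKn.
Qed.

(** These ideals increase with [n], so their union is an ideal, and its finitely many generators all
    occur at one stage [N]. *)
Lemma lead_ideal_stable J : noetherian R ->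
  exists N, forall n c, lead_ideal J n c -> lead_ideal J N c.
Proof.
move=> noethR.
have [U UE] : exists U : ideal R, forall c, U c <-> exists n, lead_ideal J n c.
  unshelve eexists (@Ideal R (fun c => exists n, lead_ideal J n c) _ _ _) => //.
  - by exists 0%N; apply: ideal0.
  - move=> x y [n nx] [m my]; exists (maxn n m); apply: idealD.
      exact: lead_idealS (leq_maxl _ _) nx.
    exact: lead_idealS (leq_maxr _ _) my.
  - by move=> a x [n nx]; exists n; apply: idealM.
have [s [sU Us]] := noethR U.
suff [N sN] : exists N, forall c, c \in s -> lead_ideal J N c.
  exists N => n c cn; apply: (@ideal_gen_min _ (fun g => g \in s)) => //.
  by apply/Us/UE; exists n.
elim: s sU {Us} => [|x s IHs] sU; first by exists 0%N.
have [|N sN] := IHs; first by move=> g gs; apply: sU; rewrite inE gs orbT.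
have [|n xn] := (UE x).1 (sU x _); first by rewrite inE eqxx.
exists (maxn n N) => c /[!inE] /orP[/eqP ->|/sN cN].
  exact: lead_idealS (leq_maxl _ _) xn.
exact: lead_idealS (leq_maxr _ _) cN.
Qed.

Lemma ideal_gen_sub (G G' : {poly R} -> Prop) : (forall g, G g -> G' g) ->
  forall x, ideal_gen G x -> ideal_gen G' x.
Proof. by move=> GG'; apply: ideal_gen_min => g /GG'; apply: ideal_gen_mem. Qed.

Lemma lead_ideal_gens J n : noetherian R ->
  exists t : seq {poly R}, (forall g, g \in t -> J g) /\
    forall c, lead_ideal J n c -> lead_ideal (ideal_gen (fun g => g \in t)) n c.
Proof.
move=> noethR; have [s [sJ Js]] := noethR (lead_ideal J n).
have [t [t1 t2]] := choice_seq sJ.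
exists t; split=> [g /t1[x _ []] //|c /Js].
apply: ideal_gen_min => g /t2[f ft [Jf sf fg]]; exists f; split=> //.
exact: ideal_gen_mem.
Qed.

Lemma lead_ideal_gens_le J N : noetherian R ->
  exists t : seq {poly R}, (forall g, g \in t -> J g) /\
    forall n c, (n <= N)%N -> lead_ideal J n c ->
      lead_ideal (ideal_gen (fun g => g \in t)) n c.
Proof.
move=> noethR; elim: N => [|N [t [tJ Jt]]].
  have [t [tJ Jt]] := lead_ideal_gens J 0 noethR.
  by exists t; split=> // n c; rewrite leqn0 => /eqP->; apply: Jt.
have [t' [t'J Jt']] := lead_ideal_gens J N.+1 noethR.
exists (t ++ t'); split=> [g|n c].
  by rewrite mem_cat => /orP[/tJ|/t'J].
rewrite leq_eqVlt ltnS => /orP[/eqP->|nN] Jc.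
  have [f [tf sf fc]] := Jt' _ Jc; exists f; split=> //; move: tf.
  by apply: ideal_gen_sub => g gt; rewrite mem_cat gt orbT.
have [f [tf sf fc]] := Jt _ _ nN Jc; exists f; split=> //; move: tf.
by apply: ideal_gen_sub => g gt; rewrite mem_cat gt.
Qed.

(* Generators of the ideals of leading coefficients in degrees [<= N], beyond
   which these ideals are stationary, suffice. *)
Theorem noetherian_poly : noetherian R -> noetherian {poly R}.
Proof.
move=> noethR J; have [N JN] := lead_ideal_stable J noethR.
have [t [tJ Jt]] := lead_ideal_gens_le J N noethR.
exists t; split=> // f; have [m] := ubnP (size f).
elim: m f => // m IHm f; rewrite ltnS => sf Jf.
have [->|f0] := eqVneq f 0; first exact: ideal0.
set n := (size f).-1; have sfE : size f = n.+1 by rewrite prednK // size_poly_gt0.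
have [g [tg sg gf]] : lead_ideal (ideal_gen (fun g => g \in t)) n f`_n.
  have Jf1 : lead_ideal J n f`_n by exists f; rewrite sfE.
  have [nN|/ltnW Nn] := leqP n N; first exact: Jt.
  exact/(lead_idealS Nn)/Jt/JN/Jf1.
rewrite -(subrK g f); apply: idealD => //.
have Jg : J g by apply: ideal_gen_min tg.
apply: IHm; last exact: idealB.
rewrite (leq_trans _ sf) // sfE ltnS; apply/leq_sizeP => j nj.
move: nj; rewrite leq_eqVlt => /orP[/eqP<-|nj]; first by rewrite coefB gf subrr.
by rewrite coefB !nth_default ?subrr // ?sfE // (leq_trans sg).
Qed.

End HilbertBasis.

Lemma mpoly_rmorph_ext (R : comNzRingType) (S : comNzRingType) n
    (f g : {rmorphism {mpoly R[n]} -> S}) :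
  (forall c, f c%:MP = g c%:MP) -> (forall i, f 'X_i = g 'X_i) -> f =1 g.
Proof.
move=> fgC fgX; elim/mpolyind=> [|c m p _ _ IHp]; first by rewrite !rmorph0.
rewrite !rmorphD IHp -mul_mpolyC !rmorphM fgC mpolyXE_id !rmorph_prod.
by congr (_ * _ + _); apply: eq_bigr => i _; rewrite !rmorphXn fgX.
Qed.

(** Inverse of [muni]: the variable of the univariate polynomial becomes the last of the [n.+1]
    variables. It carries univariate results over by induction on the number of variables. *)
Definition mpoly_of_poly (R : comNzRingType) n : {poly {mpoly R[n]}} -> {mpoly R[n.+1]} :=
  fun p => (map_poly (@mwiden n R) p).['X_ord_max].

Section MpolyOfPoly.
Variables (R : comNzRingType) (n : nat).
Local Notation mpoly_of_poly := (@mpoly_of_poly R n).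

Lemma mpoly_of_poly_is_zmod_morphism : zmod_morphism mpoly_of_poly.
Proof. by move=> p p'; rewrite /mpoly_of_poly rmorphB hornerD hornerN. Qed.

Lemma mpoly_of_poly_is_monoid_morphism : monoid_morphism mpoly_of_poly.
Proof.
split; first by rewrite /mpoly_of_poly rmorph1 hornerC.
by move=> p p'; rewrite /mpoly_of_poly rmorphM hornerM.
Qed.

HB.instance Definition _ := GRing.isZmodMorphism.Build {poly {mpoly R[n]}}
  {mpoly R[n.+1]} mpoly_of_poly mpoly_of_poly_is_zmod_morphism.
HB.instance Definition _ := GRing.isMonoidMorphism.Build {poly {mpoly R[n]}}
  {mpoly R[n.+1]} mpoly_of_poly mpoly_of_poly_is_monoid_morphism.

Lemma muniX (i : 'I_n) : muni ('X_(widen_ord (leqnSn n) i) : {mpoly R[n.+1]}) = ('X_i)%:P.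
Proof.
rewrite /muni mmapX mmap1U; case: splitP => [j /= ij|j].
  by congr ('X__)%:P; apply: val_inj.
by rewrite /= ord1 addn0 => /eqP; rewrite ltn_eqF.
Qed.

Lemma muniXmax : muni ('X_ord_max : {mpoly R[n.+1]}) = 'X.
Proof.
rewrite /muni mmapX mmap1U; case: splitP => // j /= ij.
by have := ltn_ord j; rewrite -ij ltnn.
Qed.

Lemma muni_mwiden (p : {mpoly R[n]}) : muni (mwiden p) = p%:P.
Proof.
apply: (@mpoly_rmorph_ext _ _ _ (@muni n R \o @mwiden n R) polyC) => [c|i] /=.
  by rewrite mwidenC muniC.
by rewrite mwidenX mnmwiden1 muniX.
Qed.

Lemma mpoly_of_polyC p : mpoly_of_poly p%:P = mwiden p.
Proof. by rewrite /mpoly_of_poly map_polyC hornerC. Qed.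

Lemma mpoly_of_polyX : mpoly_of_poly 'X = 'X_ord_max.
Proof. by rewrite /mpoly_of_poly map_polyX hornerX. Qed.

Lemma mpoly_of_polyK : cancel mpoly_of_poly (@muni n R).
Proof.
elim/poly_ind=> [|p c IHp]; first by rewrite !rmorph0.
by rewrite !(rmorphD, rmorphM) /= IHp mpoly_of_polyC mpoly_of_polyX muniXmax muni_mwiden.
Qed.

Lemma muniK : cancel (@muni n R) mpoly_of_poly.
Proof.
move=> p; apply: (@mpoly_rmorph_ext _ _ _ (mpoly_of_poly \o @muni n R) idfun) => [c|i] /=.
  by rewrite muniC mpoly_of_polyC mwidenC.
have [j ->|->] := unliftP ord_max i; last by rewrite muniXmax mpoly_of_polyX.
have -> : lift ord_max j = widen_ord (leqnSn n) j.
  by apply: val_inj; rewrite /= /bump leqNgt ltn_ord.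
by rewrite muniX mpoly_of_polyC mwidenX mnmwiden1.
Qed.

End MpolyOfPoly.

Theorem noetherian_mpoly (R : comNzRingType) n : noetherian R -> noetherian {mpoly R[n]}.
Proof.
move=> noethR; elim: n => [|n IHn].
  apply: (@noetherian_surj _ _ (@mpolyC 0 R)) => // p.
  by exists p@_0%MM; apply: mpolyKC.
have noethP := noetherian_poly IHn.
apply: (@noetherian_surj {poly {mpoly R[n]}} {mpoly R[n.+1]} (@mpoly_of_poly R n)) => // p.
by exists (muni p); apply: muniK.
Qed.

(** * Unique factorization of polynomials over a field *)

(** Unique factorization is cut in two. Primality of irreducibles passes from [A] to [{poly A}] by
    Gauss's lemma; factorizations are obtained separately, by induction on the degree over a
    field. *)
Definition irreducibles_prime (A : idomainType) : Prop :=
  forall p : A, irreducible_elt p -> prime_elt p.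

Definition factorizable (A : idomainType) : Prop :=
  forall a : A, a != 0 -> exists s : seq A,
    (forall p, p \in s -> irreducible_elt p) /\ associated a (\prod_(p <- s) p).

Lemma divides_refl (A : idomainType) (a : A) : divides a a.
Proof. by exists 1; rewrite mul1r. Qed.

Lemma divides_mull (A : idomainType) (a b c : A) : divides a c -> divides a (b * c).
Proof. by move=> [x ->]; exists (b * x); rewrite mulrA. Qed.

Lemma divides_mulr (A : idomainType) (a b c : A) : divides a b -> divides a (b * c).
Proof. by rewrite mulrC; apply: divides_mull. Qed.

Lemma divides0 (A : idomainType) (a : A) : divides a 0.
Proof. by exists 0; rewrite mul0r. Qed.

Lemma dividesD (A : idomainType) (a b c : A) :
  divides a b -> divides a c -> divides a (b + c).
Proof. by move=> [x ->] [y ->]; exists (x + y); rewrite mulrDl. Qed.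

Lemma dividesN (A : idomainType) (a b : A) : divides a b -> divides a (- b).
Proof. by move=> [x ->]; exists (- x); rewrite mulNr. Qed.

Lemma divides_sum (A : idomainType) (a : A) (I : Type) (s : seq I) (P : pred I) F :
  (forall i, P i -> divides a (F i)) -> divides a (\sum_(i <- s | P i) F i).
Proof.
by move=> aF; apply: big_ind => //; [exact: divides0 | exact: dividesD].
Qed.

Lemma dividesDr (A : idomainType) (a b c : A) :
  divides a (b + c) -> divides a b -> divides a c.
Proof. by move=> abc /dividesN ab; rewrite -(addKr b c); apply: dividesD. Qed.

Lemma divides_unit (A : idomainType) (p u : A) :
  u \is a GRing.unit -> divides p u -> p \is a GRing.unit.
Proof. by move=> uU [c uE]; move: uU; rewrite uE unitrM => /andP[]. Qed.

Lemma prime_eltM (A : idomainType) (p a b : A) :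
  prime_elt p -> divides p (a * b) -> divides p a \/ divides p b.
Proof. by case=> _ _; apply. Qed.

Lemma prime_elt_neq0 (A : idomainType) (p : A) : prime_elt p -> p != 0.
Proof. by case. Qed.

Lemma prime_irreducible (A : idomainType) (p : A) : prime_elt p -> irreducible_elt p.
Proof.
move=> [p0 pU pM]; split=> // a b pE; have [|[c aE]|[c bE]] := pM a b.
- by rewrite -pE; apply: divides_refl.
- right; apply/unitrPr; exists c; apply: (mulfI p0).
  by rewrite mulr1 {2}pE aE; ring.
- left; apply/unitrPr; exists c; apply: (mulfI p0).
  by rewrite mulr1 {2}pE bE; ring.
Qed.

Section Gauss.
Variables (A : idomainType).
Implicit Types (f g h p : {poly A}).

Lemma divides_polyC (c : A) f : divides c%:P f <-> forall i, divides c f`_i.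
Proof.
split=> [[g ->] i|cf]; first by rewrite coefMC; exists g`_i.
have /choice[g gE] : forall i, exists x, f`_i = x * c by move=> i; apply: cf.
exists (\poly_(i < size f) g i); apply/polyP => i.
rewrite coefMC coef_poly; case: ltnP => [_|/(nth_default 0) ->]; first exact: gE.
by rewrite mul0r.
Qed.

(** Let [i] and [j] be the first indices at which [c] does not divide a coefficient of [f] and of
    [g]. In degree [i + j] the coefficient of the product is [f_i * g_j] plus multiples of [c]. *)
Lemma prime_polyC (c : A) : prime_elt c -> prime_elt c%:P.
Proof.
move=> [c0 cU cM]; split=> [||f g fg].
- by rewrite polyC_eq0.
- by rewrite poly_unitE coefC /= (negbTE cU) andbF.
apply: contrapT => /not_orP[cf cg].
have first_coef h : ~ divides c%:P h ->
    exists i, ~ divides c h`_i /\ forall j, (j < i)%N -> divides c h`_j.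
  move=> ch; have : exists i, ~~ `[< divides c h`_i >].
    apply: contrapT => /forallNP ci; apply/ch/divides_polyC => i.
    by have /negP := ci i; rewrite negbK => /asboolP.
  move=> exi; case: (ex_minnP exi) => i /negP ci mini; exists i; split.
    by move=> /asboolP.
  by move=> j ji; apply/asboolP; apply: contraLR ji => /mini; rewrite -leqNgt.
have [i [ci ltci]] := first_coef f cf; have [j [cj ltcj]] := first_coef g cg.
have /divides_polyC/(_ (i + j)%N) := fg; rewrite coefM.
have ij : (i < (i + j).+1)%N by rewrite ltnS leq_addr.
rewrite (bigD1 (Ordinal ij)) //= addKn addrC => /dividesDr cD.
suff /cD/cM[/ci//|/cj//] : divides c (\sum_(l < (i + j).+1 | l != Ordinal ij) f`_l * g`_(i + j - l)).
apply: divides_sum => l; rewrite -val_eqE /= neq_ltn => /orP[li|il].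
  exact/divides_mulr/ltci.
apply/divides_mull/ltcj; rewrite ltn_subLR; last by rewrite -ltnS.
by rewrite ltn_add2r.
Qed.

Hypotheses (irrA : irreducibles_prime A) (facA : factorizable A).

(** The primes in a factorization of [c] are cancelled one at a time: each divides [p * h], hence
    [h], since [p] is primitive. *)
Lemma divides_scale_primitive p h g c : c != 0 ->
  (forall a, prime_elt a -> ~ divides a%:P p) -> c *: g = p * h -> divides p g.
Proof.
move=> c0 primp; have [s [irrs [u uU ->]]] := facA c0.
rewrite -scalerA => cg.
have {cg} : (\prod_(x <- s) x) *: g = p * (u^-1 *: h).
  by rewrite -scalerAr -cg !scalerA mulKr.
move: (u^-1 *: h) => {}h; elim: s irrs h => [|x s IHs] irrs h.
  by rewrite big_nil scale1r => ->; exists h; rewrite mulrC.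
have xP : prime_elt x by apply/irrA/irrs; rewrite inE eqxx.
rewrite big_cons -scalerA => E.
have [||[h' h'E]] := @prime_eltM _ _ p h (prime_polyC xP).
- by exists (\prod_(y <- s) y *: g); rewrite -E -mul_polyC mulrC.
- by move=> /(primp _ xP).
apply: (IHs _ h') => [y ys|]; first by apply: irrs; rewrite inE ys orbT.
have x0 : x%:P != 0 by rewrite polyC_eq0 prime_elt_neq0.
by apply: (mulfI x0); rewrite mul_polyC E h'E; ring.
Qed.

(** Each prime of [c] is cancelled from one of the two factors; those cancelled from [g] make up
    [a]. *)
Lemma factor_scale p q g c : c != 0 -> c *: p = q * g ->
  exists q' g', p = q' * g' /\ exists2 a, a != 0 & g = a *: g'.
Proof.
move=> c0; have [s [irrs [u uU ->]]] := facA c0.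
rewrite -scalerA => cp.
have {cp} : (\prod_(x <- s) x) *: p = (u^-1 *: q) * g.
  by rewrite -scalerAl -cp !scalerA mulKr.
move: (u^-1 *: q) => {}q; elim: s irrs q g => [|x s IHs] irrs q g.
  rewrite big_nil scale1r => ->; exists q, g; split=> //.
  by exists 1; rewrite ?oner_neq0 ?scale1r.
have xP : prime_elt x by apply/irrA/irrs; rewrite inE eqxx.
have {}irrs y : y \in s -> irreducible_elt y by move=> ys; apply: irrs; rewrite inE ys orbT.
have x0 : x%:P != 0 by rewrite polyC_eq0 prime_elt_neq0.
rewrite big_cons -scalerA => E.
have [|[q1 qE]|[g1 gE]] := @prime_eltM _ _ q g (prime_polyC xP).
- by exists (\prod_(y <- s) y *: p); rewrite -E -mul_polyC mulrC.
- by apply: (IHs irrs q1 g); apply: (mulfI x0); rewrite mul_polyC E qE; ring.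
have [|q' [g' [pE [a a0 g1E]]]] := IHs irrs q g1.
  by apply: (mulfI x0); rewrite mul_polyC E gE; ring.
exists q', g'; split=> //; exists (x * a); first by rewrite mulf_neq0 // prime_elt_neq0.
by rewrite gE g1E mulrC mul_polyC scalerA.
Qed.

Import Pdiv.IdomainDefs Pdiv.WeakIdomain.

Lemma irreducible_primitive p : irreducible_elt p -> (1 < size p)%N ->
  forall a, prime_elt a -> ~ divides a%:P p.
Proof.
move=> [p0 pU pM] sp a [a0 aU _] [b pE]; have [] := pM _ _ pE.
  rewrite poly_unitE => /andP[/eqP sb _]; move: sp; rewrite pE.
  by rewrite mulrC mul_polyC size_scale // sb.
by rewrite poly_unitE coefC (negbTE aU) andbF.
Qed.

Theorem irreducibles_prime_poly : irreducibles_prime {poly A}.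
Proof.
move=> p pirr; have [p0 pU pM] := pirr.
have [sp|sp] := leqP (size p) 1.
  rewrite (size1_polyC sp) in pirr *; apply/prime_polyC/irrA.
  have [c0 cU cM] := pirr; split.
  - by rewrite -polyC_eq0.
  - by move: cU; rewrite poly_unitE coefC size_polyC -polyC_eq0 c0.
  - move=> a b abE; have := cM a%:P b%:P; rewrite -polyCM abE => /(_ erefl).
    by rewrite !poly_unitE !coefC /= => -[/andP[_ aU]|/andP[_ bU]]; [left|right].
have primp := irreducible_primitive pirr sp.
(* [%|] is divisibility up to a nonzero scalar, that is, over the fraction field; primitivity of [p]
   removes the scalar. *)
have divp g : p %| g -> divides p g.
  move=> /dvdpP[[c q] /= c0 cg]; apply: (divides_scale_primitive (h := q) c0 primp).
  by rewrite cg mulrC.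
split=> // f g [h fgE].
have fg : p %| f * g by apply/dvdpP; exists (1, h); rewrite ?oner_neq0 ?scale1r.
have [cop|ncop] := boolP (coprimep p f).
  by right; apply: divp; rewrite -(Gauss_dvdpr _ cop).
(* The gcd of [p] and [f] is, up to a scalar, a factor [g'] of [p]. By irreducibility either [g'] is
   associated to [p], or the gcd is constant, against [ncop]. *)
left; apply: divp; have /dvdpP[[c q] /= c0 cp] := dvdp_gcdl p f.
have [q' [g' [pE [a a0 gE]]]] := factor_scale c0 cp.
have g'f : g' %| f.
  by apply: dvdp_trans (dvdp_gcdr p f); rewrite gE dvdpZr.
have [q'U|g'U] := pM _ _ pE.
  rewrite pE; apply: dvdp_trans g'f; apply/dvdpP; exists (1, q'^-1).
    exact: oner_neq0.
  by rewrite scale1r mulKr.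
move: ncop; rewrite coprimep_def gE size_scale //.
by move: g'U; rewrite poly_unitE => /andP[->].
Qed.

End Gauss.

Section Isomorphism.
Variables (A B : idomainType) (f : {rmorphism A -> B}) (g : {rmorphism B -> A}).
Hypotheses (fK : cancel f g) (gK : cancel g f).

Lemma divides_iso a b : divides (f a) (f b) -> divides a b.
Proof.
by move=> [c fbE]; exists (g c); apply: (can_inj fK); rewrite rmorphM gK fbE.
Qed.

Lemma iso_unit a : f a \is a GRing.unit -> a \is a GRing.unit.
Proof. by move=> /(rmorph_unit g); rewrite fK. Qed.

Lemma prime_elt_iso a : prime_elt (f a) -> prime_elt a.
Proof.
move=> [a0 aU aM]; split.
- by apply: contraNneq a0 => ->; rewrite rmorph0.
- by apply: contra aU => /(rmorph_unit f).
- move=> x y [z xyE]; have [|/divides_iso ?|/divides_iso ?] := aM (f x) (f y); [|by left|by right].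
  by exists (f z); rewrite -!rmorphM xyE.
Qed.

End Isomorphism.

Lemma irreducibles_prime_iso (A B : idomainType) (f : {rmorphism A -> B})
    (g : {rmorphism B -> A}) (fK : cancel f g) (gK : cancel g f) :
  irreducibles_prime A -> irreducibles_prime B.
Proof.
move=> irrA p [p0 pU pM]; apply: (prime_elt_iso gK fK); apply: irrA; split.
- by apply: contraNneq p0 => gp0; rewrite -(gK p) gp0 rmorph0.
- by apply: contra pU => /(iso_unit gK).
- move=> a b gpE; have [|aU|bU] := pM (f a) (f b).
  + by rewrite -rmorphM -gpE gK.
  + by left; apply: iso_unit fK _ aU.
  + by right; apply: iso_unit fK _ bU.
Qed.

Lemma mpolyC_unit (F : fieldType) n (c : F) : c != 0 ->
  (c%:MP : {mpoly F[n]}) \is a GRing.unit.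
Proof.
by move=> c0; apply/unitrPr; exists (c^-1)%:MP; rewrite -mpolyCM divff.
Qed.

Lemma mpoly_unitP (F : fieldType) n (u : {mpoly F[n]}) : u \is a GRing.unit ->
  exists2 a : F, a != 0 & u = a%:MP.
Proof.
move=> uU; have /andP[/eqP uE _] := uU; exists u@_0%MM => //.
by apply: contraTneq uU => u0; rewrite uE u0 mpolyC0 unitr0.
Qed.

Theorem factorizable_mpoly (F : fieldType) n : factorizable {mpoly F[n]}.
Proof.
move=> a a0; have [m] := ubnP (msize a); elim: m a a0 => // m IHm a a0 am.
have [aU|aU] := boolP (a \is a GRing.unit).
  by exists [::]; split=> //; exists a => //; rewrite big_nil mulr1.
have [airr|] := pselect (irreducible_elt a).
  exists [:: a]; split=> [p|]; first by rewrite inE => /eqP->.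
  by exists 1; rewrite ?unitr1 // big_seq1 mul1r.
move=> nirr; have [b [c [aE bU cU]]] : exists b c, [/\ a = b * c,
    b \isn't a GRing.unit & c \isn't a GRing.unit].
  apply: contrapT => Nbc; apply: nirr; split=> // b c aE.
  have [|bU] := boolP (b \is a GRing.unit); first by left.
  have [|cU] := boolP (c \is a GRing.unit); first by right.
  by case: Nbc; exists b, c.
move: a0; rewrite aE mulf_eq0 => /norP[b0 c0].
have size_nonunit (p : {mpoly F[n]}) : p != 0 -> p \isn't a GRing.unit -> (1 < msize p)%N.
  move=> p0; apply: contraR; rewrite -leqNgt => /msize1_polyC pE.
  by rewrite pE; apply: mpolyC_unit; rewrite -(mpolyC_eq0 n) -pE.
have sb := size_nonunit b b0 bU; have sc := size_nonunit c c0 cU.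
move: am; rewrite aE msizeM // => am.
have [||s [irrs [u uU bE]]] := IHm b => //.
  by move: am sb sc; case: (msize b) (msize c) => [|x] [|[|y]] //=; lia.
have [||t [irrt [v vU cE]]] := IHm c => //.
  by move: am sb sc; case: (msize b) (msize c) => [|[|x]] [|y] //=; lia.
exists (s ++ t); split=> [p|].
  by rewrite mem_cat => /orP[/irrs|/irrt].
by exists (u * v); rewrite ?unitrM ?uU // big_cat bE cE /=; ring.
Qed.

Theorem irreducibles_prime_mpoly (F : fieldType) n : irreducibles_prime {mpoly F[n]}.
Proof.
elim: n => [|n IHn].
  by move=> p [p0]; rewrite -(mpolyKC p) mpolyC_unit // -(mpolyC_eq0 0) mpolyKC.
have IHp := irreducibles_prime_poly IHn (@factorizable_mpoly F n).
apply: (@irreducibles_prime_iso {poly {mpoly F[n]}} {mpoly F[n.+1]}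
  (@mpoly_of_poly F n) (@muni n F)) IHp.
  exact: mpoly_of_polyK.
exact: muniK.
Qed.

(** Used for the new coefficients of the auxiliary linear form: adjoining them must not split a
    prime. *)
Lemma prime_mpolyC (A : idomainType) n (c : A) :
  prime_elt c -> prime_elt (c%:MP : {mpoly A[n]}).
Proof.
elim: n => [|n IHn] cP.
  apply: (@prime_elt_iso {mpoly A[0]} A (@mcoeff 0 A 0%MM) (@mpolyC 0 A)).
  - exact: mpolyKC.
  - exact: mpolyCK.
  - by rewrite /= mpolyCK.
apply: (@prime_elt_iso {mpoly A[n.+1]} {poly {mpoly A[n]}} (@muni n A) (@mpoly_of_poly A n)).
- exact: muniK.
- exact: mpoly_of_polyK.
- by rewrite /= muniC; apply/prime_polyC/IHn.
Qed.

(** * Multiplicities *)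

Section ResidueDomain.
Variables (A : idomainType) (p : A) (pP : prime_elt p).

(** The proof of primality is an argument of the predicate so that its ideal and prime ideal
    structures can be declared as instances. *)
Definition multiple_pred of prime_elt p : pred A := fun x => `[< divides p x >].
Local Notation S := (multiple_pred pP).

Lemma multiple_idealr_closed : idealr_closed S.
Proof.
split=> [||a x y /asboolP px /asboolP py]; first exact/asboolP/divides0.
  by apply/asboolP => p1; case: pP => _ /negP pU _; apply/pU/(divides_unit (unitr1 A)).
by apply/asboolP/dividesD => //; apply: divides_mull.
Qed.

Lemma multiple_prime_ideal : prime_idealr_closed S.
Proof.
by move=> x y /asboolP/(prime_eltM pP)[px|py]; apply/orP; [left|right]; apply/asboolP.
Qed.

HB.instance Definition _ := isIdealr.Build A S multiple_idealr_closed.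
HB.instance Definition _ := isPrimeIdealrClosed.Build A S multiple_prime_ideal.

Definition multiple_ideal : prime_idealr A := S.
Definition residue_ring := {ideal_quot multiple_ideal}.
HB.instance Definition _ := GRing.ComNzRing.on residue_ring.

(** An [idomainType] includes units and inverses, here chosen classically. The domain structure on
    [A/p] is what [det0P] requires for matrices modulo [p]. *)
Definition residue_unit : pred residue_ring := fun x => `[< exists y, y * x = 1 >].
Definition residue_inv (x : residue_ring) : residue_ring :=
  if pselect (exists y, y * x = 1) is left ex then sval (cid ex) else x.

Lemma residue_mulVr : {in residue_unit, left_inverse 1 residue_inv *%R}.
Proof.
by move=> x /asboolP xU; rewrite /residue_inv; case: pselect => // ex; case: cid.
Qed.

Lemma residue_unitP x y : y * x = 1 -> x \in residue_unit.
Proof. by move=> yx; apply/asboolP; exists y. Qed.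

Lemma residue_inv_out : {in [predC residue_unit], residue_inv =1 id}.
Proof. by move=> x /negP xU; rewrite /residue_inv; case: pselect => // ex; case: xU; apply/asboolP. Qed.

HB.instance Definition _ := GRing.ComNzRing_hasMulInverse.Build residue_ring
  residue_mulVr residue_unitP residue_inv_out.
HB.instance Definition _ := GRing.ComUnitRing_isIntegral.Build residue_ring
  (@Quotient.rquot_IdomainAxiom A multiple_ideal).

Definition residue (x : A) : residue_ring := \pi_{ideal_quot multiple_ideal}%qT x.

Lemma residue_is_zmod_morphism : zmod_morphism residue.
Proof. exact: raddfB. Qed.

Lemma residue_is_monoid_morphism : monoid_morphism residue.
Proof. by split; [exact: rmorph1 | exact: rmorphM]. Qed.

HB.instance Definition _ := GRing.isZmodMorphism.Build A residue_ring residue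
  residue_is_zmod_morphism.
HB.instance Definition _ := GRing.isMonoidMorphism.Build A residue_ring residue
  residue_is_monoid_morphism.

Lemma residue_eq0 x : residue x = 0 <-> divides p x.
Proof.
have -> : residue x = 0 <-> residue x == residue 0 by rewrite rmorph0; split=> /eqP.
rewrite /residue -Quotient.idealrBE subr0.
by split=> [/asboolP|?]; last exact/asboolP.
Qed.

Lemma residue_surj y : exists x, residue x = y.
Proof. by exists (repr y); rewrite /residue reprK. Qed.

End ResidueDomain.

(** Modulo [p] the determinant vanishes, so there is a nonzero kernel row over the domain [A/p]; [y]
    lifts its coefficients. *)
Lemma det_mod_prime (A : idomainType) (p : A) n (B : 'M[A]_n) :
  prime_elt p -> divides p (\det B) ->
  exists y : 'rV[A]_n, (exists i, ~ divides p (y 0 i)) /\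
    exists x : 'rV[A]_n, y *m B = p *: x.
Proof.
move=> pP /(residue_eq0 pP); rewrite -det_map_mx => /eqP/det0P[v /rV0Pn[i v0] vB].
have /choice[y yE] : forall j, exists x, residue pP x = v 0 j.
  by move=> j; apply: residue_surj.
exists (\row_j y j); split.
  by exists i; rewrite mxE => /(residue_eq0 pP); rewrite yE; apply/eqP.
have /choice[x xE] : forall j, exists x, ((\row_j y j) *m B) 0 j = x * p.
  move=> j; apply/(residue_eq0 pP); rewrite !mxE rmorph_sum.
  move/rowP/(_ j): vB; rewrite !mxE => vBj; rewrite -[RHS]vBj; apply: eq_bigr => l _.
  by rewrite !mxE rmorphM -yE.
by exists (\row_j x j); apply/rowP => j; rewrite xE !mxE mulrC.
Qed.

Definition exact_power (A : idomainType) (p a : A) (e : nat) : Prop :=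
  exists2 b, ~ divides p b & a = p ^+ e * b.

(** The default 0 covers elements without an exact power, such as [a = 0]. *)
Definition mult (A : idomainType) (p a : A) : nat :=
  if pselect (exists e, exact_power p a e) is left h then sval (cid h) else 0%N.

(** The powers of [p] intersect in 0. This stands in for the localization at [p] being a discrete
    valuation ring, and makes [mult] meaningful on all nonzero elements when [p] is prime. *)
Definition separated (A : idomainType) (p : A) : Prop :=
  forall a, a != 0 -> exists e, ~ divides (p ^+ e) a.

Section Multiplicity.
Variables (A : idomainType) (p : A) (pP : prime_elt p).
Implicit Types a b : A.

Lemma exact_power_uniq a e e' : exact_power p a e -> exact_power p a e' -> e = e'.
Proof.
wlog le_ee' : e e' / (e <= e')%N.
  by move=> H ae ae'; have [/H->|/ltnW/H->] := leqP e e'.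
move=> [b pb ->] [b' pb' E]; apply/eqP; rewrite eqn_leq le_ee' leqNgt /=.
apply/negP => lt_ee'; apply: pb; exists (p ^+ (e' - e).-1 * b').
have pe0 : p ^+ e != 0 by rewrite expf_neq0 // prime_elt_neq0.
apply: (mulfI pe0); rewrite E -{1}(subnKC le_ee') exprD.
by rewrite -{1}(prednK (n := (e' - e)%N)) ?subn_gt0 // exprS; ring.
Qed.

Lemma mult_eq a e : exact_power p a e -> mult p a = e.
Proof.
move=> ae; rewrite /mult; case: pselect => [h|[]]; last by exists e.
exact: exact_power_uniq (svalP (cid h)) ae.
Qed.

Lemma mult_ndivides a : ~ divides p a -> mult p a = 0%N.
Proof. by move=> pa; apply: mult_eq; exists a; rewrite ?expr0 ?mul1r. Qed.

Hypothesis sepp : separated p.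

Lemma multP a : a != 0 -> exact_power p a (mult p a).
Proof.
move=> a0; suff [e ae] : exists e, exact_power p a e by rewrite (mult_eq ae).
have [e] := sepp a0; elim: e => [|e IHe] pea.
  by case: pea; exists a; rewrite expr0 mulr1.
have [[b aE]|/IHe//] := pselect (divides (p ^+ e) a).
exists e, b; last by rewrite aE mulrC.
by move=> [c bE]; apply: pea; exists c; rewrite aE bE exprS mulrA.
Qed.

Lemma multM a b : a != 0 -> b != 0 -> mult p (a * b) = (mult p a + mult p b)%N.
Proof.
move=> a0 b0; have [x px aE] := multP a0; have [y py bE] := multP b0.
apply: mult_eq; exists (x * y); first by case/(prime_eltM pP).
by rewrite {1}aE {1}bE exprD; ring.
Qed.

Lemma mult_prime : mult p p = 1%N.
Proof.
apply: mult_eq; exists 1; last by rewrite expr1 mulr1.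
by case: pP => _ /negP pU _ /(divides_unit (unitr1 A)).
Qed.

Lemma mult_gt0 a : a != 0 -> (0 < mult p a)%N -> divides p a.
Proof.
move=> a0; have [b _] := multP a0; case: (mult p a) => // e -> _.
by exists (p ^+ e * b); rewrite exprS; ring.
Qed.

Lemma mult_unit a : a \is a GRing.unit -> mult p a = 0%N.
Proof.
by move=> aU; apply: mult_ndivides => /(divides_unit aU); apply/negP; case: pP.
Qed.

Lemma multX a n : a != 0 -> mult p (a ^+ n) = (n * mult p a)%N.
Proof.
move=> a0; elim: n => [|n IHn]; first by rewrite expr0 mult_unit ?unitr1.
by rewrite exprS multM ?expf_neq0 // IHn mulSn.
Qed.

End Multiplicity.

(** * Local length of the cokernel of a matrix *)

Definition set_row (R : Type) m n (B : 'M[R]_(m, n)) (i : 'I_m) (x : 'rV[R]_n) : 'M[R]_(m, n) :=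
  \matrix_(j, l) if j == i then x 0 l else B j l.

Lemma row_set_row (R : Type) m n (B : 'M[R]_(m, n)) i x j :
  row j (set_row B i x) = if j == i then x else row j B.
Proof. by apply/rowP => l; rewrite !mxE; case: eqP => // _; rewrite mxE. Qed.

Lemma det_set_row (R : comNzRingType) n (B : 'M[R]_n) i x :
  \det (set_row B i x) = (x *m \adj B) 0 i.
Proof.
rewrite (expand_det_row _ i) mxE; apply: eq_bigr => l _; rewrite !mxE eqxx.
congr (_ * (_ * \det _)); apply/matrixP => j' l'; rewrite !mxE.
by rewrite eq_sym (negbTE (neq_lift _ _)).
Qed.

(** Cramer's rule, by multiplying [y *m B] by the adjugate. When [c] is prime and does not divide
    [y 0 i], the determinant loses exactly one factor [c]. *)
Lemma det_set_row_scale (R : comNzRingType) n (B : 'M[R]_n) i (x y : 'rV_n) c :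
  y *m B = c *: x -> c * \det (set_row B i x) = y 0 i * \det B.
Proof.
move=> yB; transitivity ((c *: x *m \adj B) 0 i).
  by rewrite det_set_row -scalemxAl [RHS]mxE.
by rewrite -yB -mulmxA mul_mx_adj mul_mx_scalar mxE mulrC.
Qed.

Lemma det_rV_inj (A : idomainType) n (B : 'M[A]_n) (x y : 'rV_n) :
  \det B != 0 -> x *m B = y *m B -> x = y.
Proof.
move=> B0 xyB; apply/eqP; rewrite -subr_eq0; apply: contraNT B0 => xy0.
by apply/det0P; exists (x - y); rewrite // mulmxBl xyB subrr.
Qed.

Section Lattice.
Variables (A : idomainType) (p : A) (pP : prime_elt p).

(* The row space of [B] over the local ring at [p]. *)
Definition local_span m n (B : 'M[A]_(m, n)) (x : 'rV[A]_n) : Prop :=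
  exists s y, ~ divides p s /\ s *: x = y *m B.

Lemma ndividesM (s t : A) : ~ divides p s -> ~ divides p t -> ~ divides p (s * t).
Proof. by move=> ps pt /(prime_eltM pP)[]. Qed.

Lemma ndivides1 : ~ divides p 1.
Proof. by case: pP => _ /negP pU _ /(divides_unit (unitr1 A)). Qed.

(** Trace on ['rV[A]_n] of a submodule of the localization at [p]: stability under division by
    elements outside [(p)] replaces denominators. *)
Definition local_closed n (W : 'rV[A]_n -> Prop) : Prop :=
  [/\ forall x y, W x -> W y -> W (x + y), forall a x, W x -> W (a *: x)
    & forall s x, ~ divides p s -> W (s *: x) -> W x].

Lemma local_closed_span m n (B : 'M[A]_(m, n)) : local_closed (local_span B).
Proof.
split=> [x x' [s [y [ps sx]]] [s' [y' [ps' sx']]]|a x [s [y [ps sx]]]|s x ps [t [y [pt sx]]]].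
- exists (s * s'), (s' *: y + s *: y'); split; first exact: ndividesM.
  rewrite mulmxDl -!scalemxAl -sx -sx' !scalerA scalerDr.
  by congr (_ *: _ + _); rewrite mulrC.
- by exists s, (a *: y); split=> //; rewrite -scalemxAl -sx !scalerA mulrC.
- by exists (t * s), y; split; [exact: ndividesM | rewrite -scalerA].
Qed.

Lemma local_span_mul m n (B : 'M[A]_(m, n)) y : local_span B (y *m B).
Proof. by exists 1, y; split; [exact: ndivides1 | rewrite scale1r]. Qed.

Lemma local_closed_mul m n (B : 'M[A]_(m, n)) (W : 'rV[A]_n -> Prop) : local_closed W -> W 0 ->
  (forall i, W (row i B)) -> forall x, local_span B x -> W x.
Proof.
move=> [WD WZ Ws] W0 WB x [s [y [ps sx]]]; apply: (Ws s) => //; rewrite sx.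
by rewrite mulmx_sum_row; apply: big_ind => // i _; apply: WZ.
Qed.

Section Step.
Variables (n : nat) (B : 'M[A]_n) (x y : 'rV[A]_n) (i : 'I_n).
Hypotheses (detB : \det B != 0) (yB : y *m B = p *: x) (yi : ~ divides p (y 0 i)).
Local Notation B' := (set_row B i x).

Lemma set_row_det_neq0 : \det B' != 0.
Proof.
apply: contraNneq detB => B'0; have := det_set_row_scale i yB.
rewrite B'0 mulr0 => /esym/eqP; rewrite mulf_eq0 => /orP[/eqP yi0|//].
by case: yi; rewrite yi0; apply: divides0.
Qed.

Lemma mult_set_row : separated p -> mult p (\det B) = (mult p (\det B')).+1.
Proof.
move=> sepp; have := congr1 (mult p) (det_set_row_scale i yB).
have yi0 : y 0 i != 0 by apply/eqP => yi0; case: yi; rewrite yi0; apply: divides0.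
rewrite !multM ?set_row_det_neq0 ?(prime_elt_neq0 pP) // mult_prime //.
by rewrite (mult_ndivides pP yi).
Qed.

(** [y 0 i] is invertible at [p], so row [i] of [B] is recovered from [x] and the other rows. *)
Lemma local_span_set_row : forall z, local_span B z -> local_span B' z.
Proof.
have [sD sZ ss] := local_closed_span B'.
have B'row j : local_span B' (row j B') by rewrite rowE; apply: local_span_mul.
have Bj j : j != i -> local_span B' (row j B).
  by move=> ji; have := B'row j; rewrite row_set_row (negbTE ji).
apply: local_closed_mul; first exact: local_closed_span.
  by rewrite -(mul0mx _ B'); apply: local_span_mul.
move=> j; have [->|/Bj//] := eqVneq j i; apply: (ss (y 0 i)) => //.
have -> : y 0 i *: row i B = p *: x - \sum_(j | j != i) y 0 j *: row j B.
  by rewrite -yB mulmx_sum_row (bigD1 i) //= addrK.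
apply/sD; first by apply: sZ; have := B'row i; rewrite row_set_row eqxx.
rewrite -scaleN1r; apply/sZ; elim/big_ind: _ => [|u v|l li]; last exact/sZ/Bj.
  by rewrite -(mul0mx _ B'); apply: local_span_mul.
exact: sD.
Qed.

(** If [x] were in the local span of [B], some [s *: y] with [s] outside [(p)] would be a multiple
    of [p], as [B] is injective; its coordinate [i] is not. *)
Lemma set_row_nspan : local_span B' x /\ ~ local_span B x.
Proof.
split.
  by have := local_span_mul B' (delta_mx 0 i); rewrite -rowE row_set_row eqxx.
move=> [s [w [ps sx]]]; have : s *: y = p *: w.
  by apply: (det_rV_inj detB); rewrite -!scalemxAl yB -sx !scalerA mulrC.
move/rowP/(_ i); rewrite !mxE => E.
have [||//] := @prime_eltM _ _ s (y 0 i) pP; last by [].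
by exists (w 0 i); rewrite E mulrC.
Qed.

End Step.

Hypothesis sepp : separated p.

Lemma local_chain_exists n (B : 'M[A]_n) : \det B != 0 ->
  exists Bs : nat -> 'M[A]_n, Bs 0%N = B /\ forall i, (i < mult p (\det B))%N ->
    (forall x, local_span (Bs i) x -> local_span (Bs i.+1) x) /\
    (exists2 x, local_span (Bs i.+1) x & ~ local_span (Bs i) x).
Proof.
move eE: (mult p (\det B)) => e; elim: e B eE => [|e IHe] B eE B0.
  by exists (fun=> B).
have [|y [[i yi] [x yB]]] := @det_mod_prime _ p _ B pP.
  by apply: mult_gt0 => //; rewrite eE.
have := mult_set_row B0 yB yi sepp; rewrite eE => -[/esym eE'].
have [Bs [Bs0 BsS]] := IHe _ eE' (set_row_det_neq0 B0 yB yi).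
exists (fun j => if j is j'.+1 then Bs j' else B); split=> // -[_|j /BsS//].
rewrite Bs0; split; first exact: local_span_set_row yB yi.
by exists x; case: (set_row_nspan B0 yB yi).
Qed.

(** Induction on the length of the chain. A multiple of a vector of [W 1] outside [W 0] replaces a
    row of [B]; this lowers the multiplicity by one and keeps the rows of the new matrix in
    [W 1]. *)
Lemma local_chain_bound n (B : 'M[A]_n) (W : nat -> 'rV[A]_n -> Prop) l : \det B != 0 ->
  (forall i, local_closed (W i)) -> (forall y, W 0%N (y *m B)) ->
  (forall i, (i < l)%N -> (forall x, W i x -> W i.+1 x) /\ exists2 x, W i.+1 x & ~ W i x) ->
  (l <= mult p (\det B))%N.
Proof.
move=> B0 Wc; elim: l B W B0 Wc => // l IHl B W B0 Wc WB WS.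
have [W01 [x W1x W0x]] := WS 0%N isT.
have [s [e [ps sE]]] : exists s e, ~ divides p s /\ \det B = p ^+ e * s.
  by have [s ps sE] := multP pP sepp B0; exists s, (mult p (\det B)).
(* The adjugate puts [\det B *: x] in the row space, so some power of [p] works; the least exponent
   is positive since [x] is not in [W 0]. *)
have ex_m : exists m, `[< exists z, p ^+ m *: (s *: x) = z *m B >].
  exists e; apply/asboolP; exists (x *m \adj B).
  by rewrite scalerA -sE -mulmxA mul_adj_mx mul_mx_scalar.
case: (ex_minnP ex_m) => -[|m] /asboolP[z zE] min_m.
  case: W0x; case: (Wc 0%N) => _ _; apply; first exact: ps.
  by move: zE; rewrite expr0 scale1r => ->.
set x' := p ^+ m *: (s *: x).
have zB : z *m B = p *: x' by rewrite -zE exprS -!scalerA.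
(* Otherwise [p] could be cancelled in [zB], and [m.+1] would not be minimal. *)
have [i zi] : exists i, ~ divides p (z 0 i).
  apply: contrapT => /forallNP zp.
  have /choice[w wE] : forall i, exists w, z 0 i = w * p.
    by move=> i; have := zp i; apply: contrapT.
  suff : (m < m)%N by rewrite ltnn.
  apply: min_m; apply/asboolP.
  exists (\row_i w i); apply: (scalemx_inj (prime_elt_neq0 pP)).
  rewrite -[LHS]zB scalemxAl; congr (_ *m _); apply/rowP => i.
  by rewrite !mxE wE mulrC.
have [W1D W1Z W1s] := Wc 1%N.
have W1x' : W 1%N x' by exact/W1Z/W1Z.
rewrite (mult_set_row B0 zB zi sepp) ltnS.
apply: (IHl _ (fun j => W j.+1)) => //; first exact: set_row_det_neq0 B0 zB zi.
  have W10 : W 1%N 0 by rewrite -(scale0r x); apply: W1Z.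
  move=> y; apply: (@local_closed_mul _ _ (set_row B i x')) => //.
    move=> j; rewrite row_set_row; case: eqP => // _.
    by rewrite rowE; apply/W01/WB.
  exact: local_span_mul.
by move=> j jl; apply: (WS j.+1).
Qed.

End Lattice.

Section LocalLength.
Variables (A : idomainType) (p : A) (pP : prime_elt p) (sepp : separated p).
Variables (V : lmodType A) (n : nat) (g : 'rV[A]_n -> V) (B : 'M[A]_n).
Hypotheses (gD : forall x y, g (x + y) = g x + g y) (gZ : forall a x, g (a *: x) = a *: g x).
Hypotheses (gsurj : forall v, exists x, g x = v) (detB : \det B != 0).
Hypotheses (gB : forall y, g (y *m B) = 0) (gker : forall x, g x = 0 -> local_span p B x).
Local Notation D := (prime_mulset pP).

Lemma prime_mulsetE s : D s <-> ~ divides p s.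
Proof. by case: pP. Qed.

Lemma torsion_coker : torsion_module V.
Proof.
move=> v; have [x <-] := gsurj v; exists (\det B) => //.
by rewrite -gZ -mul_mx_scalar -mul_adj_mx mulmxA gB.
Qed.

Definition loc_span_submod m (C : 'M[A]_(m, n)) : submodule (locmod D V).
Proof.
apply: (@Submodule (locring D) (locmod D V)
  (fun v => exists x s (Ds : D s), local_span p C x /\ v = locmk (g x) Ds)).
- exists 0, 1, (mulset1 D); split; last by have := gZ 0 0; rewrite !scale0r => ->.
  by rewrite -(mul0mx _ C); apply: local_span_mul.
- move=> _ _ [x [s [Ds [Cx ->]]]] [x' [s' [Ds' [Cx' ->]]]].
  exists (s' *: x + s *: x'), (s * s'), (mulsetM Ds Ds'); split.
    by have [sD sZ _] := local_closed_span pP C; apply/sD; apply/sZ.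
  by rewrite gD !gZ; apply: locmod_addE.
- move=> a _ [x [s [Ds [Cx ->]]]]; have [Da aE] := locring_fracE a.
  exists ((locring_frac a).1 *: x), ((locring_frac a).2 * s), (mulsetM Da Ds); split.
    by have [_ sZ _] := local_closed_span pP C; apply/sZ.
  by rewrite gZ; apply: locmod_scaleE.
Defined.

(** The chain of row spaces above [B] is pushed to the localization, and a chain of submodules there
    is pulled back along [x |-> g x / 1]. The kernel of [g] is only assumed to be the row space of
    [B] locally at [p], which is what the reduction of Cayley data provides. *)
Lemma local_length_coker : has_length (locmod D V) (mult p (\det B)).
Proof.
split.
  have [Bs [Bs0 BsS]] := local_chain_exists pP sepp detB.
  exists (fun i => loc_span_submod (Bs i)) => i ie; have [sub [x xS xNS]] := BsS i ie.
  split=> [_ [z [s [Ds [Bz ->]]]]|]; first by exists z, s, Ds; split=> //; apply: sub.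
  exists (locmk (g x) (mulset1 D)); first by exists x, 1, (mulset1 D).
  move=> [z [s [Ds [Bz /locmkP[u [/prime_mulsetE pu]]]]]].
  have gsub a b : g (a - b) = g a - g b by rewrite gD -(scaleN1r b) gZ scaleN1r.
  rewrite scale1r -!gZ => /eqP; rewrite -subr_eq0 -gsub => /eqP/gker Bd.
  apply: xNS; have [sD sZ ss] := local_closed_span pP (Bs i).
  apply: (ss (u * s)); first by apply: ndividesM => //; apply/prime_mulsetE.
  rewrite -scalerA -(subrK (u *: z) (u *: (s *: x))); apply: sD; last exact: sZ.
  have : forall j, (j <= i)%N -> local_span p (Bs j) (u *: (s *: x) - u *: z).
    elim=> [|j IHj] ji; first by rewrite Bs0.
    have [sub' _] := BsS j (ltn_trans ji ie); apply: sub'; exact/IHj/ltnW.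
  by apply.
move=> l [W WS].
pose D1 : D 1 := mulset1 D.
apply: (@local_chain_bound _ _ pP sepp _ B (fun i x => W i (locmk (g x) D1))) => //.
- move=> i; split=> [x y Wx Wy|a x Wx|s x /prime_mulsetE Ds Wx].
  + have -> : locmk (g (x + y)) D1 = locmk (g x) D1 + locmk (g y) D1.
      rewrite [RHS]locmod_addE; apply: locmk_eq.
      by rewrite gD mulr1 !scale1r.
    exact: submodD.
  + have aP : a%:F / 1%:F \in locring_pred D by apply/asboolP; exists a, 1.
    have -> : locmk (g (a *: x)) D1 = Locring aP *: locmk (g x) D1.
      rewrite [RHS](@locmod_scaleE _ _ _ _ a 1 D1) //; apply: locmk_eq.
      by rewrite gZ mulr1.
    exact: submodZ.
  + have aP : 1%:F / s%:F \in locring_pred D by apply/asboolP; exists 1, s.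
    have -> : locmk (g x) D1 = Locring aP *: locmk (g (s *: x)) D1.
      rewrite [RHS](@locmod_scaleE _ _ _ _ 1 s Ds) //; apply: locmk_eq.
      by rewrite gZ mulr1 !scale1r.
    exact: submodZ.
- move=> y; rewrite gB; exact: submod0.
- move=> i il; have [sub [v Wv NWv]] := WS i il; split=> [x|]; first exact: sub.
  elim/locmod_ind: v Wv NWv => w s Ds Wv NWv; have [x gx] := gsurj w.
  have aP : s%:F / 1%:F \in locring_pred D by apply/asboolP; exists s, 1.
  have bP : 1%:F / s%:F \in locring_pred D by apply/asboolP; exists 1, s.
  exists x.
    have -> : locmk (g x) D1 = Locring aP *: locmk w Ds.
      rewrite [RHS](@locmod_scaleE _ _ _ _ s 1 D1) //; apply: locmk_eq.
      by rewrite gx mul1r scale1r.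
    exact: submodZ.
  move=> Wx; apply: NWv.
  have -> : locmk w Ds = Locring bP *: locmk (g x) D1.
    rewrite [RHS](@locmod_scaleE _ _ _ _ 1 s Ds) //; apply: locmk_eq.
    by rewrite gx mulr1 scale1r.
  exact: submodZ.
Qed.

End LocalLength.

(** * Cayley determinants *)

(** The ranks [rho 0] and [rho s.+1] vanish by hypothesis and not by conversion, hence the equation
    on the size. *)
Lemma mulmx_size0 (R : pzRingType) k m l (e : m = 0%N) (u : 'M[R]_(k, m)) (v : 'M_(m, l)) :
  u *m v = 0.
Proof. by move: u v; rewrite e => u v; rewrite thinmx0 mul0mx. Qed.

Lemma det_size0 (R : comPzRingType) m (e : m = 0%N) (u : 'M[R]_m) : \det u = 1.
Proof. by move: u; rewrite e => u; rewrite det_mx00. Qed.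

Lemma set_row_mull (R : pzRingType) m n l (B : 'M[R]_(m, n)) i x (C : 'M_(n, l)) :
  set_row B i x *m C = set_row (B *m C) i (x *m C).
Proof.
by apply/row_matrixP => j; rewrite row_mul !row_set_row; case: eqP; rewrite ?row_mul.
Qed.

Lemma col_mx_set_rowu (R : pzRingType) m1 m2 n (B : 'M[R]_(m1, n)) (C : 'M_(m2, n)) i x :
  col_mx (set_row B i x) C = set_row (col_mx B C) (lshift m2 i) x.
Proof.
apply/row_matrixP => j; rewrite row_set_row; case: (split_ordP j) => j' ->.
  by rewrite !rowKu row_set_row (inj_eq (@lshift_inj _ _)); case: eqP.
by rewrite !rowKd eq_rlshift.
Qed.

Lemma col_mx_set_rowd (R : pzRingType) m1 m2 n (B : 'M[R]_(m1, n)) (C : 'M_(m2, n)) i x :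
  col_mx B (set_row C i x) = set_row (col_mx B C) (rshift m1 i) x.
Proof.
apply/row_matrixP => j; rewrite row_set_row; case: (split_ordP j) => j' ->.
  by rewrite !rowKu eq_lrshift.
by rewrite !rowKd row_set_row (inj_eq (@rshift_inj _ _)); case: eqP.
Qed.

Section CayleyMatrices.
Variables (A : idomainType) (s : nat) (rho : nat -> nat).
Local Notation n j := (rho j.+1 + rho j)%N.
Variable D : forall j, 'M[A]_(n j.+1, n j).

(** The rows of [S j] play the part of [b'' j] but may be arbitrary vectors; the images of the rows
    of [S j.+1] are stacked on them. When [S] selects the coordinates on [b''], the determinant for
    [j < s] is that of the block [phi j.+1]. Arbitrary rows leave room for dividing combinations by
    [p]. *)
Definition cayley_mx (S : forall j, 'M[A]_(rho j, n j)) j : 'M[A]_(n j) :=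
  col_mx (S j.+1 *m D j) (S j).

Local Notation M := cayley_mx.
Hypothesis DD : forall j, D j.+1 *m D j = 0.
Hypothesis exactD : forall j (x : 'rV_(n j.+1)), (j < s)%N ->
  x *m D j = 0 -> exists y, x = y *m D j.+1.
Hypothesis rho_s : rho s.+1 = 0%N.

Definition cayley_data (S : forall j, 'M[A]_(rho j, n j)) : Prop :=
  forall j, (j <= s)%N -> \det (M S j) != 0.

Variables (p : A) (pP : prime_elt p) (sepp : separated p).
Local Notation v S j := (mult p (\det (M S j))).

Section Replace.
Variables (S : forall j, 'M[A]_(rho j, n j)) (b : nat).
Variables (y : 'rV[A]_(rho b.+1)) (z : 'rV[A]_(n b.+2)) (t : 'rV[A]_(n b.+1)) (i : 'I_(rho b.+1)).
Hypotheses (dataS : cayley_data S) (yzt : y *m S b.+1 + z *m D b.+1 = p *: t).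
Hypotheses (yi : ~ divides p (y 0 i)) (bs : (b < s)%N).

(** Row [i] of [S b.+1] enters [M S b.+1] and, through [D b], [M S b]; no other matrix changes. *)
Definition replace : forall j, 'M[A]_(rho j, n j) := dfwith S (set_row (S b.+1) i t).

Let yi0 : y 0 i != 0.
Proof. by apply/eqP => yi0; case: yi; rewrite yi0; apply: divides0. Qed.

Lemma replace_mx1 : M replace b.+1 = set_row (M S b.+1) (rshift _ i) t.
Proof.
rewrite /cayley_mx /replace dfwith_in dfwith_out ?ltn_eqF //.
exact: col_mx_set_rowd.
Qed.

Lemma replace_mx0 : M replace b = set_row (M S b) (lshift _ i) (t *m D b).
Proof.
rewrite /cayley_mx /replace dfwith_in dfwith_out ?gtn_eqF //.
by rewrite set_row_mull col_mx_set_rowu.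
Qed.

Lemma replace_mx j : j != b -> j != b.+1 -> M replace j = M S j.
Proof.
by move=> jb jb1; rewrite /cayley_mx /replace !dfwith_out // eq_sym.
Qed.

(** Expressed on the rows of [M S b.+1], a boundary has no component on [S b.+1]: it is killed by
    [D b], whereas the images of the rows of [S b.+1] are independent. *)
Lemma mulD_adj (w : 'rV_(n b.+2)) :
  (w *m D b.+1 *m \adj (M S b.+1)) 0 (rshift _ i) = 0.
Proof.
set u := (w *m D b.+1 *m \adj (M S b.+1)).
suff : rsubmx u = 0 by move/rowP/(_ i); rewrite !mxE.
have uM : u *m M S b.+1 *m D b = 0.
  by rewrite /u -(mulmxA _ (\adj _)) mul_adj_mx mul_mx_scalar -scalemxAl -mulmxA DD mulmx0 scaler0.
move: uM; rewrite /cayley_mx -{1}(hsubmxK u) mul_row_col mulmxDl -!mulmxA DD !mulmx0 add0r => uM.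
have /(det_rV_inj (dataS (ltnW bs))) : row_mx (rsubmx u) 0 *m M S b = 0 *m M S b.
  by rewrite /cayley_mx mul_row_col mul0mx addr0 uM mul0mx.
by move/(congr1 lsubmx); rewrite row_mxKl linear0.
Qed.

Lemma replace_det1 : p * \det (M replace b.+1) = y 0 i * \det (M S b.+1).
Proof.
rewrite replace_mx1 det_set_row.
transitivity ((p *: t *m \adj (M S b.+1)) 0 (rshift _ i)).
  by rewrite -scalemxAl [RHS]mxE.
rewrite -yzt mulmxDl mxE mulD_adj addr0.
have -> : y *m S b.+1 = row_mx 0 y *m M S b.+1 by rewrite mul_row_col mul0mx add0r.
by rewrite -mulmxA mul_mx_adj mul_mx_scalar mxE row_mxEr mulrC.
Qed.

Lemma replace_det0 : p * \det (M replace b) = y 0 i * \det (M S b).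
Proof.
rewrite replace_mx0 (@det_set_row_scale _ _ _ _ _ (row_mx y 0)) ?row_mxEl //.
rewrite mul_row_col mul0mx addr0 mulmxA scalemxAl -yzt mulmxDl -[z *m _ *m _]mulmxA.
by rewrite DD mulmx0 addr0.
Qed.

Lemma replace_data : cayley_data replace.
Proof.
move=> j js; have [->|jb] := eqVneq j b.
  apply: contraNneq (dataS (ltnW bs)) => d0; have := replace_det0; rewrite d0 mulr0.
  by move/esym/eqP; rewrite mulf_eq0 (negbTE yi0).
have [->|jb1] := eqVneq j b.+1; last by rewrite replace_mx ?dataS.
apply: contraNneq (dataS bs) => d0; have := replace_det1; rewrite d0 mulr0.
by move/esym/eqP; rewrite mulf_eq0 (negbTE yi0).
Qed.

Lemma mult_replace j : (j <= s)%N -> v S j = (v replace j + ((j == b) || (j == b.+1)))%N.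
Proof.
move=> js; have data' := replace_data.
have data'b := data' b (ltnW bs); have data'b1 := data' b.+1 bs.
have datab := dataS (ltnW bs); have datab1 := dataS bs.
have [->|jb] /= := eqVneq j b.
  have := congr1 (mult p) replace_det0; rewrite !multM //; last exact: prime_elt_neq0.
  by rewrite mult_prime // (mult_ndivides pP yi) addn1.
have [->|jb1] /= := eqVneq j b.+1; last by rewrite replace_mx ?addn0.
have := congr1 (mult p) replace_det1; rewrite !multM //; last exact: prime_elt_neq0.
by rewrite mult_prime // (mult_ndivides pP yi) addn1.
Qed.

End Replace.

(** Take a kernel row [y] modulo [p]. If its part on [S j.+1] is nonzero modulo [p], a row of
    [S j.+1] is replaced; otherwise exactness moves the relation up one degree, to [S j.+2]. *)
Lemma cayley_step S j : (j < s)%N -> cayley_data S -> divides p (\det (M S j.+1)) ->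
  exists S' b, [/\ cayley_data S', (b < s)%N &
    forall l, (l <= s)%N -> v S l = (v S' l + ((l == b) || (l == b.+1)))%N].
Proof.
move=> js dataS /(det_mod_prime pP)[y [[i yi] [x yM]]].
have yE : y *m M S j.+1 = rsubmx y *m S j.+1 + (lsubmx y *m S j.+2) *m D j.+1.
  by rewrite /cayley_mx -{1}(hsubmxK y) mul_row_col mulmxA addrC.
rewrite yE in yM.
have [[i' yi']|/forallNP yd] := pselect (exists i', ~ divides p (rsubmx y 0 i')).
  exists (replace S x i'), j; split=> //; first exact: replace_data yM yi' js.
  exact: mult_replace yM yi' js.
have /choice[w wE] : forall l, exists w, rsubmx y 0 l = w * p.
  by move=> l; have := yd l; apply: contrapT.
have {}wE : rsubmx y = p *: \row_l w l by apply/rowP => l; rewrite wE !mxE mulrC.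
have [i' yi'] : exists i', ~ divides p (lsubmx y 0 i').
  move: yi; case: (split_ordP i) => i' -> yi; first by exists i'; rewrite mxE.
  by case: (yd i'); rewrite mxE.
(* If [j.+1] were [s], the row [lsubmx y] would have length [rho s.+1 = 0]. *)
have j1s : (j.+1 < s)%N.
  rewrite ltn_neqAle js andbT; apply/eqP => j1E.
  have : (0 < rho j.+2)%N by apply: leq_ltn_trans (ltn_ord i').
  by rewrite j1E rho_s.
have p0 := prime_elt_neq0 pP.
set x' := x - (\row_l w l) *m S j.+1.
have x'E : p *: x' = (lsubmx y *m S j.+2) *m D j.+1.
  by rewrite scalerBr -yM wE scalemxAl addrAC subrr add0r.
(* First use of exactness: [x'] is a cycle because [p *: x'] is a boundary. *)
have [t0 t0E] : exists t0, x' = t0 *m D j.+1.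
  apply: exactD => //; apply: (scalemx_inj p0); rewrite scalemxAl x'E scaler0.
  by rewrite -mulmxA DD mulmx0.
(* Second use: the combination of rows of [S j.+2] equals [p *: t0] up to a boundary, the relation
   required by [replace]. *)
have [t1 t1E] : exists t1, lsubmx y *m S j.+2 - p *: t0 = t1 *m D j.+2.
  by apply: exactD; rewrite // mulmxBl -x'E -scalemxAl -t0E subrr.
have yzt : lsubmx y *m S j.+2 + (- t1) *m D j.+2 = p *: t0.
  by rewrite mulNmx -t1E opprB addrC subrK.
exists (replace S t0 i'), j.+1; split=> //; first exact: replace_data yzt yi' j1s.
exact: mult_replace yzt yi' j1s.
Qed.

Definition cayley_mult (S : forall j, 'M[A]_(rho j, n j)) : int :=
  \sum_(j < s.+1) (-1) ^+ j * (v S j)%:Z.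

(* As long as [p] divides the determinant of some [M S j] with [0 < j], the
   data can be modified so that two consecutive determinants lose a factor [p]. *)
Lemma cayley_reduce S : cayley_data S -> exists S', [/\ cayley_data S',
  forall j, (j < s)%N -> ~ divides p (\det (M S' j.+1)) & cayley_mult S' = cayley_mult S].
Proof.
have [m] := ubnP (\sum_(j < s.+1) v S j)%N; elim: m S => // m IHm S; rewrite ltnS => Sm dataS.
have [[j [js pj]]|/forallNP red] := pselect (exists j, (j < s)%N /\ divides p (\det (M S j.+1))); last first.
  by exists S; split=> // j js pj; case: (red j).
have [S' [b [dataS' bs' vS]]] := cayley_step js dataS pj.
have bs : (b.+1 < s.+1)%N by [].
have [||S'' [dataS'' redS'' S''E]] := IHm S' => //.
  apply: leq_trans Sm; rewrite (bigD1 (Ordinal bs)) // [leqRHS](bigD1 (Ordinal bs)) //=.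
  rewrite vS // eqxx orbT addn1 addSn ltnS leq_add2l; apply: leq_sum => l _.
  by rewrite vS ?leq_addr // -ltnS.
exists S''; split=> //; rewrite S''E /cayley_mult.
transitivity (\sum_(l < s.+1) ((-1) ^+ l * (v S' l)%:Z + (-1) ^+ l * ((l == b :> nat) || (l == b.+1 :> nat))%:Z)); last first.
  by apply: eq_bigr => l _; rewrite vS -1?ltnS // PoszD mulrDr.
rewrite big_split /= -[LHS]addr0; congr (_ + _).
rewrite (bigD1 (Ordinal bs)) //= (bigD1 (Ordinal (ltnW bs))) /=; last by rewrite -val_eqE /= ltn_eqF.
rewrite !eqxx orbT /= !mulr1 exprS mulN1r big1 ?addr0 ?addNr // => l.
by rewrite -!val_eqE /= => /andP[/negbTE-> /negbTE->]; rewrite mulr0.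
Qed.

Hypotheses (s_gt0 : (0 < s)%N) (rho0 : rho 0%N = 0%N).
Variables (V : lmodType A) (g : 'rV[A]_(n 0) -> V).
Hypotheses (gD : forall x y, g (x + y) = g x + g y) (gZ : forall a x, g (a *: x) = a *: g x).
Hypothesis gsurj : forall u, exists x, g x = u.
Hypothesis gker : forall x, g x = 0 <-> exists y, x = y *m D 0.

Lemma gker_cayley S y : g (y *m M S 0) = 0.
Proof.
apply/gker; exists (lsubmx y *m S 1%N).
rewrite /cayley_mx -{1}(hsubmxK y) mul_row_col -mulmxA [X in _ + X]mulmx_size0 //.
exact: addr0.
Qed.

Lemma torsion_cayley S : cayley_data S -> torsion_module V.
Proof.
move=> dataS; apply: (@torsion_coker _ V (n 0) g (M S 0) gZ gsurj (dataS 0%N isT)).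
by move=> y; apply: gker_cayley.
Qed.

Theorem local_length_cayley S : cayley_data S -> exists2 l : nat,
  has_length (locmod (prime_mulset pP) V) l & l%:Z = cayley_mult S.
Proof.
move=> /cayley_reduce[S' [dataS' redS' <-]]; exists (v S' 0); last first.
  rewrite /cayley_mult big_ord_recl /= expr0 mul1r big1 ?addr0 // => j _.
  by rewrite mult_ndivides ?mulr0 //; apply: redS'.
apply: (@local_length_coker _ _ pP sepp V (n 0) g (M S' 0) gD gZ gsurj (dataS' 0%N isT)).
  by move=> y; apply: gker_cayley.
(* Write [c] on the rows of [M S' 1]. As [D 1 *m D 0 = 0], only the part on [S' 1] contributes to
   [c *m D 0], and the denominator, this determinant, is prime to [p]. *)
move=> _ /gker[c ->]; exists (\det (M S' 1)), (row_mx (rsubmx (c *m \adj (M S' 1))) 0).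
split; first exact: redS'.
set w := c *m \adj (M S' 1).
have wE : w *m M S' 1 = \det (M S' 1) *: c.
  by rewrite -mulmxA mul_adj_mx mul_mx_scalar.
rewrite /cayley_mx mul_row_col mul0mx addr0 scalemxAl -wE.
rewrite /cayley_mx -{1}(hsubmxK w) mul_row_col mulmxDl -!mulmxA DD !mulmx0.
by rewrite add0r.
Qed.

End CayleyMatrices.

Section BasisCoord.
Variables (R : nzRingType) (V : lmodType R) (B : finType) (b : B -> V).

Definition basis_coord (v : V) : {ffun B -> R} :=
  if pselect (exists c : {ffun B -> R}, v = \sum_j c j *: b j) is left h
  then sval (cid h) else 0.

Hypothesis bP : is_basis b.

Lemma basis_coordE v : v = \sum_j basis_coord v j *: b j.
Proof.
rewrite /basis_coord; case: pselect => [h|[]]; first by rewrite -(svalP (cid h)).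
by have [c [-> _]] := bP v; exists c.
Qed.

Lemma basis_coord_inj (c c' : B -> R) :
  \sum_j c j *: b j = \sum_j c' j *: b j -> c =1 c'.
Proof.
move=> cc'; have [c0 [_ uniq]] := bP (\sum_j c j *: b j).
have ffunE' (e : B -> R) : \sum_j e j *: b j = \sum_j finfun e j *: b j.
  by apply: eq_bigr => j _; rewrite ffunE.
have c0c : c0 = finfun c by apply: uniq; apply: ffunE'.
have c0c' : c0 = finfun c' by apply: uniq; rewrite -ffunE'.
by move=> j; rewrite -(ffunE c) -(ffunE c') -c0c -c0c'.
Qed.

Lemma basis_coord_sum (c : B -> R) : basis_coord (\sum_j c j *: b j) =1 c.
Proof. by apply: basis_coord_inj; rewrite -basis_coordE. Qed.

End BasisCoord.

Section Presentation.
Variables (A : idomainType) (V : lmodType A) (s : nat).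
Implicit Types N M : A.

(* [V] is the cokernel of a matrix complex as in [local_length_cayley]. *)
Variant cayley_presented N M : Prop := CayleyPresented
  (rho : nat -> nat) (D : forall j, 'M[A]_(rho j.+2 + rho j.+1, rho j.+1 + rho j))
  (S : forall j, 'M[A]_(rho j, rho j.+1 + rho j)) (g : 'rV[A]_(rho 1 + rho 0) -> V) of
  (rho 0%N = 0%N /\ rho s.+1 = 0%N) &
  (forall j, D j.+1 *m D j = 0) &
  (forall j (x : 'rV_(rho j.+2 + rho j.+1)), (j < s)%N -> x *m D j = 0 ->
    exists y, x = y *m D j.+1) &
  cayley_data s D S &
  (forall x y, g (x + y) = g x + g y) & (forall a x, g (a *: x) = a *: g x) &
  (forall u, exists x, g x = u) & (forall x, g x = 0 <-> exists y, x = y *m D 0) &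
  N = \prod_(j < s.+1 | ~~ odd j) \det (cayley_mx D S j) &
  M = \prod_(j < s.+1 | odd j) \det (cayley_mx D S j).

Lemma cayley_presented_neq0 N M : cayley_presented N M -> N != 0 /\ M != 0.
Proof.
move=> [rho D S g _ _ _ dataS _ _ _ _ -> ->].
by split; apply/prodf_neq0 => j _; exact: (dataS _ (leq_ord j)).
Qed.

Hypothesis s_gt0 : (0 < s)%N.

Lemma cayley_presented_torsion N M : cayley_presented N M -> torsion_module V.
Proof.
move=> [rho D S g [rho0 _] _ _ dataS _ gZ gsurj gker _ _].
exact: (torsion_cayley rho0 gZ gsurj gker dataS).
Qed.

(** Stated additively because [M] is not yet known to divide [N]; that divisibility will be deduced
    from this equality. *)
Lemma cayley_presented_length N M p (pP : prime_elt p) : separated p ->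
  cayley_presented N M -> exists2 l,
    has_length (locmod (prime_mulset pP) V) l & (l + mult p M = mult p N)%N.
Proof.
move=> sepp [rho D S g [rho0 rhos] DD exactD dataS gD gZ gsurj gker -> ->].
have [l lP lE] := local_length_cayley DD exactD rhos pP sepp s_gt0 rho0 gD gZ gsurj gker dataS.
exists l => //; apply/eqP; rewrite -eqz_nat PoszD lE.
have mult_prod (P : pred 'I_s.+1) : mult p (\prod_(j < s.+1 | P j) \det (cayley_mx D S j)) =
    (\sum_(j < s.+1 | P j) mult p (\det (cayley_mx D S j)))%N.
  have : \prod_(j < s.+1 | P j) \det (cayley_mx D S j) != 0.
    by apply/prodf_neq0 => j _; exact: (dataS _ (leq_ord j)).
  elim/big_rec2: _ => [|j m a _ IH]; first by rewrite mult_unit ?unitr1.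
  by rewrite mulf_eq0 => /norP[a0 b0]; rewrite multM // IH.
have PoszS (P : pred 'I_s.+1) F : ((\sum_(j < s.+1 | P j) F j)%N)%:Z = \sum_(j < s.+1 | P j) (F j)%:Z.
  exact: (big_morph Posz PoszD).
rewrite !mult_prod !PoszS /cayley_mult (bigID (fun j : 'I__ => odd j)) /= addrAC -big_split big1 ?add0r /=.
  by apply/eqP; apply: eq_bigr => j /negbTE jo; rewrite -signr_odd jo expr0 mul1r.
by move=> j jo; rewrite -signr_odd jo expr1 mulN1r addNr.
Qed.

End Presentation.

Section CayleyComplex.
Variables (A : idomainType) (C : complex A) (s : nat) (x : {fraction A}).
Hypotheses (s_gt0 : (0 < s)%N) (Cs0 : forall y : C s.+1, y = 0).
Hypothesis exactC : forall j (y : C j.+1), (j < s)%N -> cplx_diff C j y = 0 ->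
  exists z, cplx_diff C j.+1 z = y.
Variables (V : lmodType A) (g : C 0%N -> V).
Hypotheses (gD : forall x y, g (x + y) = g x + g y) (gZ : forall a x, g (a *: x) = a *: g x).
Hypothesis gsurj : forall u, exists y, g y = u.
Hypothesis gker : forall y, g y = 0 <-> exists z, y = cplx_diff C 0 z.

(** The bases are those of an arbitrary Cayley determinant, so the link with lengths holds for every
    choice. Numerator and denominator collect the even and the odd degrees. *)
Theorem cayley_det_presented : is_cayley_det C s x ->
  exists N M u : A, [/\ u \is a GRing.unit, x = u%:F * (N%:F / M%:F) & cayley_presented V s N M].
Proof.
move=> [rho [b [phi [[rho0 rhos] bP diffb phi0 [u uU xE]]]]].
pose n j := (rho j.+1 + rho j)%N.
(* [b j] is known to be a basis only for [j <= s], so the matrices from [j = s] on are set to 0. *)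
pose D j : 'M[A]_(n j.+1, n j) := \matrix_(i, l)
  if (j < s)%N then basis_coord (b j) (cplx_diff C j (b j.+1 (split i))) (split l) else 0.
pose vec j (y : 'rV[A]_(n j)) : C j := \sum_l y 0 (unsplit l) *: b j l.
have vecD j y y' : vec j (y + y') = vec j y + vec j y'.
  by rewrite -big_split; apply: eq_bigr => l _; rewrite mxE scalerDl.
have vecZ j a y : vec j (a *: y) = a *: vec j y.
  by rewrite scaler_sumr; apply: eq_bigr => l _; rewrite mxE scalerA.
have vec_inj j y y' : (j <= s)%N -> vec j y = vec j y' -> y = y'.
  move=> js /(basis_coord_inj (bP j js)) yy'; apply/rowP => l.
  by rewrite -(splitK l); apply: yy'.
have vec_surj j v : (j <= s)%N -> exists y, vec j y = v.
  move=> js; exists (\row_l basis_coord (b j) v (split l)).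
  rewrite [RHS](basis_coordE (bP j js)); apply: eq_bigr => l _.
  by rewrite mxE unsplitK.
have vec_diff j y : (j < s)%N -> vec j (y *m D j) = cplx_diff C j (vec j.+1 y).
  move=> js; rewrite /vec linear_sum /=.
  transitivity (\sum_l \sum_i (y 0 i * D j i (unsplit l)) *: b j l).
    by apply: eq_bigr => l _; rewrite mxE scaler_suml.
  rewrite exchange_big (reindex (@unsplit (rho j.+2) (rho j.+1))) /=; last first.
    by exists split => i _; rewrite ?unsplitK ?splitK.
  apply: eq_bigr => i _; rewrite linearZ /=.
  rewrite [X in _ *: X](basis_coordE (bP j (ltnW js))) scaler_sumr.
  by apply: eq_bigr => l _; rewrite mxE js !unsplitK scalerA.
have D0 j : (s <= j)%N -> D j = 0.
  by move=> sj; apply/matrixP => i l; rewrite !mxE ltnNge sj.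
have DD j : D j.+1 *m D j = 0.
  have [js|/D0->] := ltnP j.+1 s; last by rewrite mul0mx.
  apply/row_matrixP => i; rewrite row0 rowE; apply: (vec_inj j); first exact: ltnW (ltnW js).
  rewrite mulmxA !vec_diff // ?(ltnW js) // cplx_diffK.
  by rewrite /vec big1 // => l _; rewrite mxE scale0r.
have vec0 j : vec j 0 = 0 by rewrite /vec big1 // => l _; rewrite mxE scale0r.
have exactD j (y : 'rV_(n j.+1)) : (j < s)%N -> y *m D j = 0 -> exists z, y = z *m D j.+1.
  move=> js yD; have [z zE] : exists z, cplx_diff C j.+1 z = vec j.+1 y.
    by apply: exactC => //; rewrite -vec_diff // yD vec0.
  have [j1s|sj1] := ltnP j.+1 s.
    have [z' z'E] := vec_surj j.+2 z j1s; exists z'; apply: (vec_inj j.+1 _ _ js).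
    by rewrite vec_diff // z'E zE.
  (* Here [j.+1 = s], and the boundaries come from [C s.+1 = 0]. *)
  exists 0; apply: (vec_inj j.+1 _ _ js); rewrite -zE mul0mx vec0.
  have jsE : j.+1 = s by apply/eqP; rewrite eqn_leq js.
  by move: (z); rewrite jsE => z'; rewrite (Cs0 z') linear0.
pose S j : 'M[A]_(rho j, n j) := row_mx 0 1%:M.
have detM j : (j <= s)%N -> \det (cayley_mx D S j) = if (j < s)%N then \det (phi j.+1) else 1.
  move=> js; have -> : cayley_mx D S j = block_mx (lsubmx (S j.+1 *m D j)) (rsubmx (S j.+1 *m D j)) 0 1%:M.
    by rewrite /cayley_mx block_mxEv hsubmxK.
  rewrite det_ublock det1 mulr1; case: ifP => [js'|/negbT]; last first.
    by rewrite -leqNgt => sj; apply: det_size0; rewrite -rhos; congr (rho _.+1); apply/eqP; rewrite eqn_leq js.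
  have -> : S j.+1 *m D j = dsubmx (D j).
    by rewrite -{1}[D j]vsubmxK mul_row_col mul0mx add0r mul1mx.
  congr (\det _); apply/matrixP => i l; rewrite !mxE js'.
  have [c cE] := diffb j i js'.
  rewrite !(unsplitK (inr i)) !(unsplitK (inl l)) cE.
  have -> : \sum_k phi j.+1 i k *: b j (inl k) + \sum_k c k *: b j (inr k) =
     \sum_k (match k with inl k => phi j.+1 i k | inr k => c k end) *: b j k.
    by rewrite big_sumType.
  by rewrite (basis_coord_sum (bP j js)).
have dataS : cayley_data s D S.
  move=> j js; rewrite detM //; case: ifP => [js'|_]; last exact: oner_neq0.
  exact: phi0.
pose g' (y : 'rV_(n 0%N)) := g (vec 0%N y).
have g'D y y' : g' (y + y') = g' y + g' y' by rewrite /g' vecD gD.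
have g'Z a y : g' (a *: y) = a *: g' y by rewrite /g' vecZ gZ.
have g'surj v : exists y, g' y = v.
  by have [w <-] := gsurj v; have [y <-] := vec_surj 0%N w isT; exists y.
have g'ker y : g' y = 0 <-> exists z, y = z *m D 0%N.
  rewrite gker; split=> [[z zE]|[z ->]].
    have [z' z'E] := vec_surj 1%N z s_gt0; exists z'; apply: (vec_inj 0%N) => //.
    by rewrite vec_diff // z'E.
  by exists (vec 1%N z); rewrite vec_diff.
exists (\prod_(j < s.+1 | ~~ odd j) \det (cayley_mx D S j)).
exists (\prod_(j < s.+1 | odd j) \det (cayley_mx D S j)), u; split=> //; last first.
  exact: (@CayleyPresented _ _ _ _ _ rho D S g').
(* [phi j.+1] sits in degree [j], hence the shift of index; the signs agree, and the matrix of
   degree [s] has determinant 1. *)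
rewrite xE; congr (_ * _); rewrite big_add1 big_mkord /=.
transitivity (\prod_(j < s.+1) (\det (cayley_mx D S j))%:F ^ ((-1) ^+ j)).
  rewrite big_ord_recr /= [X in _ = _ * X%:F ^ _]detM // ltnn tofrac1 exp1rz mulr1.
  apply: eq_bigr => j _; rewrite detM ?(ltnW (ltn_ord j)) // ltn_ord.
  by rewrite !exprS !mulN1r opprK.
rewrite (bigID (fun j : 'I__ => odd j)) /= mulrC !rmorph_prod -prodfV; congr (_ * _).
  by apply: eq_bigr => j /negbTE jo; rewrite -signr_odd jo.
by apply: eq_bigr => j jo; rewrite -signr_odd jo.
Qed.

End CayleyComplex.

(** * Existence of Cayley determinants, by linear algebra over the fraction field *)

Lemma fractionP (A : idomainType) (x : {fraction A}) :
  exists a b : A, b != 0 /\ x = a%:F / b%:F.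
Proof.
elim/quotW: x => x; exists (\n_x), (\d_x); split; first exact: denom_ratioP.
have d0 : (\d_x)%:F != 0 :> {fraction A} by rewrite tofrac_eq0 denom_ratioP.
apply: (mulIf d0); rewrite divfK //; unlock FracField.tofrac; apply/eqP.
rewrite -[_ * _]FracField.pi_mul.
rewrite eqmodE /= FracField.equivfE /FracField.mulf /=.
by rewrite !numden_Ratio ?(oner_eq0, mul1r, mulr1, mulf_neq0, denom_ratioP) // mulrC.
Qed.

Lemma clear_denominators (A : idomainType) m (y : 'rV[{fraction A}]_m) :
  exists d (z : 'rV[A]_m), d != 0 /\ d%:F *: y = map_mx (@FracField.tofrac A) z.
Proof.
have /choice[w wE] : forall j, exists w : A * A, w.2 != 0 /\ y 0 j = w.1%:F / w.2%:F.
  by move=> j; have [a [b ab]] := fractionP (y 0 j); exists (a, b).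
exists (\prod_j (w j).2), (\row_j ((w j).1 * \prod_(i | i != j) (w i).2)).
split; first by apply/prodf_neq0 => j _; case: (wE j).
apply/rowP => j; rewrite !mxE; case: (wE j) => wj0 ->.
rewrite (bigD1 j) //= !tofracM mulrC mulrA divfK ?tofrac_eq0 //.
Qed.

Lemma map_mx_inj0 (A : idomainType) m n (B : 'M[A]_(m, n)) :
  map_mx (@FracField.tofrac A) B = 0 -> B = 0.
Proof.
move=> B0; apply/matrixP => i j; move/matrixP/(_ i j): B0; rewrite !mxE.
by move/eqP; rewrite tofrac_eq0 => /eqP.
Qed.

Lemma locmapE (A : idomainType) (D : mulset A) (V W : lmodType A) (f : {linear V -> W})
  v s (Ds : D s) : locmap f (locmk v Ds) = locmk (f v) Ds.
Proof.
have [u [Du uE]] := locmk_repr v Ds; apply/locmkP; exists u; split=> //.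
have fZ a w : f (a *: w) = a *: f w by exact: linearZ.
by have := congr1 f uE; rewrite !fZ.
Qed.

Lemma locmk0 (A : idomainType) (D : mulset A) (V : lmodType A) s (Ds : D s) :
  locmk (0 : V) Ds = 0.
Proof. by apply: locmk_eq; rewrite !scaler0. Qed.

Section BasisVec.
Variables (R : nzRingType) (V : lmodType R) (m : nat) (b : 'I_m -> V).

Definition basis_vec (y : 'rV[R]_m) : V := \sum_l y 0 l *: b l.

Lemma basis_vec0 : basis_vec 0 = 0.
Proof. by rewrite /basis_vec big1 // => l _; rewrite mxE scale0r. Qed.

Lemma basis_vecZ a y : basis_vec (a *: y) = a *: basis_vec y.
Proof. by rewrite scaler_sumr; apply: eq_bigr => l _; rewrite mxE scalerA. Qed.

Hypothesis bP : is_basis b.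

Lemma basis_vec_surj v : exists y, basis_vec y = v.
Proof.
exists (\row_l basis_coord b v l); rewrite [RHS](basis_coordE bP).
by apply: eq_bigr => l _; rewrite mxE.
Qed.

Lemma basis_vec_inj y y' : basis_vec y = basis_vec y' -> y = y'.
Proof. by move=> /(basis_coord_inj bP) yy'; apply/rowP. Qed.

End BasisVec.

Section CayleyExistence.
Variables (A : idomainType) (C : complex A) (s : nat) (n : nat -> nat).
Variables (eps : forall j, 'I_(n j) -> C j) (D : forall j, 'M[A]_(n j.+1, n j)).
Arguments eps : clear implicits.
Hypotheses (epsP : forall j, is_basis (eps j)) (n_s : forall j, (s < j)%N -> n j = 0%N).
Hypothesis diff_eps : forall j i, cplx_diff C j (eps j.+1 i) = \sum_l D j i l *: eps j l.
Hypothesis exactC : forall j (y : C j.+1), cplx_diff C j y = 0 ->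
  exists z, cplx_diff C j.+1 z = y.
Hypothesis euler : \sum_(j < s.+1) (-1) ^+ j * (n j)%:Z = 0.

Local Notation vec j y := (basis_vec (eps j) y).
Local Notation "M ^K" := (map_mx (@FracField.tofrac A) M) (at level 2, format "M ^K").

Lemma vec_diff j y : vec j (y *m D j) = cplx_diff C j (vec j.+1 y).
Proof.
rewrite /basis_vec linear_sum /=.
transitivity (\sum_l \sum_i (y 0 i * D j i l) *: eps j l).
  by apply: eq_bigr => l _; rewrite mxE scaler_suml.
rewrite exchange_big; apply: eq_bigr => i _; rewrite linearZ /= diff_eps scaler_sumr.
by apply: eq_bigr => l _; rewrite scalerA.
Qed.

Lemma diff_mxK j : D j.+1 *m D j = 0.
Proof.
apply/row_matrixP => i; rewrite row0 rowE; apply: (basis_vec_inj (@epsP _)).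
by rewrite mulmxA !vec_diff cplx_diffK basis_vec0.
Qed.

Lemma exact_mx j (y : 'rV_(n j.+1)) : y *m D j = 0 -> exists z, y = z *m D j.+1.
Proof.
move=> yD; have [|z zE] := @exactC j (vec j.+1 y); first by rewrite -vec_diff yD basis_vec0.
by have [z' z'E] := basis_vec_surj (@epsP _) z; exists z'; apply: (basis_vec_inj (@epsP _)); rewrite vec_diff z'E zE.
Qed.

Lemma exact_frac_mx j (y : 'rV[{fraction A}]_(n j.+1)) : y *m (D j)^K = 0 ->
  (y <= (D j.+1)^K)%MS.
Proof.
have [d [z [d0 dy]]] := clear_denominators y; move=> yD.
have [|w wE] := @exact_mx j z.
  by apply: map_mx_inj0; rewrite map_mxM -dy -scalemxAl yD scaler0.
have dF0 : d%:F != 0 :> {fraction A} by rewrite tofrac_eq0.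
by rewrite -(eqmx_scale y dF0) dy wE map_mxM submxMl.
Qed.

Lemma rank_frac_mx j : (\rank (D j.+1)^K + \rank (D j)^K = n j.+1)%N.
Proof.
have -> : \rank (D j.+1)^K = \rank (kermx (D j)^K).
  apply/eqP; rewrite eqn_leq !mxrankS //.
    by apply/row_subP => i; apply: exact_frac_mx; rewrite -row_mul mulmx_ker row0.
  by apply/sub_kermxP; rewrite -map_mxM diff_mxK map_mx0.
by rewrite mxrank_ker subnK // rank_leq_row.
Qed.

(** Ranks over the fraction field, shifted so that [rho j] is the size of [b'' j]. *)
Definition cayley_rho j : nat := if j is j'.+1 then \rank (D j')^K else 0.
Arguments cayley_rho : simpl never.
Local Notation rho := cayley_rho.

Lemma cayley_rho_gt j : (s < j)%N -> rho j = 0%N.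
Proof.
case: j => // j; rewrite ltnS leq_eqVlt => /orP[/eqP<-|sj]; apply/eqP; rewrite -leqn0.
  by apply: leq_trans (rank_leq_row _) _; rewrite n_s.
by apply: leq_trans (rank_leq_col _) _; rewrite n_s.
Qed.

(** In positive degrees this is exactness over the fraction field. In degree 0 the Euler
    characteristic, telescoped, forces [D 0] to have full rank. *)
Lemma cayley_rho_size j : n j = (rho j.+1 + rho j)%N.
Proof.
case: j => [|j]; last by rewrite -rank_frac_mx.
suff E m : \sum_(j < m.+1) (-1) ^+ j * (n j)%:Z =
    (n 0%N)%:Z - (rho 1)%:Z + (-1) ^+ m * (rho m.+1)%:Z.
  move: euler; rewrite E (@cayley_rho_gt s.+1) // mulr0 addr0 addn0 => /eqP.
  by rewrite subr_eq0 eqz_nat => /eqP.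
elim: m => [|m IHm]; first by rewrite big_ord1 expr0 !mul1r subrK.
have nE : (n m.+1)%:Z = (rho m.+2)%:Z + (rho m.+1)%:Z by rewrite -PoszD rank_frac_mx.
by rewrite big_ord_recr /= IHm nE exprS; ring.
Qed.

Lemma generically_exact_complex : generically_exact C.
Proof.
split=> [|j].
  elim/locmod_ind=> v t Dt; have [w wE] := basis_vec_surj (@epsP _) v.
  have fullD : row_full (D 0)^K.
    by rewrite /row_full [X in _ == X]cayley_rho_size addn0.
  have /submxP[y yE] : (w^K <= (D 0)^K)%MS by apply: submx_full.
  have [d [z [d0 dy]]] := clear_denominators y.
  have dt0 : nonzero_mulset A (d * t) by exact: mulf_neq0.
  exists (locmk (vec 1%N z) dt0); rewrite locmapE -vec_diff; apply: locmk_eq.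
  have -> : z *m D 0 = d *: w.
    apply/eqP; rewrite -subr_eq0; apply/eqP/map_mx_inj0.
    by rewrite map_mxB map_mxM -dy map_mxZ yE -scalemxAl subrr.
  by rewrite basis_vecZ wE scalerA mulrC.
elim/locmod_ind=> v t Dt; rewrite locmapE -(locmk0 _ (mulset1 _)).
move=> /locmkP[u [u0]]; rewrite scale1r !scaler0 -linearZ /= => /exactC[z zE].
have ut0 : nonzero_mulset A (u * t) by exact: mulf_neq0.
exists (locmk z ut0); rewrite locmapE zE; apply: locmk_eq.
by rewrite scalerA mulrC.
Qed.

(** Indices of [b'' j]: basis vectors of [C j] whose images form, over the fraction field, a basis
    of the image of the differential. *)
Definition cayley_sel j : 'I_(rho j) -> 'I_(n j) :=
  match j with
  | 0 => fun i => False_rect _ (notF (ltn_ord i))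
  | j'.+1 => maxrankfun (D j')^K
  end.

Lemma cayley_sel_inj j : injective (@cayley_sel j).
Proof. by case: j => [[]//|j]; apply: maxrankfun_inj. Qed.

Lemma cayley_sel_free j (v : 'I_(rho j.+1) -> A) :
  (forall l, \sum_i v i * D j (cayley_sel i) l = 0) -> forall i, v i = 0.
Proof.
move=> vD i; have /row_free_inj := maxrowsub_free (D j)^K.
move=> /(_ 1%N) /(_ (\row_i (v i)%:F) 0); rewrite mul0mx => vinj; have /rowP/(_ i) : \row_i (v i)%:F = 0.
  apply: vinj; apply/rowP => l; rewrite !mxE.
  transitivity ((\sum_i v i * D j (cayley_sel i) l)%:F); last by rewrite vD tofrac0.
  by rewrite rmorph_sum; apply: eq_bigr => i' _; rewrite !mxE /= tofracM.
by rewrite !mxE => /eqP; rewrite tofrac_eq0 => /eqP.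
Qed.

Lemma card_unselected j : #|[pred l | l \notin codom (@cayley_sel j)]| = rho j.+1.
Proof.
have := cardC [pred l | l \in codom (@cayley_sel j)].
rewrite card_ord card_codom; last exact: cayley_sel_inj.
by rewrite card_ord => E; apply: (@addnI (rho j)); rewrite [LHS]E cayley_rho_size addnC.
Qed.

Definition cayley_comp j (l : 'I_(rho j.+1)) : 'I_(n j) :=
  enum_val (cast_ord (esym (card_unselected j)) l).

Definition cayley_index j (l : 'I_(rho j.+1) + 'I_(rho j)) : 'I_(n j) :=
  match l with inl i => cayley_comp i | inr i => cayley_sel i end.

Lemma cayley_index_bij j : bijective (@cayley_index j).
Proof.
apply: inj_card_bij; last by rewrite card_sum !card_ord cayley_rho_size.
have selN i i' : cayley_comp i != @cayley_sel j i'.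
  have := enum_valP (cast_ord (esym (card_unselected j)) i).
  by rewrite inE; apply: contraNneq => compE; rewrite -/(cayley_comp i) compE codom_f.
move=> [i|i] [i'|i'] /= E.
- by congr inl; apply: cast_ord_inj (enum_val_inj E).
- by have := selN i i'; rewrite E eqxx.
- by have := selN i' i; rewrite E eqxx.
- by congr inr; apply: cayley_sel_inj E.
Qed.

Definition cayley_phi j : 'M[A]_(rho j) :=
  match j with
  | 0 => 1%:M
  | j'.+1 => mxsub (@cayley_sel j'.+1) (@cayley_comp j') (D j')
  end.

(** If [v] kills the block, the image [w] of the corresponding combination of [b''] lies in the span
    of the [b''] one degree lower. Being a cycle, [w] is 0, since the differential is injective on
    that span; then [v] is 0 for the same reason. *)
Lemma cayley_phi_det j : \det (cayley_phi j) != 0.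
Proof.
case: j => [|j]; first by rewrite det1 oner_neq0.
apply/negP => /det0P[v /rV0Pn[i0 vi0] vphi].
pose w l := \sum_i v 0 i * D j (cayley_sel i) l.
have wcomp l : w (cayley_comp l) = 0.
  by move/rowP/(_ l): vphi; rewrite !mxE => <-; apply: eq_bigr => i _; rewrite mxE.
suff w0 l : w l = 0 by have := cayley_sel_free w0 i0; apply/eqP.
suff wsel i : w (@cayley_sel j i) = 0.
  by have [h _ hK] := cayley_index_bij j; rewrite -(hK l); case: (h l).
have wD : (\row_l w l) = (\row_l \sum_(i | cayley_sel i == l) v 0 i) *m D j.
  apply/rowP => k; rewrite !mxE.
  transitivity (\sum_l' \sum_(i' | cayley_sel i' == l') v 0 i' * D j (cayley_sel i') k).
    rewrite (exchange_big_dep predT) //=; apply: eq_bigr => i' _.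
    by rewrite (eq_bigl (pred1 (cayley_sel i'))) ?big_pred1_eq // => l'; rewrite /= eq_sym.
  by apply: eq_bigr => l' _; rewrite mxE mulr_suml; apply: eq_bigr => i' /eqP->.
clear l; case: j => [|j] in i v i0 vi0 vphi w wcomp wD *; first by case: i.
move: i; apply: cayley_sel_free => l.
have : (\row_k w k) *m D j = 0 by rewrite wD -mulmxA diff_mxK mulmx0.
move/rowP/(_ l); rewrite !mxE => wD0; rewrite -[RHS]wD0 [RHS](reindex (@cayley_index j.+1)) /=.
  rewrite big_sumType /= [X in _ = X + _]big1 ?add0r => [|k _].
    by apply: eq_bigr => k _; rewrite mxE.
  by rewrite mxE wcomp mul0r.
exact: onW_bij (cayley_index_bij _).
Qed.

Theorem cayley_det_exists : is_cayley_det C s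
  (\prod_(1 <= j < s.+1) (\det (cayley_phi j))%:F ^ ((-1) ^+ j.+1)).
Proof.
exists rho, (fun j l => eps j (cayley_index l)), cayley_phi; split.
- by split=> //; apply: cayley_rho_gt.
- move=> j _ v; have [h hK Kh] := cayley_index_bij j.
  exists [ffun l => basis_coord (eps j) v (cayley_index l)]; split.
    rewrite {1}(basis_coordE (@epsP j) v) (reindex (@cayley_index j)) /=.
      by apply: eq_bigr => l _; rewrite ffunE.
    exact: onW_bij (cayley_index_bij _).
  move=> c vE; apply/ffunP => l; rewrite ffunE vE.
  rewrite (reindex h) /=; last by apply: onW_bij; exists (@cayley_index j).
  rewrite (eq_bigr (fun l => c (h l) *: eps j l)) => [|k _]; last by rewrite Kh.
  by rewrite (basis_coord_sum (@epsP j)) hK.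
- move=> j i js; exists (fun l => D j (cayley_sel i) (cayley_sel l)).
  rewrite /= diff_eps (reindex (@cayley_index j)) /=; last exact: onW_bij (cayley_index_bij _).
  by rewrite big_sumType /=; congr (_ + _); apply: eq_bigr => l _; rewrite mxE.
- by move=> j _; apply: cayley_phi_det.
- by exists 1; rewrite ?unitr1 // tofrac1 mul1r.
Qed.

End CayleyExistence.

(** * Contents *)

Section Valuations.
Variable A : idomainType.
Implicit Types a b c p : A.

Lemma associated_sym a b : associated a b -> associated b a.
Proof. by move=> [u uU ->]; exists u^-1; rewrite ?unitrV // mulKr. Qed.

Lemma associated_trans a b c : associated a b -> associated b c -> associated a c.
Proof. by move=> [u uU ->] [v vU ->]; exists (u * v); rewrite ?unitrM ?uU // mulrA. Qed.

Lemma divides_associated a b : a != 0 -> divides a b -> divides b a -> associated a b.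
Proof.
move=> a0 [x bE] [y aE]; exists y => //; apply/unitrPr; exists x; apply: (mulIf a0).
by rewrite mul1r -mulrA -bE -aE.
Qed.

Lemma mult_associated_prime p p' a : prime_elt p -> prime_elt p' -> separated p -> a != 0 ->
  associated p p' -> mult p a = mult p' a.
Proof.
move=> pP p'P sepp a0 pp'; have [b pb aE] := multP pP sepp a0; case: (pp') => u uU pE.
symmetry; apply: mult_eq => //; exists (u ^+ mult p a * b); last by rewrite {1}aE {1}pE exprMn; ring.
move=> [y yE]; apply: pb; exists (u^-1 ^+ (mult p a).+1 * y).
have -> : b = u^-1 ^+ mult p a * (u ^+ mult p a * b).
  by rewrite mulrA -exprMn mulVr // expr1n mul1r.
rewrite yE pE exprSr -!mulrA; congr (_ * _).
by rewrite [y * (u * _)]mulrCA mulKr.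
Qed.

Hypotheses (irrA : irreducibles_prime A) (facA : factorizable A).
Hypothesis sepA : forall p, prime_elt p -> separated p.

Lemma divides_mult a b : a != 0 -> b != 0 ->
  (forall p, prime_elt p -> (mult p a <= mult p b)%N) -> divides a b.
Proof.
move=> a0; have [s [irrs [u uU aE]]] := facA a0; rewrite {a}aE in a0 *.
move: a0; rewrite mulf_eq0 => /norP[_]; elim: s irrs b => [|p s IHs] irrs b a0 b0 ab.
  by exists (b * u^-1); rewrite big_nil mulr1 divrK.
have pP : prime_elt p by apply/irrA/irrs; rewrite mem_head.
have sepp := sepA pP; move: a0 ab; rewrite big_cons mulf_eq0 => /norP[p0 a0] ab.
have u0 : u != 0 by apply: contraTneq uU => ->; rewrite unitr0.
have [c bE] : divides p b.
  apply: mult_gt0 => //; apply: leq_trans (ab p pP).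
  by rewrite !multM ?mult_prime ?mulf_neq0 // addnCA.
move: b0; rewrite bE mulf_eq0 => /norP[c0 _].
have [x xE] : divides (u * \prod_(j <- s) j) c.
  apply: IHs => // [p' p's|p' p'P]; first by apply: irrs; rewrite inE p's orbT.
  have sepp' := sepA p'P; have := ab p' p'P; rewrite bE !multM ?mulf_neq0 //.
  by rewrite addnCA addnC leq_add2r.
by exists x; rewrite xE; ring.
Qed.

Lemma associated_mult a b : a != 0 -> b != 0 ->
  (forall p, prime_elt p -> mult p a = mult p b) -> associated a b.
Proof.
by move=> a0 b0 ab; apply: divides_associated => //; apply: divides_mult => // p /ab->.
Qed.

(** Representatives, up to association, of the irreducible divisors of [a]; they supply the list
    required by [is_content]. *)
Lemma irreducible_factors a : a != 0 -> exists s : seq A,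
  [/\ uniq s, forall p p', p \in s -> p' \in s -> associated p p' -> p = p',
      forall p, p \in s -> irreducible_elt p
    & forall p, irreducible_elt p -> divides p a -> exists2 p', p' \in s & associated p p'].
Proof.
move=> /facA[s [irrs [u uU ->]]].
have [t [ut inj sub cov]] : exists t : seq A,
  [/\ uniq t, forall p p', p \in t -> p' \in t -> associated p p' -> p = p',
      {subset t <= s} & forall p, p \in s -> exists2 p', p' \in t & associated p p'].
  elim: s {irrs} => [|p s [t [ut inj sub cov]]]; first by exists [::].
  have [[p' p't pp']|pN] := pselect (exists2 p', p' \in t & associated p p').
    exists t; split=> // [x /sub xs|x /[!inE] /orP[/eqP->|/cov//]]; last by exists p'.
    by rewrite inE xs orbT.
  have refl x : associated x x by exists 1; rewrite ?unitr1 ?mul1r.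
  exists (p :: t); split.
  - by rewrite /= ut andbT; apply/negP => pt; apply: pN; exists p.
  - move=> x y /[!inE] /orP[/eqP->|xt] /orP[/eqP->|yt] xy //; first by case: pN; exists y.
      by case: pN; exists x => //; apply: associated_sym.
    exact: inj.
  - by move=> x /[!inE] /orP[->//|/sub->]; rewrite orbT.
  - move=> x /[!inE] /orP[/eqP->|/cov[y yt xy]]; first by exists p; rewrite ?mem_head.
    by exists y; rewrite // inE yt orbT.
exists t; split=> // [p /sub/irrs//|p pirr].
have pP := irrA pirr; case/(prime_eltM pP) => [/(divides_unit uU)|].
  by case: pirr => _ /negP.
move: irrs cov; elim: s {sub} => [|x s IHs] irrs cov.
  by rewrite big_nil => /(divides_unit (unitr1 A)); case: pirr => _ /negP.
rewrite big_cons => /(prime_eltM pP)[[y xE]|]; last first.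
  by apply: IHs => y ys; [apply: irrs | apply: cov]; rewrite inE ys orbT.
have [p' p't xp'] := cov x (mem_head _ _); exists p' => //.
apply: associated_trans xp'; apply: associated_sym; exists y => //.
have [x0 xU xM] := irrs x (mem_head _ _); have [//|pU] := xM _ _ xE.
by case: pirr => _; rewrite pU.
Qed.

Lemma mult_prod_power p (s : seq A) (l : A -> nat) : prime_elt p ->
  uniq s -> (forall p', p' \in s -> irreducible_elt p') ->
  (forall p', p' \in s -> associated p p' -> p = p') ->
  mult p (\prod_(p' <- s) p' ^+ l p') = if p \in s then l p else 0%N.
Proof.
move=> pP; have sepp := sepA pP; elim: s => [|x s IHs] /=.
  by rewrite big_nil mult_unit ?unitr1.
move=> /andP[xs us] irrs inj; rewrite big_cons.
have x0 : x != 0 by case: (irrs x (mem_head _ _)).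
have irrs' p' : p' \in s -> irreducible_elt p' by move=> p's; apply: irrs; rewrite inE p's orbT.
have prod0 : \prod_(p' <- s) p' ^+ l p' != 0.
  by rewrite prodf_seq_neq0; apply/allP => y /irrs'[y0 _ _] /=; apply: expf_neq0.
rewrite multM ?expf_neq0 // IHs // => [|p' p's]; last by apply: inj; rewrite inE p's orbT.
rewrite multX // inE; have [->|px] := eqVneq p x.
  by rewrite (negbTE xs) addn0 mult_prime ?muln1 //; apply/irrA/irrs/mem_head.
rewrite (@mult_ndivides _ p pP x) ?muln0 ?add0n //= => -[y xE]; move/eqP: px; apply.
apply: inj; first exact: mem_head.
apply: associated_sym; exists y => //; have [_ _ xM] := irrs x (mem_head _ _).
by have [//|pU] := xM _ _ xE; case: pP => _; rewrite pU.
Qed.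

Lemma has_length_uniq (R : nzRingType) (V : lmodType R) l l' :
  has_length V l -> has_length V l' -> l = l'.
Proof.
by move=> [Vl maxl] [Vl' maxl']; apply/eqP; rewrite eqn_leq maxl' // maxl.
Qed.

Lemma has_local_length_uniq (V : lmodType A) p l l' :
  has_local_length V p l -> has_local_length V p l' -> l = l'.
Proof.
move=> [pP Vl] [pP' Vl']; apply: has_length_uniq Vl _.
(* The multiplicative set, hence the localization, depends on the proof of primality. *)
by rewrite (Prop_irrelevance pP pP').
Qed.

Section Content.
Variable V : lmodType A.

Lemma is_content_of_lengths c : c != 0 ->
  (forall p, prime_elt p -> has_local_length V p (mult p c)) -> is_content V c.
Proof.
move=> c0 lenV; have [s [us inj irrs cov]] := irreducible_factors c0.
exists s, (fun p => mult p c); split=> //.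
- by move=> p ps; split; [apply: irrs | apply/lenV/irrA/irrs].
- move=> p pirr pN; have pP := irrA pirr.
  rewrite -(@mult_ndivides _ p pP c); first exact: lenV.
  by move=> /(cov p pirr)[p' p's /pN]; apply.
have prod0 : \prod_(p <- s) p ^+ mult p c != 0.
  by rewrite prodf_seq_neq0; apply/allP => y /irrs[y0 _ _] /=; apply: expf_neq0.
apply: associated_mult => // p pP; have sepp := sepA pP.
have [[p' p's pp']|pN] := pselect (exists2 p', p' \in s & associated p p').
  have p'P : prime_elt p' by apply/irrA/irrs.
  have E a : a != 0 -> mult p a = mult p' a by move=> a0; exact: mult_associated_prime pp'.
  rewrite !E // mult_prod_power // ?p's //; by move=> x xs /inj; apply.
rewrite mult_prod_power //; last by move=> x xs px; case: pN; exists x.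
case: ifP => [ps|_].
  by case: pN; exists p => //; exists 1; rewrite ?unitr1 ?mul1r.
by apply: (mult_ndivides pP) => /(cov p (prime_irreducible pP))[p' p's pp']; apply: pN; exists p'.
Qed.

(** At every prime both [c] and [c'] have the multiplicity prescribed by the local length, which is
    unique. *)
Lemma is_content_uniq c c' : is_content V c -> c' != 0 ->
  (forall p, prime_elt p -> has_local_length V p (mult p c')) -> associated c c'.
Proof.
move=> [s [l [[us inj] irrs outs cE]]] c'0 lenV; apply: associated_trans cE _.
have prod0 : \prod_(p <- s) p ^+ l p != 0.
  by rewrite prodf_seq_neq0; apply/allP => y /irrs[[y0 _ _] _] /=; apply: expf_neq0.
have irrs' p : p \in s -> irreducible_elt p by case/irrs.
have in_s p : p \in s -> mult p (\prod_(p <- s) p ^+ l p) = mult p c'.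
  move=> ps; have pP : prime_elt p by apply/irrA/irrs'.
  rewrite mult_prod_power // ?ps; last by move=> x xs; apply: inj.
  have [_ lenp] := irrs p ps; exact: has_local_length_uniq lenp (lenV p pP).
apply: associated_mult => // p pP; have sepp := sepA pP.
have [[p' p's pp']|pN] := pselect (exists2 p', p' \in s & associated p p').
  have p'P : prime_elt p' by apply/irrA/irrs'.
  by rewrite !(mult_associated_prime pP p'P sepp _ pp') // in_s.
rewrite mult_prod_power //; last by move=> x xs px; case: pN; exists x.
case: ifP => [ps|_].
  by case: pN; exists p => //; exists 1; rewrite ?unitr1 ?mul1r.
apply: has_local_length_uniq (lenV p pP).
by apply: outs => [|p' p's pp']; [exact: prime_irreducible | apply: pN; exists p'].
Qed.

End Content.
End Valuations.

Section MpolySeparated.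

Lemma msizeM_succ (k : fieldType) N (a b : {mpoly k[N]}) : a * b != 0 ->
  (msize a + msize b = (msize (a * b)).+1)%N.
Proof.
rewrite mulf_eq0 => /norP[a0 b0]; rewrite msizeM // prednK // addn_gt0.
by rewrite lt0n msize_poly_eq0 a0.
Qed.

(** A prime has positive degree, so its high powers exceed the degree of [a]. *)
Lemma separated_mpoly (k : fieldType) N (p : {mpoly k[N]}) : prime_elt p -> separated p.
Proof.
move=> [p0 pU _] a a0; exists (msize a) => -[b aE].
have sp : (1 < msize p)%N.
  rewrite ltnNge; apply/negP => /msize1_polyC pC; move: pU p0; rewrite pC mpolyC_eq0 => pU c0.
  by move: pU; rewrite mpolyC_unit.
have leX e : (e < msize (p ^+ e))%N.
  elim: e => [|e IHe]; first by rewrite expr0 msize1.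
  have E := @msizeM_succ _ _ p (p ^+ e); rewrite -exprS in E; rewrite -ltnS -E ?expf_neq0 //.
  by rewrite -addn2 addnC leq_add.
have E := @msizeM_succ _ _ b (p ^+ msize a); rewrite -aE in E; have := E a0.
move/eqP; rewrite gtn_eqF // -addn1 addnC leq_add ?leX //.
by rewrite lt0n msize_poly_eq0; apply: contraNneq a0 => b0; rewrite aE b0 mul0r.
Qed.

Variables (A : idomainType) (m : nat).
Implicit Types a b p : A.

Lemma divides_coef a (f : {mpoly A[m]}) mu : divides a%:MP f -> divides a f@_mu.
Proof. by move=> [g ->]; exists g@_mu; rewrite mulrC mcoeffCM mulrC. Qed.

Lemma separated_mpolyC p : separated p -> separated (p%:MP : {mpoly A[m]}).
Proof.
move=> sepp f f0; have [|e pe] := sepp f@_(mlead f); first by rewrite mleadc_eq0.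
by exists e; rewrite -rmorphXn => /(divides_coef (mlead f)).
Qed.

Lemma mult_mpolyC p a : prime_elt p -> separated p -> a != 0 ->
  mult (p%:MP : {mpoly A[m]}) a%:MP = mult p a.
Proof.
move=> pP sepp a0; have [b pb aE] := multP pP sepp a0.
apply: (mult_eq (prime_mpolyC m pP)); exists b%:MP; last first.
  by rewrite {1}aE mpolyCM rmorphXn.
by move=> /(divides_coef 0%MM); rewrite mcoeffC eqxx mulr1.
Qed.

End MpolySeparated.

(** * Multihomogeneous ideals *)

Lemma eventually_and q (P Q : 'X_{1..q} -> Prop) :
  eventually P -> eventually Q -> eventually (fun nu => P nu /\ Q nu).
Proof.
move=> [nu1 P1] [nu2 Q2]; exists (mlcm nu1 nu2) => nu; rewrite lem_mlcm => /andP[n1 n2].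
by split; [exact: P1 | exact: Q2].
Qed.

Lemma eventually_imp q (P Q : 'X_{1..q} -> Prop) :
  (forall nu, P nu -> Q nu) -> eventually P -> eventually Q.
Proof. by move=> PQ [nu0 P0]; exists nu0 => nu /P0/PQ. Qed.

Lemma eventually_ge q (mu : 'X_{1..q}) : eventually (fun nu => (mu <= nu)%MM).
Proof. by exists mu. Qed.

Lemma lem_sub2r q (m1 m2 mu : 'X_{1..q}) : (m1 + mu <= m2)%MM -> (m1 <= m2 - mu)%MM.
Proof.
by move=> /mnm_lepP le; apply/mnm_lepP => i; rewrite mnmBE leq_subRL ?[(mu i + _)%N]addnC
   -?mnmDE //; have := le i; rewrite mnmDE; lia.
Qed.

Lemma eventually_sub q (mu : 'X_{1..q}) (P : 'X_{1..q} -> Prop) :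
  eventually P -> eventually (fun nu => P (nu - mu)%MM).
Proof. by move=> [nu0 P0]; exists (nu0 + mu)%MM => nu /lem_sub2r/P0. Qed.

Lemma eventually_all q (I : finType) (P : I -> 'X_{1..q} -> Prop) :
  (forall i, eventually (P i)) -> eventually (fun nu => forall i, P i nu).
Proof.
move=> PE.
suff [nu0 P0] : eventually (fun nu => forall i, i \in enum I -> P i nu).
  by exists nu0 => nu /P0 Pi i; apply: Pi; rewrite mem_enum.
elim: (enum I) => [|i s [nu1 P1]]; first by exists 0%MM.
have [nu2 P2] := PE i; exists (mlcm nu1 nu2) => nu; rewrite lem_mlcm => /andP[n1 n2] j.
by rewrite inE => /orP[/eqP->|]; [exact: P2 | exact: P1].
Qed.

Section MultihomogPart.
Variables (q : nat) (n : 'I_q -> nat) (A : idomainType).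
Local Notation P := {mpoly A[nvars n]}.
Implicit Types (f g h : P) (nu mu : 'X_{1..q}) (J : ideal P).

Lemma mcoeff_part nu f m :
  (multihomog_part nu f)@_m = if multideg m == nu then f@_m else 0.
Proof.
rewrite /multihomog_part raddf_sum /=.
rewrite (eq_bigr (fun m' => if m' == m then f@_m' else 0)) => [|m' _]; last first.
  by rewrite mcoeffZ mcoeffX; case: eqP => _; rewrite ?mulr1 ?mulr0.
rewrite -big_mkcondr /=; case: ifP => [mnu|mnu]; last first.
  by apply: big1_seq => m' /andP[/andP[m'nu /eqP m'm] _]; rewrite -m'm m'nu in mnu.
have [mf|mf] := boolP (m \in msupp f); last first.
  rewrite (memN_msupp_eq0 mf); apply: big1_seq => m' /andP[/andP[_ /eqP->] m's].
  by rewrite m's in mf.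
rewrite big_mkcond (bigD1_seq m) ?msupp_uniq //= mnu eqxx big1 ?addr0 // => m'.
by move=> /negbTE->; rewrite andbF.
Qed.

Lemma multihomogP nu f :
  multihomog nu f <-> forall m, multideg m != nu -> f@_m = 0.
Proof.
split=> [fnu m mnu|fnu m]; last first.
  by rewrite mcoeff_msupp; apply: contraNeq => /fnu ->.
by apply: memN_msupp_eq0; apply: contra mnu => /fnu ->.
Qed.

Lemma part_multihomog nu f : multihomog nu (multihomog_part nu f).
Proof. by apply/multihomogP => m mnu; rewrite mcoeff_part (negbTE mnu). Qed.

Lemma part_id nu f : multihomog nu f -> multihomog_part nu f = f.
Proof.
move=> /multihomogP fnu; apply/mpolyP => m; rewrite mcoeff_part.
by case: eqVneq => // /fnu ->.
Qed.

Lemma part_neq nu mu f : multihomog mu f -> nu != mu -> multihomog_part nu f = 0.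
Proof.
move=> /multihomogP fmu numu; apply/mpolyP => m; rewrite mcoeff_part mcoeff0.
by case: eqP => // mnu; rewrite fmu // mnu.
Qed.

Lemma part_is_zmod_morphism nu : zmod_morphism (@multihomog_part q n A nu).
Proof.
by move=> f g; apply/mpolyP => m; rewrite mcoeffB !mcoeff_part mcoeffB; case: ifP; rewrite ?subr0.
Qed.
HB.instance Definition _ nu := GRing.isZmodMorphism.Build P P
  (@multihomog_part q n A nu) (part_is_zmod_morphism nu).

Lemma partB nu f g : multihomog_part nu (f - g) = multihomog_part nu f - multihomog_part nu g.
Proof. exact: raddfB. Qed.

Lemma part_sum nu (I : Type) (s : seq I) (Q : pred I) (F : I -> P) :
  multihomog_part nu (\sum_(i <- s | Q i) F i) = \sum_(i <- s | Q i) multihomog_part nu (F i).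
Proof. exact: raddf_sum. Qed.

Lemma multihomog0 nu : multihomog nu (0 : P).
Proof. exact: (submod0 (homog_submod n A nu)). Qed.

Lemma multihomogD nu f g : multihomog nu f -> multihomog nu g -> multihomog nu (f + g).
Proof. exact: (submodD (s := homog_submod n A nu)). Qed.

Lemma multihomogZ nu a f : multihomog nu f -> multihomog nu (a *: f).
Proof. exact: (submodZ (s := homog_submod n A nu)). Qed.

Lemma multihomog_sum nu (I : Type) (s : seq I) (Q : pred I) (F : I -> P) :
  (forall i, Q i -> multihomog nu (F i)) -> multihomog nu (\sum_(i <- s | Q i) F i).
Proof.
by move=> Fnu; apply: big_ind => //; [exact: multihomog0 | exact: multihomogD].
Qed.

Lemma multihomogX m : multihomog (multideg m) ('X_[m] : P).
Proof. by move=> m'; rewrite msuppX inE => /eqP->. Qed.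

Lemma multihomogM nu mu f g :
  multihomog nu f -> multihomog mu g -> multihomog (nu + mu)%MM (f * g).
Proof.
move=> fnu gmu m /msuppM_le/allpairsP[[m1 m2] [/= m1f m2g ->]].
by rewrite multidegD (fnu _ m1f) (gmu _ m2g).
Qed.

Lemma partM nu mu f g : multihomog mu g ->
  multihomog_part nu (f * g) = if (mu <= nu)%MM then multihomog_part (nu - mu)%MM f * g else 0.
Proof.
move=> gmu; elim/mpolyind: f => [|c m f _ _ IHf].
  by rewrite mul0r !raddf0 mul0r if_same.
rewrite mulrDl !raddfD /= IHf mulrDl; case: ifP => [le|nle]; last first.
  rewrite addr0; apply: (@part_neq _ (multideg m + mu)%MM).
    by apply: multihomogM => //; apply/multihomogZ/multihomogX.
  by apply: contraFneq nle => ->; apply: lem_addl.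
congr (_ + _); have cXm : multihomog (multideg m) (c *: 'X_[m]) by apply/multihomogZ/multihomogX.
have [E|NE] := eqVneq (nu - mu)%MM (multideg m).
  rewrite E (part_id cXm) part_id // -(submK le) E; exact: multihomogM.
rewrite (part_neq cXm NE) mul0r; apply: part_neq (multihomogM cXm gmu) _.
by apply: contraNneq NE => ->; rewrite addmK.
Qed.

Lemma sum_parts f : f = \sum_(nu <- undup (map (@multideg q n) (msupp f))) multihomog_part nu f.
Proof.
apply/mpolyP => m; rewrite raddf_sum /=.
rewrite (eq_bigr (fun nu => if nu == multideg m then f@_m else 0)) => [|nu _]; last first.
  by rewrite mcoeff_part eq_sym.
rewrite -big_mkcond /=; have [mf|mf] := boolP (m \in msupp f).
  rewrite -big_filter filter_pred1_uniq ?undup_uniq ?big_seq1 //.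
  by rewrite mem_undup map_f.
by rewrite (memN_msupp_eq0 mf) big1.
Qed.

Lemma multihomog_ideal_gen (G : P -> Prop) :
  (forall g, G g -> forall nu, ideal_gen G (multihomog_part nu g)) ->
  multihomog_ideal (ideal_gen G).
Proof.
move=> Gpart f [m [a [g [Gg ->]]]] nu; rewrite part_sum.
apply: (ideal_sum (J := ideal_gen G)) => i _.
rewrite (sum_parts (g i)) mulr_sumr part_sum.
apply: (ideal_sum (J := ideal_gen G)) => mu _.
rewrite (partM _ _ (@part_multihomog mu (g i))); case: ifP => _; last exact: ideal0.
by apply/idealM/Gpart.
Qed.

Lemma multihomog_ideal_add J (G : P -> Prop) : multihomog_ideal J ->
  (forall g, G g -> exists nu, multihomog nu g) -> multihomog_ideal (ideal_add J G).
Proof.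
move=> homJ homG; apply: multihomog_ideal_gen => g [Jg|Gg] nu.
  by apply: ideal_gen_mem; left; apply: homJ.
have [mu gmu] := homG _ Gg; have [->|/(part_neq gmu)->] := eqVneq nu mu.
  by rewrite part_id //; apply: ideal_gen_mem; right.
exact: ideal0.
Qed.

Lemma ideal_addP (I : finType) J (F : I -> P) (Q : pred I) x :
  ideal_add J (fun g => exists2 i, Q i & g = F i) x <->
  exists a : I -> P, J (x - \sum_(i | Q i) a i * F i).
Proof.
split=> [|[a Ja]]; last first.
  apply: ideal_trans (ideal_gen_mem _) _; first by left; exact: Ja.
  by apply: ideal_sum => i Qi; apply/idealM/ideal_gen_mem; right; exists i.
have [U UE] : exists U : ideal P, forall x, U x <-> exists a : I -> P, J (x - \sum_(i | Q i) a i * F i).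
  unshelve eexists (@Ideal P (fun x => exists a : I -> P, J (x - \sum_(i | Q i) a i * F i)) _ _ _) => //.
  - by exists (fun=> 0); rewrite big1 ?subr0 => [|i _]; [exact: ideal0 | rewrite mul0r].
  - move=> y z [a Ja] [b Jb]; exists (fun i => a i + b i).
    have -> : \sum_(i | Q i) (a i + b i) * F i = \sum_(i | Q i) a i * F i + \sum_(i | Q i) b i * F i.
      by rewrite -big_split; apply: eq_bigr => i _; rewrite mulrDl.
    by rewrite opprD addrACA; apply: idealD.
  - move=> c y [a Ja]; exists (fun i => c * a i).
    have -> : \sum_(i | Q i) c * a i * F i = c * \sum_(i | Q i) a i * F i.
      by rewrite mulr_sumr; apply: eq_bigr => i _; rewrite mulrA.
    by rewrite -mulrBr; apply: idealM.
move=> Jx; apply/UE; move: Jx; apply: ideal_gen_min => g [Jg|[i Qi ->]]; apply/UE.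
  by exists (fun=> 0); rewrite big1 ?subr0 // => i _; rewrite mul0r.
exists (fun j => (j == i)%:R); rewrite (bigD1 i) //= eqxx mul1r big1 ?addr0 ?subrr.
  exact: ideal0.
by move=> j /andP[_ /negbTE->]; rewrite mul0r.
Qed.

(** The homogeneous parts of the coefficients suffice. The bounds [d i <= nu] make the truncated
    differences [nu - d i] genuine. *)
Lemma ideal_add_homog (I : finType) J (F : I -> P) (Q : pred I) (d : I -> 'X_{1..q}) nu x :
  multihomog_ideal J -> (forall i, multihomog (d i) (F i)) ->
  (forall i, (d i <= nu)%MM) -> multihomog nu x ->
  ideal_add J (fun g => exists2 i, Q i & g = F i) x <->
  exists a : I -> P, (forall i, multihomog (nu - d i)%MM (a i)) /\
     J (x - \sum_(i | Q i) a i * F i).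
Proof.
move=> homJ Fd dnu xnu; rewrite ideal_addP; split=> [[a Ja]|[a [_ Ja]]]; last by exists a.
exists (fun i => multihomog_part (nu - d i)%MM (a i)); split.
  by move=> i; apply: part_multihomog.
suff <- : multihomog_part nu (x - \sum_(i | Q i) a i * F i) =
    x - \sum_(i | Q i) multihomog_part (nu - d i)%MM (a i) * F i by apply: homJ.
rewrite partB part_sum (part_id xnu); congr (_ - _); apply: eq_bigr => i _.
by rewrite (partM _ _ (Fd i)) dnu.
Qed.

End MultihomogPart.

(** * Exactness of Koszul complexes *)

Section KoszulExact.
Variables (q : nat) (n : 'I_q -> nat) (A : idomainType).
Local Notation P := {mpoly A[nvars n]}.
Variables (r : nat) (d : 'I_r.+1 -> 'X_{1..q}) (f : 'I_r.+1 -> P).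
Hypothesis fd : forall i, multihomog (d i) (f i).
Variable J : ideal P.
Hypothesis homJ : multihomog_ideal J.
Local Notation chain := {ffun {set 'I_r.+1} -> P}.
Local Notation term := (koszul_term n A d).
Local Notation rel := (koszul_rel r J).
Local Notation diff := (koszul_diff f).
Implicit Types (w z : chain) (S : {set 'I_r.+1}) (nu : 'X_{1..q}).

Lemma diffE w S : diff w S = \sum_(i | i \notin S) koszul_sign n A i S * f i * w (i |: S).
Proof. by rewrite ffunE. Qed.

Lemma chainB w w' S : (w - w') S = w S - w' S.
Proof. by rewrite ffunE [X in _ + X]ffunE. Qed.

Lemma chainD w w' S : (w + w') S = w S + w' S.
Proof. by rewrite ffunE. Qed.

Lemma diffD w w' : diff (w + w') = diff w + diff w'.
Proof. exact: (raddfD (diff : {additive chain -> chain})). Qed.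

Lemma diffB w w' : diff (w - w') = diff w - diff w'.
Proof. exact: (raddfB (diff : {additive chain -> chain})). Qed.

(** Chains on the [e_i] with [i < t]: the Koszul complex of the first [t] forms is kept as a
    subcomplex of the full one. *)
Definition supported (t : nat) w : Prop :=
  forall S (i : 'I_r.+1), i \in S -> (t <= i)%N -> w S = 0.

Lemma supported_diff t w : supported t w -> supported t (diff w).
Proof.
move=> wt S i iS ti; rewrite diffE big1 // => j _.
by rewrite (wt _ i) ?mulr0 // !inE iS orbT.
Qed.

Lemma sign0 (i : 'I_r.+1) : koszul_sign n A i set0 = 1 :> P.
Proof.
by rewrite /koszul_sign (_ : [set j in set0 | _] = set0) ?cards0 //; apply/setP => j; rewrite !inE.
Qed.

Lemma signU (i t : 'I_r.+1) S : (i < t)%N ->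
  koszul_sign n A i (t |: S) = koszul_sign n A i S :> P.
Proof.
move=> it; rewrite /koszul_sign; congr (_ ^+ #|pred_of_set _|); apply/setP => j.
by rewrite !inE; case: eqP => // ->; rewrite ltnNge (ltnW it) !andbF.
Qed.

Definition total_deg : 'X_{1..q} := (\sum_i d i)%MM.

Lemma total_deg_ge i : (d i <= total_deg)%MM.
Proof. by rewrite /total_deg (bigD1 i) //=; apply: lem_addr. Qed.

Section Split.
Variable t : 'I_r.+1.

(** A chain on [e_0, ..., e_t] is its bottom part plus its top part wedge [e_t], with [e_t] written
    last; [top_chain] is the wedge by [e_t]. *)
Definition top_part w : chain := [ffun S : {set 'I_r.+1} => if t \in S then 0 else w (t |: S)].
Definition bottom_part w : chain := [ffun S : {set 'I_r.+1} => if t \in S then 0 else w S].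
Definition top_chain w : chain := [ffun S : {set 'I_r.+1} => if t \in S then w (S :\ t) else 0].

Lemma top_part_supported w : supported t.+1 w -> supported t (top_part w).
Proof.
move=> wt S i iS; rewrite leq_eqVlt ffunE => /orP[/eqP/val_inj ti|ti].
  by rewrite ti iS.
by case: ifP => // _; apply: (wt _ i); rewrite ?inE ?iS ?orbT.
Qed.

Lemma bottom_part_supported w : supported t.+1 w -> supported t (bottom_part w).
Proof.
move=> wt S i iS; rewrite leq_eqVlt ffunE => /orP[/eqP/val_inj ti|ti].
  by rewrite ti iS.
by case: ifP => // _; apply: (wt _ i).
Qed.

Lemma top_chain_supported w : supported t w -> supported t.+1 (top_chain w).
Proof.
move=> wt S i iS ti; rewrite ffunE; case: ifP => // _; apply: (wt _ i _ (ltnW ti)).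
by rewrite !inE iS andbT -val_eqE /= gtn_eqF.
Qed.

Lemma top_part_term nu p w : (d t <= nu)%MM -> term nu p.+1 w -> term (nu - d t) p (top_part w).
Proof.
move=> dnu wT S; rewrite ffunE; case: ifP => tS; first by split=> // m; rewrite msupp0.
have [wp wnu] := wT (t |: S); split=> [Sp|m /wnu].
  by apply: wp; rewrite cardsU1 tS => -[].
rewrite big_setU1 ?tS //= => <-; apply/mnmP => j.
by rewrite mnmBE !mnmDE mnm_sumE; lia.
Qed.

Lemma bottom_part_term nu p w : term nu p w -> term nu p (bottom_part w).
Proof.
by move=> wT S; rewrite ffunE; case: ifP => tS; [split=> // m; rewrite msupp0 | apply: wT].
Qed.

Lemma top_chain_term nu p w : (d t <= nu)%MM -> term (nu - d t) p w -> term nu p.+1 (top_chain w).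
Proof.
move=> dnu wT S; rewrite ffunE; case: ifP => tS; last by split=> // m; rewrite msupp0.
have [wp wnu] := wT (S :\ t); split=> [Sp|m /wnu E].
  by apply: wp => E; apply: Sp; rewrite (cardsD1 t) tS E.
rewrite (big_setD1 t) //= -(submK dnu) -E [RHS]addmC [RHS]addmA; congr (_ + _)%MM.
Qed.

(** [t] is larger than every other index involved, so adjoining it to [S] changes no sign. *)
Lemma diff_top_part w : supported t.+1 w ->
  forall S, t \notin S -> diff (top_part w) S = diff w (t |: S).
Proof.
move=> wt S tS; rewrite !diffE [LHS](bigD1 t) //= [top_part w _]ffunE setU11 mulr0 add0r.
rewrite [LHS](eq_bigl (fun i => i \notin t |: S)) => [|i]; last first.
  by rewrite !inE negb_or andbC.
apply: eq_bigr => i; rewrite !inE negb_or => /andP[it iS].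
rewrite ffunE !inE eq_sym (negbTE it) (negbTE tS) /= setUCA.
have [lit|] := ltnP i t; first by rewrite signU.
rewrite leq_eqVlt => /orP[/eqP/val_inj ti|ti]; first by rewrite ti eqxx in it.
by rewrite (wt _ i) ?mulr0 // !inE eqxx.
Qed.

Lemma diff_top_part_in w S : t \in S -> diff (top_part w) S = 0.
Proof.
by move=> tS; rewrite diffE big1 // => i _; rewrite ffunE !inE tS orbT mulr0.
Qed.

Lemma diff_top_chain w : supported t w ->
  forall S, t \notin S -> diff (top_chain w) (t |: S) = diff w S.
Proof.
move=> wt S tS; have {2}-> : w = top_part (top_chain w).
  apply/ffunP => S'; rewrite !ffunE; case: ifP => tS'; first exact: wt tS' _.
  by rewrite setU11 setU1K ?tS'.
by rewrite diff_top_part //; apply: top_chain_supported.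
Qed.

(* The complex on [e_0, ..., e_t] is the mapping cone of [f t] on the complex
   on [e_0, ..., e_(t-1)]: a cycle whose top part is a boundary is homologous
   to a cycle that does not involve [e_t]. *)
Lemma exact_split nu p w z : (d t <= nu)%MM ->
  (forall w', term nu p.+1 w' -> supported t w' -> rel (diff w') ->
     exists z', [/\ term nu p.+2 z', supported t z' & rel (w' - diff z')]) ->
  term nu p.+1 w -> supported t.+1 w -> rel (diff w) ->
  term (nu - d t) p.+1 z -> supported t z -> rel (top_part w - diff z) ->
  exists z', [/\ term nu p.+2 z', supported t.+1 z' & rel (w - diff z')].
Proof.
move=> dnu IH wT wt dw zT zt wz.
(* Subtracting the boundary of [z] wedge [e_t] puts the top part into [J]; [w3] then discards that
   part. *)
set tz := top_chain z; set w2 := w - diff tz; set w3 := bottom_part w2.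
have tzT : term nu p.+2 tz by apply: top_chain_term.
have tzt : supported t.+1 tz by apply: top_chain_supported.
have dtzT : term nu p.+1 (diff tz) by apply: koszul_diff_term.
have w2T : term nu p.+1 w2 by apply: submodD => //; apply: submodN.
have w2t : supported t.+1 w2.
  by move=> S i iS ti; rewrite chainB (wt _ _ iS ti) (supported_diff tzt iS ti) subr0.
have w23 : rel (w2 - w3).
  move=> S; rewrite chainB [w3 S]ffunE.
  case: ifP => tS; last by rewrite subrr; apply: ideal0.
  have := wz (S :\ t); rewrite chainB [top_part _ _]ffunE.
  by rewrite !inE eqxx /= setD1K // -diff_top_chain ?inE ?eqxx // setD1K // subr0 -chainB.
have dw3 : rel (diff w3).
  have -> : diff w3 = diff w - diff (w2 - w3).
    by rewrite !diffB koszul_diffK subr0 subKr.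
  by apply: submodD => //; apply/submodN/koszul_diff_rel.
have w3T : term nu p.+1 w3 by apply: bottom_part_term.
have w3t : supported t w3 by apply: bottom_part_supported.
have [z' [z'T z't wz']] := IH w3 w3T w3t dw3.
exists (tz + z'); split; first exact: submodD.
  by move=> S i iS ti; rewrite chainD (tzt _ _ iS ti) (z't _ _ iS (ltnW ti)) addr0.
have -> : w - diff (tz + z') = (w2 - w3) + (w3 - diff z').
  by rewrite diffD subrKA /w2 opprD addrA.
exact: submodD.
Qed.

End Split.

Definition lower_ideal (t : nat) : ideal P :=
  ideal_add J (fun g => exists2 j : 'I_r.+1, (j < t)%N & g = f j).

(** Filter-regularity speaks of membership in the ideal of [J] and the first [t] forms, the
    induction of boundaries; in degree 0 the two coincide. *)
Lemma lower_ideal_cycle (t : nat) nu g : (total_deg <= nu)%MM -> multihomog nu g ->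
  lower_ideal t g <-> exists z, [/\ term nu 1 z, supported t z &
    rel ([ffun S : {set 'I_r.+1} => if S == set0 then g else 0] - diff z)].
Proof.
move=> dnu gnu.
have dinu i : (d i <= nu)%MM by apply: lepm_trans dnu; apply: total_deg_ge.
split=> [|[z [zT zt gz]]].
  case/(ideal_add_homog (fun j : 'I_r.+1 => (j < t)%N) homJ fd dinu gnu) => a [anu Ja].
  pose z : chain := [ffun S : {set 'I_r.+1} => \sum_(i : 'I_r.+1 | (S == [set i]) && (i < t)%N) a i].
  have zE i : z [set i] = if (i < t)%N then a i else 0.
    rewrite ffunE; case: ifP => it; last first.
      by apply: big1 => j /andP[/eqP/set1_inj<-]; rewrite it.
    rewrite (big_pred1 i) // => j; rewrite (inj_eq set1_inj) /= eq_sym.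
    by case: eqP => // ->; rewrite it.
  have z0 S : #|S| <> 1%N -> z S = 0.
    by move=> S1; rewrite ffunE big1 // => i /andP[/eqP SE]; rewrite SE cards1 in S1.
  exists z; split.
  - move=> S; split=> [/z0 //|m]; have [/cards1P[i ->]|/eqP/z0->] := boolP (#|S| == 1%N); last first.
      by rewrite msupp0.
    rewrite zE big_set1; case: ifP => _; last by rewrite msupp0.
    by move=> /anu ->; rewrite -{2}(submK (dinu i)) addmC.
  - move=> S i iS ti; have [/cards1P[j SE]|/eqP/z0//] := boolP (#|S| == 1%N).
    by move: iS; rewrite SE inE => /eqP<-; rewrite zE ltnNge ti.
  - move=> S; rewrite chainB [X in J (X - _)]ffunE diffE.
    case: eqP => [->|/eqP/set0Pn[i iS]].
      rewrite (eq_bigr (fun i => f i * z [set i])) => [|i _]; last by rewrite sign0 mul1r setU0.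
      rewrite (eq_bigl predT) => [|i]; last by rewrite inE.
      suff -> : \sum_i f i * z [set i] = \sum_(i : 'I_r.+1 | (i < t)%N) a i * f i by [].
      rewrite [RHS]big_mkcond; apply: eq_bigr => i _.
      by rewrite zE; case: ifP => _; rewrite ?mulr0 // mulrC.
    rewrite sub0r big1 ?oppr0; first exact: ideal0.
    move=> j jS; rewrite z0 ?mulr0 // cardsU1 jS /= (cardsD1 i) iS.
    by rewrite add1n addSn.
have := gz set0; rewrite chainB [X in J (X - _)]ffunE eqxx diffE.
rewrite (eq_bigr (fun i => f i * z [set i])) => [|i _]; last by rewrite sign0 mul1r setU0.
rewrite (eq_bigl predT) => [|i]; last by rewrite inE.
move=> Jg; apply/(ideal_addP _ _ (fun j : 'I_r.+1 => (j < t)%N)); exists (fun i => z [set i]).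
rewrite (_ : \sum_(i : 'I_r.+1 | _) _ = \sum_i f i * z [set i]) //.
rewrite big_mkcond; apply: eq_bigr => i _; rewrite mulrC; case: ltnP => // ti.
by rewrite (zt _ i) ?mulr0 // inE.
Qed.

(** Induction on the number of forms. The top part of a cycle lives in multidegree [nu - d t], so
    [nu] must be large enough for the induction hypothesis there too. *)
Lemma koszul_exact (t : nat) : (t <= r.+1)%N ->
  (forall i : 'I_r.+1, (i < t)%N -> filter_regular (lower_ideal i) (f i)) ->
  eventually (fun nu => forall p w, term nu p.+1 w -> supported t w -> rel (diff w) ->
     exists z, [/\ term nu p.+2 z, supported t z & rel (w - diff z)]).
Proof.
elim: t => [|t IHt] tr reg.
  exists 0%MM => nu _ p w wT w0 _; exists 0; split; [exact: submod0 | by move=> S i; rewrite ffunE|].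
  move=> S; rewrite linear0 subr0; have [S0|] := eqVneq S set0.
    by rewrite (wT S).1 ?S0 ?cards0 //; apply: ideal0.
  by case/set0Pn=> i iS; rewrite (w0 _ _ iS) //; apply: ideal0.
have {}IHt : eventually _ := IHt (ltnW tr) (fun i it => reg i (ltnW it)).
pose T := Ordinal tr.
have regT : filter_regular _ _ := reg T (ltnSn t).
have := eventually_and (eventually_and IHt (eventually_sub (d T) IHt))
  (eventually_and (eventually_sub (d T) regT)
  (eventually_and (eventually_ge (d T)) (eventually_sub (d T) (eventually_ge total_deg)))).
apply: eventually_imp => nu [[IH IH'] [regnu [dnu tdnu]]] p w wT wt dw.
have topT : term (nu - d T) p (top_part T w) by apply: top_part_term.
have topt : supported t (top_part T w) by apply: (@top_part_supported T).
have [z [zT zt wz]] : exists z, [/\ term (nu - d T) p.+1 z, supported t z &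
    rel (top_part T w - diff z)].
  (* For [p > 0] the top part is a cycle and the induction hypothesis applies. For [p = 0] it is a
     polynomial killed by [f T] modulo the previous forms: this is where filter-regularity
     enters. *)
  case: p => [|p] in wT topT *; last first.
    apply: (IH' p) => // S; have [TS|TS] := boolP (T \in S).
      by rewrite diff_top_part_in //; apply: ideal0.
    by rewrite diff_top_part.
  have topE : top_part T w = [ffun S : {set 'I_r.+1} => if S == set0 then w [set T] else 0].
    apply/ffunP => S; rewrite [RHS]ffunE; case: eqP => [->|/eqP S0].
      by rewrite ffunE inE setU0.
    by apply: (topT S).1 => /eqP; rewrite cards_eq0 (negbTE S0).
  have gnu : multihomog (nu - d T)%MM (w [set T]).
    have := (topT set0).2; rewrite topE ffunE eqxx big_set0 => gnu m /gnu.
    by rewrite add0m.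
  rewrite topE; apply/(lower_ideal_cycle t tdnu gnu); apply: regnu => //.
  have := dw set0; rewrite diffE (bigD1 T) ?inE //= sign0 mul1r setU0 => Jd.
  apply: ideal_trans (_ : lower_ideal t (- \sum_(i | (i \notin set0) && (i != T))
      koszul_sign n A i set0 * f i * w (i |: set0))).
    by rewrite opprK; apply: ideal_gen_mem; left.
  apply/idealN/ideal_sum => i /andP[_ iT]; rewrite setU0.
  have [it|] := ltnP i t.
    apply: (ideal_mulr (J := lower_ideal t)); apply: (idealM (i := lower_ideal t)).
    by apply: ideal_gen_mem; right; exists i.
  rewrite leq_eqVlt => /orP[/eqP Ti|ti]; first by case/eqP: iT; apply: val_inj.
  by rewrite (wt _ i) ?mulr0 ?inE //; apply: ideal0.
exact: (@exact_split T nu p w z dnu (IH p)).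
Qed.

End KoszulExact.

Lemma qmod_pi0 (R : nzRingType) (V : lmodType R) (S : submodule V) : qmod_pi S 0 = 0.
Proof. by []. Qed.

Lemma qmod_pi_eq0 (R : nzRingType) (V : lmodType R) (S : submodule V) x :
  qmod_pi S x = 0 <-> S x.
Proof. by rewrite -qmod_pi0 qmod_piP subr0. Qed.

Section KoszulComplex.
Variables (q : nat) (n : 'I_q -> nat) (A : idomainType).
Local Notation P := {mpoly A[nvars n]}.
Variables (r : nat) (d : 'I_r.+1 -> 'X_{1..q}) (f : 'I_r.+1 -> P).
Hypothesis fd : forall i, multihomog (d i) (f i).
Variable J : ideal P.
Hypothesis homJ : multihomog_ideal J.
Local Notation chain := {ffun {set 'I_r.+1} -> P}.
Local Notation term := (koszul_term n A d).
Local Notation rel := (koszul_rel r J).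
Local Notation diff := (koszul_diff f).

Lemma submod_typeP (R : nzRingType) (V : lmodType R) (T : submodule V) (x : submod_type T) :
  T (val x).
Proof. exact: asboolW (submod_valP x). Qed.

Lemma koszul_mapE nu p (x : submod_type (term nu p.+1)) :
  koszul_map fd (qmod_pi (submod_restr (term nu p.+1) rel) x) =
  qmod_pi (submod_restr (term nu p) rel)
    (SubmodType (subquot_map_subproof (@koszul_diff_term _ _ _ _ _ _ fd nu p) x)).
Proof. exact: (subquot_mapE _ (@koszul_diff_rel q n A r f J)). Qed.

Lemma koszul_term_gt nu p : (r.+1 < p)%N -> forall w, term nu p w -> w = 0.
Proof.
move=> rp w wT; apply/ffunP => S; rewrite ffunE; apply: (wT S).1 => Sp.
by have := max_card (mem S); rewrite Sp card_ord leqNgt rp.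
Qed.

Lemma koszul_mod_gt nu p (x : koszul_mod d J nu p) : (r.+1 < p)%N -> x = 0.
Proof.
move=> rp; elim/qmod_ind: x => x; apply/qmod_pi_eq0 => /= S.
by rewrite (koszul_term_gt rp (submod_typeP x)) ffunE; apply: ideal0.
Qed.

Lemma supported_all (w : chain) : supported r.+1 w.
Proof. by move=> S i _; rewrite leqNgt ltn_ord. Qed.

Lemma koszul_complex_exact : filter_regular_seq f J ->
  eventually (fun nu => forall p (x : koszul_mod d J nu p.+1), koszul_map fd x = 0 ->
    exists y, koszul_map fd y = x).
Proof.
move=> reg; have := koszul_exact fd homJ (leqnn r.+1) (fun i _ => reg i).
apply: eventually_imp => nu exact_nu p; elim/qmod_ind=> x.
rewrite koszul_mapE => /qmod_pi_eq0 /= dx.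
have [z [zT _ xz]] := exact_nu p _ (submod_typeP x) (supported_all _) dx.
exists (qmod_pi _ (@SubmodType _ _ (term nu p.+2) z (asboolI zT))).
rewrite koszul_mapE; apply/qmod_piP.
by have := submodN xz; rewrite opprB.
Qed.

Definition chain_eval (w : chain) : P := w set0.

Lemma chain_eval_is_linear : linear chain_eval.
Proof. by move=> a w w'; rewrite /chain_eval !ffunE. Qed.
HB.instance Definition _ := GRing.isLinear.Build A chain P _ chain_eval chain_eval_is_linear.

Variable J' : ideal P.
Hypothesis J'E : forall x, J' x <-> lower_ideal f J r.+1 x.

Lemma chain_eval_term nu w : term nu 0 w -> homog_submod n A nu (chain_eval w).
Proof. by move=> /(_ set0)[_]; rewrite big_set0 => wnu m /wnu; rewrite add0m. Qed.

Lemma chain_eval_rel w : rel w -> ideal_submod J' (chain_eval w).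
Proof. by move=> wJ; apply/J'E/ideal_gen_mem; left; apply: wJ. Qed.

Definition koszul_aug nu : koszul_mod d J nu 0 -> gcomp J' nu :=
  @subquot_map A chain P (term nu 0) rel (homog_submod n A nu) (ideal_submod J')
    chain_eval (@chain_eval_term nu).

Lemma koszul_aug_is_linear nu : linear (@koszul_aug nu).
Proof. exact: subquot_map_is_linear chain_eval_rel. Qed.

Lemma koszul_augE nu x : koszul_aug (qmod_pi (submod_restr (term nu 0) rel) x) =
  qmod_pi (submod_restr (homog_submod n A nu) (ideal_submod J'))
    (SubmodType (subquot_map_subproof (@chain_eval_term nu) x)).
Proof. exact: (subquot_mapE _ chain_eval_rel). Qed.

Lemma const_chain_term nu g : multihomog nu g ->
  term nu 0 [ffun S : {set 'I_r.+1} => if S == set0 then g else 0].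
Proof.
move=> gnu S; rewrite ffunE; case: eqP => [->|/eqP S0].
  by rewrite cards0 big_set0; split=> // m /gnu <-; rewrite add0m.
by split=> // m; rewrite msupp0.
Qed.

Lemma const_chainE nu w : term nu 0 w ->
  w = [ffun S : {set 'I_r.+1} => if S == set0 then w set0 else 0].
Proof.
move=> wT; apply/ffunP => S; rewrite [RHS]ffunE; case: eqP => [->//|/eqP S0].
by apply: (wT S).1 => /eqP; rewrite cards_eq0 (negbTE S0).
Qed.

Lemma koszul_aug_surj nu u : exists x, @koszul_aug nu x = u.
Proof.
elim/qmod_ind: u => g.
exists (qmod_pi _ (SubmodType (asboolI (const_chain_term (submod_typeP g))))).
rewrite koszul_augE; apply/qmod_piP => /=.
by rewrite /chain_eval ffunE eqxx subrr; apply: ideal0.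
Qed.

Lemma koszul_aug_ker nu : (total_deg d <= nu)%MM -> forall x : koszul_mod d J nu 0,
  koszul_aug x = 0 <-> exists y, x = koszul_map fd y.
Proof.
move=> dnu; elim/qmod_ind=> x; rewrite koszul_augE qmod_pi_eq0 /=.
have xT := submod_typeP x; have gnu := chain_eval_term xT.
rewrite J'E (lower_ideal_cycle fd homJ r.+1 dnu gnu) -(const_chainE xT); split.
  move=> [z [zT _ xz]]; exists (qmod_pi _ (@SubmodType _ _ (term nu 1) z (asboolI zT))).
  by rewrite koszul_mapE; apply/qmod_piP.
move=> [y]; elim/qmod_ind: y => y; rewrite koszul_mapE => /qmod_piP xy.
by exists (val y); split; [exact: submod_typeP | exact: supported_all | exact: xy].
Qed.

End KoszulComplex.

(** * Filter-regularity of generic polynomials *)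

Lemma mcoeffXM n (R : nzRingType) (m k : 'X_{1..n}) (f : {mpoly R[n]}) :
  ('X_[m] * f)@_k = if (m <= k)%MM then f@_(k - m) else 0.
Proof.
rewrite -commr_mpolyX; case: ifP => [mk|mk]; first by rewrite -{1}(submK mk) addmC mcoeffMX.
apply: memN_msupp_eq0; apply: contraFN mk => /msuppM_le/allpairsP[[m1 m2] [/= _ m2X ->]].
by move: m2X; rewrite msuppX inE => /eqP->; apply: lem_addl.
Qed.

Section ParameterCoef.
Variables (R : idomainType) (N v : nat).
Local Notation RN := {mpoly R[N]}.
Local Notation P := {mpoly RN[v]}.
Implicit Types (f g h : P) (mu nu : 'X_{1..N}) (J : ideal {mpoly R[v]}).

(** A polynomial over [R[u]] is viewed as a family of polynomials over [R], indexed by the monomials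
    in the parameters [u]. *)
Definition ucoef mu f : {mpoly R[v]} := map_mpoly (mcoeff mu) f.

Lemma mcoeff_ucoef mu f m : (ucoef mu f)@_m = f@_m@_mu.
Proof. by rewrite mcoeff_map_mpoly. Qed.

Lemma ucoef_ext f g : (forall mu, ucoef mu f = ucoef mu g) -> f = g.
Proof.
move=> fg; apply/mpolyP => m; apply/mpolyP => mu.
by have := congr1 (mcoeff m) (fg mu); rewrite !mcoeff_ucoef.
Qed.

Lemma ucoef_is_zmod_morphism mu : zmod_morphism (ucoef mu).
Proof. by move=> f g; apply/mpolyP => m; rewrite mcoeffB !mcoeff_ucoef !mcoeffB. Qed.
HB.instance Definition _ mu := GRing.isZmodMorphism.Build P {mpoly R[v]}
  (ucoef mu) (ucoef_is_zmod_morphism mu).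

Lemma ucoefD mu f g : ucoef mu (f + g) = ucoef mu f + ucoef mu g.
Proof. exact: raddfD. Qed.

Lemma ucoef_sum mu (I : Type) (s : seq I) (Q : pred I) (F : I -> P) :
  ucoef mu (\sum_(i <- s | Q i) F i) = \sum_(i <- s | Q i) ucoef mu (F i).
Proof. exact: raddf_sum. Qed.

Lemma ucoef0 mu : ucoef mu 0 = 0.
Proof. exact: raddf0. Qed.

Lemma ucoefXM mu m f : ucoef mu ('X_[m] * f) = 'X_[m] * ucoef mu f.
Proof.
by apply/mpolyP => k; rewrite mcoeff_ucoef !mcoeffXM; case: ifP => _;
  rewrite ?mcoeff0 ?mcoeff_ucoef.
Qed.

Lemma ucoefZX mu nu f :
  ucoef mu ('X_[nu] *: f) = if (nu <= mu)%MM then ucoef (mu - nu)%MM f else 0.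
Proof.
apply/mpolyP => k; rewrite mcoeff_ucoef mcoeffZ mcoeffXM.
by case: ifP => _; rewrite ?mcoeff0 ?mcoeff_ucoef.
Qed.

Lemma ucoefZC mu c f : ucoef mu (c%:MP *: f) = c *: ucoef mu f.
Proof. by apply/mpolyP => k; rewrite mcoeff_ucoef !mcoeffZ mcoeffCM mcoeff_ucoef. Qed.

Lemma ucoef_const mu (f : {mpoly R[v]}) :
  ucoef mu (map_mpoly (@mpolyC N R) f) = if mu == 0%MM then f else 0.
Proof.
apply/mpolyP => k; rewrite mcoeff_ucoef mcoeff_map_mpoly mcoeffC.
by case: eqP => _; rewrite ?mulr1 ?mulr0 ?mcoeff0.
Qed.

(** The extension of [J] to the ring with parameters, described coefficientwise so that membership
    can be tested; [ext_idealP] gives its generators. *)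
Definition ext_ideal J : ideal P.
Proof.
apply: (@Ideal P (fun f => forall mu, J (ucoef mu f))).
- by move=> mu; rewrite ucoef0; apply: ideal0.
- by move=> f g Jf Jg mu; rewrite ucoefD; apply: idealD.
move=> a f Jf; elim/mpolyind: a => [|c m a _ _ IHa] mu.
  by rewrite mul0r ucoef0; apply: ideal0.
rewrite mulrDl ucoefD; apply: idealD; last exact: IHa.
rewrite -scalerAl; set G := 'X_[m] * f.
have JG nu : J (ucoef nu G) by rewrite ucoefXM; apply: idealM.
elim/mpolyind: c => [|s nu c _ _ IHc]; first by rewrite scale0r ucoef0; apply: ideal0.
rewrite scalerDl ucoefD; apply: idealD; last exact: IHc.
have -> : (s *: 'X_[nu]) *: G = s%:MP *: ('X_[nu] *: G) by rewrite scalerA mul_mpolyC.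
rewrite ucoefZC -mul_mpolyC; apply: idealM; rewrite ucoefZX.
by case: ifP => _; [exact: JG | exact: ideal0].
Defined.

Lemma ucoef_sum_supp f : exists s : seq 'X_{1..N},
  f = \sum_(mu <- s) 'X_[mu] *: map_mpoly (@mpolyC N R) (ucoef mu f).
Proof.
pose s := undup (flatten [seq msupp (f@_m) | m <- msupp f]); exists s.
apply: ucoef_ext => mu; rewrite ucoef_sum.
rewrite (eq_bigr (fun nu => if nu == mu then ucoef mu f else 0)) => [|nu _]; last first.
  rewrite ucoefZX ucoef_const; case: (eqVneq nu mu) => [->|numu].
    by rewrite lepm_refl (_ : mu - mu = 0)%MM ?eqxx //; apply/mnmP => i; rewrite mnmBE subnn mnm0E.
  case: ifP => // numu'; case: eqP => // E; case/eqP: numu.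
  by rewrite -(submK numu') E add0m.
rewrite -big_mkcond /=; have [mus|mus] := boolP (mu \in s).
  by rewrite -big_filter filter_pred1_uniq ?undup_uniq ?big_seq1.
rewrite big1_seq ?big1 => [|nu /andP[/eqP-> nus]]; last by rewrite nus in mus.
apply/mpolyP => m; rewrite mcoeff_ucoef mcoeff0.
have [mf|/memN_msupp_eq0->] := boolP (m \in msupp f); last by rewrite mcoeff0.
apply: memN_msupp_eq0; apply: contra mus => mum; rewrite mem_undup.
apply/flattenP; exists (msupp f@_m) => //; by apply/mapP; exists m.
Qed.

Lemma ext_idealP J f : ext_ideal J f <->
  ideal_gen (fun g => exists2 h, J h & g = map_mpoly (@mpolyC N R) h) f.
Proof.
split=> [Jf|]; last first.
  apply: ideal_gen_min => _ [h Jh ->] mu; rewrite ucoef_const.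
  by case: ifP => _ //; apply: ideal0.
have [s ->] := ucoef_sum_supp f; apply: ideal_sum => mu _.
rewrite -mul_mpolyC; apply/idealM/ideal_gen_mem.
by exists (ucoef mu f).
Qed.

Section GenericRegular.
Variables (T : finType) (tau : T -> 'X_{1..v}) (kap : T -> 'I_N) (t0 : T).
Hypothesis kap_inj : injective kap.
Definition generic_form : P := \sum_t 'X_(kap t) *: 'X_[tau t].

Lemma ucoef_generic_formM mu h : ucoef mu (generic_form * h) =
  \sum_(t | (U_(kap t) <= mu)%MM) 'X_[tau t] * ucoef (mu - U_(kap t))%MM h.
Proof.
rewrite mulr_suml ucoef_sum [RHS]big_mkcond; apply: eq_bigr => t _.
by rewrite -scalerAl ucoefZX ucoefXM.
Qed.

Lemma saturation J (m : 'X_{1..v}) : exists Q : ideal {mpoly R[v]},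
  forall x, Q x <-> exists s, J ('X_[m *+ s] * x).
Proof.
unshelve eexists (@Ideal {mpoly R[v]} (fun x => exists s, J ('X_[m *+ s] * x)) _ _ _) => //.
- by exists 0%N; rewrite mulr0; apply: ideal0.
- move=> x y [s Js] [s' Js']; exists (s + s')%N.
  have mE : (m *+ (s + s') = m *+ s + m *+ s')%MM.
    by apply/mnmP => i; rewrite mnmDE !mulmnE mulnDr.
  rewrite mE mpolyXD mulrDr.
  by apply: idealD; [rewrite mulrAC mulrC | rewrite -mulrA]; apply: idealM.
- by move=> a x [s Js]; exists s; rewrite mulrCA; apply: idealM.
Qed.

(* By descending induction on the exponent of the parameter ['X_(kap t0)] in [mu]:
   in the coefficient of [U_(kap t0) + mu] in the product, ['X_[tau t0]]
   multiplies the coefficient of [mu] in [h], and the other terms involve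
   coefficients of [h] with a larger exponent of that parameter. *)
Lemma generic_regular J h : ext_ideal J (generic_form * h) ->
  exists s, ext_ideal J ('X_[tau t0 *+ s] * h).
Proof.
move=> Jh; have [Q QE] := saturation J (tau t0).
have JQ x : J x -> Q x by move=> Jx; apply/QE; exists 0%N; rewrite mulm0n mpolyX0 mul1r.
suff Qh : forall mu, Q (ucoef mu h).
  have [s hE] := ucoef_sum_supp h.
  have [e eE] : exists e, forall mu, mu \in s -> J ('X_[tau t0 *+ e] * ucoef mu h).
    elim: {hE} s => [|mu s [e eE]]; first by exists 0%N.
    have mE a b : (tau t0 *+ (a + b) = tau t0 *+ a + tau t0 *+ b)%MM.
      by apply/mnmP => i; rewrite mnmDE !mulmnE mulnDr.
    have /QE[e' e'E] := Qh mu; exists (e + e')%N => nu /[!inE] /orP[/eqP->|/eE Jnu].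
      by rewrite mE mpolyXD -mulrA; apply: idealM.
    by rewrite mE mpolyXD [X in X * _]mulrC -mulrA; apply: idealM.
  exists e; rewrite hE mulr_sumr big_seq; apply: ideal_sum => mu mus.
  rewrite -scalerAr -mul_mpolyC; apply: idealM => nu.
  rewrite ucoefXM ucoef_const; case: ifP => _; first exact: eE.
  by rewrite mulr0; apply: ideal0.
have [K KE] : exists K, forall mu, (K <= mu (kap t0))%N -> ucoef mu h = 0.
  have [s hE] := ucoef_sum_supp h; exists (\sum_(mu <- s) mu (kap t0)).+1%N => mu Kmu.
  rewrite hE ucoef_sum big_seq big1 // => nu nus; rewrite ucoefZX ucoef_const.
  case: ifP => // numu; case: eqP => // E; move: Kmu; rewrite ltnNge => /negP[].
  rewrite -(submK numu) E add0m (big_rem nu) //=; exact: leq_addr.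
suff : forall e mu, (K <= mu (kap t0) + e)%N -> Q (ucoef mu h).
  by move=> H mu; apply: (H K); apply: leq_addl.
elim=> [|e IHe] nu Ke; first by rewrite KE; [exact: ideal0 | move: Ke; rewrite addn0].
have := Jh (nu + U_(kap t0))%MM; rewrite ucoef_generic_formM.
rewrite (bigD1 t0) ?lem_addl //= addmK => /JQ Q1.
have : Q ('X_[tau t0] * ucoef nu h).
  set S := \sum_(t | _) _ in Q1; have QS : Q S.
    apply: ideal_sum => t /andP[tnu tt0]; apply/idealM/IHe.
    rewrite mnmBE mnmDE !mnm1E eqxx (inj_eq kap_inj) (negbTE tt0) subn0; lia.
  by rewrite -(addrK S (_ * _)); apply: idealB.
by move=> /QE[s Js]; apply/QE; exists s.+1; rewrite mulmSr mpolyXD -mulrA.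
Qed.

End GenericRegular.

End ParameterCoef.

Lemma uniform_exponent (T : eqType) (s : seq T) (Q : T -> nat -> Prop) :
  (forall t a b, (a <= b)%N -> Q t a -> Q t b) -> (forall t, t \in s -> exists e, Q t e) ->
  exists e, forall t, t \in s -> Q t e.
Proof.
move=> mono; elim: s => [|t s IHs] Qs; first by exists 0%N.
have [|e Qe] := Qs t; first by rewrite inE eqxx.
have [|e' Qe'] := IHs; first by move=> t' t's; apply: Qs; rewrite inE t's orbT.
exists (maxn e e') => t'; rewrite inE => /orP[/eqP->|/Qe'].
  exact: mono (leq_maxl _ _) Qe.
exact/mono/leq_maxr.
Qed.

Section LocalRegular.
Variables (q : nat) (n : 'I_q -> nat).
Local Notation nv := (nvars n).
Implicit Types (v : {ffun 'I_q -> 'I_nv}).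

(** One variable per block. Inverting their product is passing to a chart of the product of
    projective spaces, and filter-regularity is checked on these charts. *)
Definition selection v : Prop := forall p, block (v p) = p.

Definition sel_mon v : 'X_{1..nv} := (\sum_p U_(v p))%MM.

Lemma sel_inj v : selection v -> injective v.
Proof. by move=> vP p p' vpp'; rewrite -(vP p) vpp' vP. Qed.

Lemma sel_mon_le v (m : 'X_{1..nv}) e : selection v ->
  (forall p, (e <= m (v p))%N) -> (sel_mon v *+ e <= m)%MM.
Proof.
move=> vP em; apply/mnm_lepP => w; rewrite mulmnE mnm_sumE.
have [p wE|nw] := pickP (fun p => v p == w).
  rewrite (bigD1 p) //= mnm1E wE big1 ?addn0 ?mul1n; first by rewrite -(eqP wE).
  move=> p' p'p; rewrite mnm1E; apply/eqP; rewrite eqb0.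
  by apply: contra p'p => /eqP p'w; apply/eqP/(sel_inj vP); rewrite p'w (eqP wE).
by rewrite big1 ?mul0n // => p _; rewrite mnm1E nw.
Qed.

(** Pigeonhole: a block has at most [nv] variables, so a degree above [nv * e] gives one of them an
    exponent at least [e]. *)
Lemma large_monomial (m : 'X_{1..nv}) e :
  (forall p, (nv * e < multideg m p)%N) ->
  exists v, selection v /\ (sel_mon v *+ e <= m)%MM.
Proof.
move=> mE; have vex p : exists w : 'I_nv, block w = p /\ (e <= m w)%N.
  apply: contrapT => /forallNP Nw; have := mE p; rewrite ltnNge mnmE => /negP; apply.
  apply: (@leq_trans (\sum_(w < nv) e)%N); last by rewrite sum_nat_const card_ord.
  rewrite big_mkcond; apply: leq_sum => w _; case: eqP => // wp.
  by case: (leqP e (m w)) => [em|/ltnW//]; case: (Nw w).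
have [w wP] := choice vex; exists [ffun p => w p]; split=> [p|].
  by rewrite ffunE; case: (wP p).
apply: sel_mon_le => p; first by rewrite ffunE; case: (wP p).
by rewrite ffunE; case: (wP p).
Qed.

Variable A : idomainType.
Local Notation P := {mpoly A[nv]}.
Implicit Types (f g : P) (J : ideal P) (nu : 'X_{1..q}).

Lemma homog_generators J : noetherian P -> multihomog_ideal J ->
  exists s : seq ('X_{1..q} * P),
    (forall t, t \in s -> multihomog t.1 t.2 /\ J t.2) /\
    forall x, J x -> ideal_gen (fun g => g \in map snd s) x.
Proof.
move=> noethP homJ; have [s [sJ Js]] := noethP J.
pose degs g := undup (map (@multideg q n) (msupp g)).
exists (flatten [seq [seq (nu, multihomog_part nu g) | nu <- degs g] | g <- s]).
split=> [t /flatten_mapP[g gs /mapP[nu _ ->]]|x /Js].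
  by split; [exact: part_multihomog | apply/homJ/sJ].
apply: ideal_gen_min => g gs; rewrite (sum_parts g) big_seq.
apply: ideal_sum => nu nug; apply: ideal_gen_mem; apply/mapP.
exists (nu, multihomog_part nu g) => //; apply/flatten_mapP; exists g => //.
exact: (map_f (fun nu => (nu, multihomog_part nu g))).
Qed.

Lemma colon_ideal J f : exists Q : ideal P, forall g, Q g <-> J (f * g).
Proof.
unshelve eexists (@Ideal P (fun g => J (f * g)) _ _ _) => //.
- by rewrite /= mulr0; apply: ideal0.
- by move=> x y /= Jx Jy; rewrite mulrDr; apply: idealD.
- by move=> a x /= Jx; rewrite mulrCA; apply: idealM.
Qed.

(* By noetherianity a single exponent serves for all generators of [J : f], and
   a monomial of large multidegree is divisible by some [sel_mon v *+ e]. *)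
Theorem filter_regular_local J f (mu : 'X_{1..q}) : noetherian P -> multihomog_ideal J ->
  multihomog mu f ->
  (forall v, selection v -> forall g, J (f * g) -> exists s, J ('X_[sel_mon v *+ s] * g)) ->
  filter_regular J f.
Proof.
move=> noethP homJ fmu local_reg; have [Q QE] := colon_ideal J f.
have homQ : multihomog_ideal Q.
  move=> g /QE Jfg nu; apply/QE; have := homJ _ Jfg (nu + mu)%MM.
  by rewrite mulrC (partM _ _ fmu) lem_addl addmK mulrC.
have [s [sP sQ]] := homog_generators noethP homQ.
have [e eP] : exists e, forall t, t \in s -> forall v, selection v -> J ('X_[sel_mon v *+ e] * t.2).
  have mono g v a b : (a <= b)%N -> J ('X_[sel_mon v *+ a] * g) -> J ('X_[sel_mon v *+ b] * g).
    move=> ab Ja; have -> : (sel_mon v *+ b = sel_mon v *+ (b - a) + sel_mon v *+ a)%MM.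
      by apply/mnmP => w; rewrite mnmDE !mulmnE -mulnDr subnK.
    by rewrite mpolyXD -mulrA; apply: idealM.
  apply: uniform_exponent => [t a b ab Ja v vP|t ts].
    exact: mono ab (Ja v vP).
  have [||e eP] := @uniform_exponent _ (enum {ffun 'I_q -> 'I_nv})
      (fun v e => selection v -> J ('X_[sel_mon v *+ e] * t.2)).
  - by move=> v a b ab Ja vP; apply: mono ab (Ja vP).
  - move=> v _; have [vP|nvP] := pselect (selection v); last by exists 0%N.
    by have [|e eJ] := local_reg v vP t.2; [apply/QE; case: (sP t ts) | exists e].
  - by exists e => v; apply: eP; rewrite mem_enum.
pose D : 'X_{1..q} := (\sum_(t <- s) t.1)%MM.
exists (D + [multinom (nv * e).+1 | p < q])%MM => nu nuD g gnu /QE/sQ g_s.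
(* The bound on [nu] is chosen as follows: [D] dominates the multidegrees of the generators, and the
   rest leaves their coefficients a degree above [nv * e] in every block, as [large_monomial]
   asks. *)
pose F (i : 'I_(size s)) := (nth (0%MM, 0) s i).2.
pose dF (i : 'I_(size s)) := (nth (0%MM, 0) s i).1.
have Fs (i : 'I_(size s)) : nth (0%MM, 0) s i \in s by apply: mem_nth; apply: ltn_ord.
have FdF i : multihomog (dF i) (F i) by case: (sP _ (Fs i)).
have dFD i : (dF i <= D)%MM.
  rewrite /D (big_rem (nth (0%MM, 0) s i)) ?Fs //=; exact: lem_addr.
have dFnu i : (dF i <= nu)%MM.
  by apply: lepm_trans nuD; apply: lepm_trans (dFD i) _; apply: lem_addr.
(* With the zero ideal, [ideal_add_homog] makes the coefficients on the generators
   multihomogeneous. *)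
have zeroP : exists Z : ideal P, forall x, Z x <-> x = 0.
  unshelve eexists (@Ideal P (fun x => x = 0) _ _ _) => //.
  - by move=> x y -> ->; rewrite addr0.
  - by move=> a x ->; rewrite mulr0.
have [Z ZE] := zeroP.
have homZ : multihomog_ideal Z by move=> x /ZE -> nu'; apply/ZE; rewrite raddf0.
have : ideal_add Z (fun g => exists2 i, predT i & g = F i) g.
  move: g_s; apply: ideal_gen_min => _ /mapP[t ts ->]; apply: ideal_gen_mem; right.
  have ti : (index t s < size s)%N by rewrite index_mem.
  by exists (Ordinal ti) => //; rewrite /F /= nth_index.
move=> /(ideal_add_homog _ homZ FdF dFnu gnu)[a [anu /ZE/subr0_eq->]].
apply: ideal_sum => i _; rewrite [a i]mpolyE mulr_suml big_seq.
apply: ideal_sum => m mai; rewrite -scalerAl -mul_mpolyC; apply: idealM.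
have [|v [vP vm]] := @large_monomial m e.
  move=> p; rewrite (anu i m mai) mnmBE.
  have := mnm_lepP nuD p; have := mnm_lepP (dFD i) p.
  by rewrite mnmDE mnmE; lia.
by rewrite -(submK vm) mpolyXD -mulrA; apply/idealM/eP.
Qed.

End LocalRegular.

(** * Substitution of the parameters *)

Section Congruence.
Variables (S T : comNzRingType) (phi psi : {rmorphism S -> T}) (J : ideal T).
Definition rmorph_congr (x : S) : Prop := J (phi x - psi x).
Local Notation D := rmorph_congr.

Lemma rmorph_congrD x y : D x -> D y -> D (x + y).
Proof. by move=> Dx Dy; rewrite /rmorph_congr !rmorphD opprD addrACA; apply: idealD. Qed.

Lemma rmorph_congrM x y : D x -> D y -> D (x * y).
Proof.
move=> Dx Dy; rewrite /rmorph_congr !rmorphM.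
have -> : phi x * phi y - psi x * psi y = phi x * (phi y - psi y) + psi y * (phi x - psi x) by ring.
by apply: idealD; apply: idealM.
Qed.

Lemma rmorph_congr1 : D 1.
Proof. by rewrite /rmorph_congr !rmorph1 subrr; apply: ideal0. Qed.

Lemma rmorph_congrX x e : D x -> D (x ^+ e).
Proof.
move=> Dx; elim: e => [|e IHe]; first exact: rmorph_congr1.
by rewrite exprS; apply: rmorph_congrM.
Qed.

Lemma rmorph_congr_prod (I : Type) (s : seq I) (F : I -> S) :
  (forall i, D (F i)) -> D (\prod_(i <- s) F i).
Proof.
move=> DF; elim: s => [|i s IHs]; first by rewrite big_nil; apply: rmorph_congr1.
by rewrite big_cons; apply: rmorph_congrM.
Qed.

End Congruence.

Lemma mpoly_rmorph_congr (R : comNzRingType) (T : comNzRingType) N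
    (phi psi : {rmorphism {mpoly R[N]} -> T}) (J : ideal T) :
  (forall c, J (phi c%:MP - psi c%:MP)) -> (forall i, J (phi 'X_i - psi 'X_i)) ->
  forall x, J (phi x - psi x).
Proof.
move=> JC JX; apply: (mpolyind (P := rmorph_congr phi psi J)) => [|c m x _ _ IHx].
  by rewrite /rmorph_congr !rmorph0 subrr; apply: ideal0.
apply: rmorph_congrD => //; rewrite -mul_mpolyC; apply: rmorph_congrM; first exact: JC.
rewrite mpolyXE_id; apply: rmorph_congr_prod => i; apply: rmorph_congrX; exact: JX.
Qed.

Section ParameterSubst.
Variables (R : idomainType) (N v : nat).
Local Notation P := {mpoly {mpoly R[N]}[v]}.
Local Notation CC := ((@mpolyC v {mpoly R[N]}) \o (@mpolyC N R)).

(* The parameters are substituted, the variables are fixed. *)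
Definition subst_par0 (h : 'I_N -> P) : {mpoly R[N]} -> P := mmap CC h.
HB.instance Definition _ h := GRing.RMorphism.on (subst_par0 h).

Definition subst_par (h : 'I_N -> P) : P -> P := mmap (subst_par0 h) (fun w => 'X_w).
HB.instance Definition _ h := GRing.RMorphism.on (subst_par h).

Arguments subst_par0 : simpl never.
Arguments subst_par : simpl never.

Lemma subst_parD h f g : subst_par h (f + g) = subst_par h f + subst_par h g.
Proof. exact: rmorphD. Qed.

Lemma subst_parM h f g : subst_par h (f * g) = subst_par h f * subst_par h g.
Proof. exact: rmorphM. Qed.

Lemma subst_parC h c : subst_par h c%:MP = subst_par0 h c.
Proof. exact: mmapC. Qed.

Lemma subst_par0C h c : subst_par0 h c%:MP = c%:MP%:MP.
Proof. exact: mmapC. Qed.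

Lemma subst_par0U h i : subst_par0 h 'X_i = h i.
Proof. by rewrite /subst_par0 mmapX mmap1U. Qed.

Lemma subst_par_var h w : subst_par h 'X_w = 'X_w.
Proof. by rewrite /subst_par mmapX mmap1U. Qed.

Lemma subst_parX h m : subst_par h 'X_[m] = 'X_[m].
Proof.
rewrite mpolyXE_id rmorph_prod; apply: eq_bigr => i _.
by rewrite rmorphXn /= subst_par_var.
Qed.

Lemma subst_parZ h c f : subst_par h (c *: f) = subst_par0 h c * subst_par h f.
Proof. by rewrite -mul_mpolyC subst_parM subst_parC. Qed.

Lemma subst_par_const h f :
  subst_par h (map_mpoly (@mpolyC N R) f) = map_mpoly (@mpolyC N R) f.
Proof.
have constD (a b : {mpoly R[v]}) : map_mpoly (@mpolyC N R) (a + b) =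
    map_mpoly (@mpolyC N R) a + map_mpoly (@mpolyC N R) b.
  exact: (raddfD (map_mpoly (@mpolyC N R))).
elim/mpolyind: f => [|c m f _ _ IHf].
  have -> : map_mpoly (@mpolyC N R) 0 = 0 :> P.
    exact: (raddf0 (map_mpoly (@mpolyC N R))).
  exact: rmorph0.
rewrite constD subst_parD.
apply: (congr2 +%R _ IHf).
rewrite map_mpolyZ.
rewrite map_mpolyX.
rewrite subst_parZ.
rewrite subst_parX.
rewrite subst_par0C.
exact: mul_mpolyC.
Qed.

Lemma subst_par_congr (J : ideal P) h h' : (forall i, J (h i - h' i)) ->
  forall f, J (subst_par h f - subst_par h' f).
Proof.
move=> Jhh'; apply: mpoly_rmorph_congr => [c|i] /=; last first.
  by rewrite !subst_par_var subrr; apply: ideal0.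
rewrite !subst_parC; apply: mpoly_rmorph_congr => [a|i] /=.
  by rewrite !subst_par0C subrr; apply: ideal0.
by rewrite !subst_par0U.
Qed.

(** Component of degree [e] in the parameters. On it, multiplying all parameters by a monomial of
    [x] amounts to multiplying by the [e]-th power of that monomial. *)
Definition upart (e : nat) (f : P) : P := map_mpoly (pihomog mdeg e) f.

Lemma mcoeff_pihomog e (p : {mpoly R[N]}) mu :
  (pihomog mdeg e p)@_mu = if mdeg mu == e then p@_mu else 0.
Proof.
elim/mpolyind: p => [|c m p _ _ IHp]; first by rewrite raddf0 mcoeff0 if_same.
rewrite pihomogD mcoeffD IHp mcoeffD mcoeffZ linearZ /= mcoeffZ pihomogX mcoeffX.
case: (eqVneq m mu) => [->|mmu].
  by case: ifP => ce; rewrite ?mcoeffX ?mcoeff0 ?eqxx ?mulr0 ?addr0.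
rewrite (_ : c * _ = 0) ?mulr0 ?add0r //.
by case: ifP => _; rewrite ?mcoeffX ?(negbTE mmu) ?mcoeff0 mulr0.
Qed.

Lemma ucoef_upart mu e f : ucoef mu (upart e f) = if mdeg mu == e then ucoef mu f else 0.
Proof.
apply/mpolyP => m; rewrite mcoeff_ucoef /upart mcoeff_map_mpoly mcoeff_pihomog.
by case: ifP => _; rewrite ?mcoeff0 ?mcoeff_ucoef.
Qed.

Lemma sum_uparts f : exists K, f = \sum_(e < K) upart e f.
Proof.
exists (\sum_(m <- msupp f) msize f@_m)%N; apply/mpolyP => m; rewrite raddf_sum /=.
rewrite (eq_bigr (fun e : 'I__ => pihomog mdeg e f@_m)) => [|e _]; last first.
  by rewrite /upart mcoeff_map_mpoly.
apply: pihomog_partitionE; have [mf|/memN_msupp_eq0->] := boolP (m \in msupp f).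
  by rewrite (big_rem m) //= leq_addr.
by rewrite msize0.
Qed.

Lemma subst_par0X h m mu : (forall i, h i = 'X_[m] * ('X_i)%:MP) ->
  subst_par0 h 'X_[mu] = 'X_[m *+ mdeg mu] * ('X_[mu])%:MP.
Proof.
move=> hE; have hM : {morph subst_par0 h : a b / a * b} by exact: rmorphM.
have hX i e : subst_par0 h ('X_i ^+ e) = 'X_[m *+ e] * ('X_i ^+ e)%:MP.
  elim: e => [|e IHe].
    by rewrite !expr0 mulm0n mpolyX0 mul1r; apply: subst_par0C.
  by rewrite !exprS hM IHe subst_par0U hE mulmS mpolyXD mpolyCM; ring.
rewrite mpolyXE_id mdegE.
elim: (index_enum _) => [|i s IHs].
  by rewrite !big_nil mulm0n mpolyX0 mul1r; apply: subst_par0C.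
have mE : (m *+ (mu i + \sum_(j <- s) mu j) = m *+ mu i + m *+ (\sum_(j <- s) mu j))%MM.
  by apply/mnmP => j; rewrite mnmDE !mulmnE mulnDr.
by rewrite !big_cons hM IHs hX mE mpolyXD mpolyCM; ring.
Qed.

Lemma subst_par_upart h e f m : (forall i, h i = 'X_[m] * ('X_i)%:MP) ->
  subst_par h (upart e f) = 'X_[m *+ e] * upart e f.
Proof.
move=> hE; have [s {1 2}->] := ucoef_sum_supp (upart e f).
rewrite (_ : subst_par h _ = \sum_(mu <- s) subst_par h
   ('X_[mu] *: map_mpoly (@mpolyC N R) (ucoef mu (upart e f)))); last exact: rmorph_sum.
rewrite mulr_sumr; apply: eq_bigr => mu _.
rewrite subst_parZ subst_par_const (subst_par0X mu hE) ucoef_upart.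
case: eqP => [->|_]; first by rewrite -mulrA mul_mpolyC.
have -> : map_mpoly (@mpolyC N R) 0 = 0 :> P by exact: (raddf0 (map_mpoly (@mpolyC N R))).
by rewrite scaler0 !mulr0.
Qed.

End ParameterSubst.

Section GenericForms.
Variables (R : idomainType) (N v : nat) (T : finType).
Variables (tau : T -> 'X_{1..v}) (kap : T -> 'I_N).
Local Notation U := (generic_form R tau kap).
Local Notation P := {mpoly {mpoly R[N]}[v]}.
Implicit Types (f g : P).

(** [U] is linear in the parameters, so multiplication by it raises the degree in them by one. *)
Lemma upart_genericM e f : upart e (f * U) = if e is e'.+1 then upart e' f * U else 0.
Proof.
apply: ucoef_ext => mu; rewrite ucoef_upart [f * U]mulrC ucoef_generic_formM.
case: e => [|e].
  rewrite ucoef0; case: eqP => // /eqP; rewrite mdeg_eq0 => /eqP->.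
  rewrite big_pred0 // => t; apply/negP => /mnm_lepP/(_ (kap t)).
  by rewrite mnm1E eqxx mnm0E.
rewrite [upart e f * U]mulrC ucoef_generic_formM.
case: eqP => muE; last first.
  apply/esym/big1 => t tmu; rewrite ucoef_upart; case: eqP => [mE|_]; last by rewrite mulr0.
  by case: muE; rewrite -(submK tmu) mdegD mdeg1 mE addn1.
apply: eq_bigr => t tmu; rewrite ucoef_upart.
have -> // : mdeg (mu - U_(kap t))%MM == e.
by rewrite -eqSS -muE -[in X in _ == X](submK tmu) mdegD mdeg1 addn1.
Qed.

Lemma upart_ext (J : ideal {mpoly R[v]}) e f : ext_ideal N J f -> ext_ideal N J (upart e f).
Proof. by move=> Jf mu; rewrite ucoef_upart; case: ifP => _; [apply: Jf | apply: ideal0]. Qed.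

End GenericForms.

Lemma upartB (R : idomainType) N v e (f g : {mpoly {mpoly R[N]}[v]}) :
  upart e (f - g) = upart e f - upart e g.
Proof. exact: (raddfB (map_mpoly (pihomog mdeg e))). Qed.

Lemma upart_sum (R : idomainType) N v e (I : Type) (s : seq I) (Q : pred I) (F : I -> {mpoly {mpoly R[N]}[v]}) :
  upart e (\sum_(i <- s | Q i) F i) = \sum_(i <- s | Q i) upart e (F i).
Proof. exact: (raddf_sum (map_mpoly (pihomog mdeg e))). Qed.

Lemma part_const (R : idomainType) N q (n : 'I_q -> nat) nu (f : {mpoly R[nvars n]}) :
  multihomog_part nu (map_mpoly (@mpolyC N R) f) = map_mpoly (@mpolyC N R) (multihomog_part nu f).
Proof.
have E (g : {mpoly R[nvars n]}) m : (map_mpoly (@mpolyC N R) g)@_m = (g@_m)%:MP.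
  exact: mcoeff_map_mpoly.
apply/mpolyP => m; rewrite [LHS]mcoeff_part [RHS]E [in RHS]mcoeff_part E.
by case: ifP => _; rewrite ?mpolyC0.
Qed.

Section GenericRegularSequence.
Variables (k : fieldType) (q : nat) (n : 'I_q -> nat) (r : nat) (d : 'I_r.+1 -> 'X_{1..q}).
Variable I : ideal {mpoly k[nvars n]}.
Hypothesis homI : multihomog_ideal I.
Local Notation nv := (nvars n).
Local Notation N := (num_u n d).
Local Notation ku := {mpoly k[N]}.
Local Notation P := {mpoly ku[nv]}.
Local Notation U := (generic_poly n k d).

Definition gen_tau i (t : mon_of n (d i)) : 'X_{1..nv} := val (val t).
Definition gen_kap i (t : mon_of n (d i)) : 'I_N :=
  enum_rank (Tagged (fun i => mon_of n (d i)) t).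

Lemma gen_kap_inj i : injective (@gen_kap i).
Proof.
by move=> t t' /enum_rank_inj/eqP; rewrite -tag_eqE /tag_eq /= eqxx /= tagged_asE => /eqP.
Qed.

Lemma generic_polyE i : U i = generic_form k (@gen_tau i) (@gen_kap i).
Proof. by []. Qed.

Lemma base_changeE f : base_change d I f <-> ext_ideal N I f.
Proof. by rewrite ext_idealP. Qed.

Definition seq_ideal (i : nat) : ideal P :=
  ideal_add (base_change d I) (fun g => exists2 j : 'I_r.+1, (j < i)%N & g = U j).

Lemma seq_idealP i x : seq_ideal i x <->
  exists a : 'I_r.+1 -> P, ext_ideal N I (x - \sum_(j : 'I_r.+1 | (j < i)%N) a j * U j).
Proof.
rewrite /seq_ideal (ideal_addP _ _ (fun j : 'I_r.+1 => (j < i)%N)).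
by split=> -[a Ja]; exists a; apply/base_changeE.
Qed.

Lemma upart_seq_ideal i e x : seq_ideal i x -> seq_ideal i (upart e x).
Proof.
move=> /seq_idealP[a Ja]; apply/seq_idealP.
exists (fun j => if e is e'.+1 then upart e' (a j) else 0).
have := upart_ext e Ja; rewrite upartB upart_sum.
rewrite (eq_bigr (fun j => (if e is e'.+1 then upart e' (a j) else 0) * U j)) // => j _.
by rewrite generic_polyE upart_genericM; case: (e) => [|e']; rewrite ?mul0r.
Qed.

Section Selection.
Variable v : {ffun 'I_q -> 'I_nv}.
Hypothesis vP : selection v.

(** For [delta = d j] this monomial occurs in [U j], and its coefficient is the one that will be
    solved for. *)
Definition sel_power (delta : 'X_{1..q}) : 'X_{1..nv} := (\sum_p U_(v p) *+ delta p)%MM.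

Lemma sel_powerE delta p : sel_power delta (v p) = delta p.
Proof.
rewrite mnm_sumE (bigD1 p) //= mulmnE mnm1E eqxx mul1n big1 ?addn0 // => p' p'p.
by rewrite mulmnE mnm1E (inj_eq (sel_inj vP)) (negbTE p'p).
Qed.

Lemma sel_power_out delta w : (forall p, v p != w) -> sel_power delta w = 0%N.
Proof.
by move=> vw; rewrite mnm_sumE big1 // => p _; rewrite mulmnE mnm1E (negbTE (vw p)).
Qed.

Lemma multideg_sel_power delta : multideg (sel_power delta) = delta.
Proof.
apply/mnmP => p; rewrite mnmE (bigD1 (v p)) ?vP ?eqxx //= sel_powerE big1 ?addn0 // => w.
case/andP=> /eqP wp wv; apply: sel_power_out => p'; apply/eqP => vw.
by move: wp; rewrite -vw vP => pp'; rewrite -vw pp' eqxx in wv.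
Qed.

Lemma mdeg_sel_power delta : mdeg (sel_power delta) = mdeg delta.
Proof.
rewrite mdeg_sum mdegE; apply: eq_bigr => p _.
by rewrite mdegMn mdeg1 mul1n.
Qed.

Lemma sel_index i : exists t : mon_of n (d i), gen_tau t = sel_power (d i).
Proof.
have lt : (mdeg (sel_power (d i)) < (mdeg (d i)).+1)%N by rewrite mdeg_sel_power.
have tP : multideg (BMultinom lt) == d i by rewrite multideg_sel_power.
by exists (Sub (BMultinom lt) tP); rewrite /gen_tau SubK.
Qed.

Local Notation S := (sel_mon v).
(** Large enough for [S *+ B] to be divisible by every [sel_power (d i)], which clears the
    denominators of the elimination. *)
Definition sel_bound : nat := (\sum_i mdeg (d i))%N.
Local Notation B := sel_bound.

Lemma sel_power_le i : (sel_power (d i) <= S *+ B)%MM.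
Proof.
have dB p : (d i p <= B)%N.
  rewrite /sel_bound (bigD1 i) //= (leq_trans _ (leq_addr _ _)) // mdegE.
  by rewrite (bigD1 p) //= leq_addr.
apply/mnm_lepP => w; have [p /eqP<-|nw] := pickP (fun p => v p == w).
  rewrite sel_powerE mulmnE mnm_sumE (bigD1 p) //= mnm1E eqxx.
  by rewrite mulnDl mul1n (leq_trans (dB p)) ?leq_addr.
by rewrite sel_power_out // => p; rewrite nw.
Qed.

(* Substitution that solves [U j = 0] for the coefficient of the monomial
   [sel_power (d j)], for [j < i], after multiplication of all parameters by
   the monomial [S *+ B]. *)
Definition elim_par (i : nat) (l : 'I_N) : P :=
  let: existT j t := enum_val l in
  if (j < i)%N && (gen_tau t == sel_power (d j)) then
    - ('X_[S *+ B - sel_power (d j)] *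
       \sum_(t' : mon_of n (d j) | gen_tau t' != sel_power (d j)) (uvar k t')%:MP * 'X_[gen_tau t'])
  else 'X_[S *+ B] * ('X_l)%:MP.

Definition scale_par (l : 'I_N) : P := 'X_[S *+ B] * ('X_l)%:MP.

Lemma elim_par_kap i j (t : mon_of n (d j)) : elim_par i (gen_kap t) =
  if (j < i)%N && (gen_tau t == sel_power (d j)) then
    - ('X_[S *+ B - sel_power (d j)] *
       \sum_(t' : mon_of n (d j) | gen_tau t' != sel_power (d j)) (uvar k t')%:MP * 'X_[gen_tau t'])
  else 'X_[S *+ B] * (uvar k t)%:MP.
Proof. by rewrite /elim_par /gen_kap enum_rankK. Qed.

Lemma subst_generic h j : subst_par h (U j) = \sum_t h (gen_kap t) * 'X_[@gen_tau j t].
Proof.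
rewrite (_ : subst_par h _ = \sum_t subst_par h (uvar k t *: 'X_[@gen_tau j t])); last exact: rmorph_sum.
by apply: eq_bigr => t _; rewrite subst_parZ subst_par0U subst_parX.
Qed.

Lemma gen_tau_inj j : injective (@gen_tau j).
Proof. by move=> t t' /val_inj/val_inj. Qed.

Lemma generic_split j : U j = \sum_(t : mon_of n (d j)) (uvar k t)%:MP * 'X_[gen_tau t].
Proof. by apply: eq_bigr => t _; rewrite mul_mpolyC. Qed.

Lemma elim_generic i (j : 'I_r.+1) : (j < i)%N -> subst_par (elim_par i) (U j) = 0.
Proof.
move=> ji; have [t0 t0E] := sel_index j.
rewrite subst_generic (bigD1 t0) //= elim_par_kap ji t0E eqxx /= mulNr mulrAC.
rewrite -mpolyXD submK ?sel_power_le // addrC; apply/eqP; rewrite subr_eq0; apply/eqP.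
rewrite mulr_sumr; apply: eq_big => [t|t tt0].
  by rewrite -t0E (inj_eq (@gen_tau_inj j)).
by rewrite elim_par_kap -t0E (inj_eq (@gen_tau_inj j)) (negbTE tt0) andbF mulrA.
Qed.

Lemma elim_generic_fix i (j : 'I_r.+1) : (i <= j)%N ->
  subst_par (elim_par i) (U j) = 'X_[S *+ B] * U j.
Proof.
move=> ij; rewrite subst_generic generic_split mulr_sumr; apply: eq_bigr => t _.
by rewrite elim_par_kap ltnNge ij /= mulrA.
Qed.

Lemma elim_seq_ideal i x : seq_ideal i x -> ext_ideal N I (subst_par (elim_par i) x).
Proof.
pose phi : {rmorphism P -> P} := subst_par (elim_par i).
have [Q QE] : exists Q : ideal P, forall y, Q y <-> ext_ideal N I (phi y).
  by exists (ideal_preim phi (ext_ideal N I)).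
move=> Jx; apply/QE; apply: ideal_gen_min Jx => g [Ig|[j ji ->]]; last first.
  by apply/QE; rewrite [phi _]elim_generic //; apply: ideal0.
apply: ideal_gen_min Ig => _ [f If ->]; apply/QE.
rewrite [phi _]subst_par_const; apply/base_changeE/ideal_gen_mem.
by exists f.
Qed.

Lemma ext_seq_ideal i x : ext_ideal N I x -> seq_ideal i x.
Proof. by move=> Ix; apply: ideal_gen_mem; left; apply/base_changeE. Qed.

(** The two substitutions differ only on the coefficients solved for, and there by a multiple of
    [U j]. *)
Lemma elim_congr i f : seq_ideal i (subst_par (elim_par i) f - subst_par scale_par f).
Proof.
apply: subst_par_congr => l; rewrite /scale_par /elim_par.
have lE := enum_valK l; case vl: (enum_val l) lE => [j t] lE.
case: ifP => [/andP[ji /eqP tE]|_]; last by rewrite subrr; apply: ideal0.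
have -> : - ('X_[S *+ B - sel_power (d j)] *
       \sum_(t' : mon_of n (d j) | gen_tau t' != sel_power (d j)) (uvar k t')%:MP * 'X_[gen_tau t'])
   - 'X_[S *+ B] * ('X_l)%:MP = - 'X_[S *+ B - sel_power (d j)] * U j :> P.
  have lU : 'X_l = uvar k t by rewrite /uvar lE.
  have SB : 'X_[S *+ B] = 'X_[S *+ B - sel_power (d j)] * 'X_[sel_power (d j)] :> P.
    by rewrite -mpolyXD submK // sel_power_le.
  rewrite lU SB generic_split [X in _ = _ * X](bigD1 t) //= tE.
  have -> : \sum_(t' : mon_of n (d j) | gen_tau t' != sel_power (d j))
      (uvar k t')%:MP * 'X_[gen_tau t'] =
    \sum_(t' : mon_of n (d j) | t' != t) (uvar k t')%:MP * 'X_[gen_tau t'] :> P.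
    by apply: eq_bigl => t'; rewrite -tE (inj_eq (@gen_tau_inj j)).
  ring.
by apply/idealM/ideal_gen_mem; right; exists j.
Qed.

(** Elimination sends [U j] to 0 for [j < i], so the ideal goes to the extension of [I], for which
    [U i] is regular after inverting [S]. To come back, elimination is replaced by scaling modulo
    the ideal, and on a part of degree [e] in the parameters scaling is multiplication by a power of
    [S]. *)
Lemma generic_local_regular (i : 'I_r.+1) g : seq_ideal i (U i * g) ->
  exists s, seq_ideal i ('X_[S *+ s] * g).
Proof.
have SE a b : (S *+ (a + b) = S *+ a + S *+ b)%MM.
  by apply/mnmP => w; rewrite mnmDE !mulmnE mulnDr.
move=> Jg; have [K gE] := sum_uparts g.
suff [s sE] : exists s, forall e, e \in iota 0 K -> seq_ideal i ('X_[S *+ s] * upart e g).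
  exists s; rewrite gE mulr_sumr; apply: ideal_sum => e _.
  by apply: sE; rewrite mem_iota /=.
apply: uniform_exponent => [e a b ab Ja|e _].
  by rewrite -(subnK ab) SE mpolyXD -mulrA; apply: idealM.
have {}Jg : seq_ideal i (U i * upart e g).
  have := upart_seq_ideal e.+1 Jg.
  by rewrite [U i * g]mulrC upart_genericM mulrC.
have := elim_seq_ideal Jg; rewrite subst_parM elim_generic_fix // mulrAC -mulrA.
rewrite [_ * U i]mulrC mulrCA; have [t tE] := sel_index i.
have GR := @generic_regular k N nv _ (@gen_tau i) (@gen_kap i) t (@gen_kap_inj i) I.
move=> /GR[s]; rewrite tE => /(ext_seq_ideal i) Js.
(* [B * s] dominates the power of [sel_power (d i)], one more [B] comes from [elim_generic_fix], and
   [B * e] from scaling a part of degree [e]. *)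
exists (B * s + (B + B * e))%N.
have {}Js : seq_ideal i ('X_[S *+ (B * s + B)] * subst_par (elim_par i) (upart e g)).
  have le : (sel_power (d i) *+ s <= S *+ (B * s))%MM.
    apply/mnm_lepP => w; rewrite !mulmnE mulnA leq_mul2r.
    by rewrite -mulmnE (mnm_lepP (sel_power_le i)) orbT.
  by rewrite SE -(submK le) !mpolyXD -!mulrA; apply: idealM.
have : seq_ideal i ('X_[S *+ (B * s + B)] * subst_par scale_par (upart e g)).
  apply: ideal_trans Js; rewrite -mulrBr; apply: idealM.
  by rewrite -opprB; apply/idealN/elim_congr.
have -> : subst_par scale_par (upart e g) = 'X_[S *+ B *+ e] * upart e g.
  exact: subst_par_upart.
rewrite mulrA -mpolyXD.
suff -> : (S *+ (B * s + B) + S *+ B *+ e = S *+ (B * s + (B + B * e)))%MM by [].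
by apply/mnmP => w; rewrite mnmDE !mulmnE; ring.
Qed.

End Selection.

Lemma base_change_homog : multihomog_ideal (base_change d I).
Proof.
apply: multihomog_ideal_gen => _ [f If ->] nu; apply: ideal_gen_mem.
exists (multihomog_part nu f); first exact: homI.
exact: part_const.
Qed.

Theorem generic_filter_regular : filter_regular_seq U (base_change d I).
Proof.
have homBC := base_change_homog; move=> i; apply: (@filter_regular_local q n ku _ _ (d i)).
- by apply/noetherian_mpoly/noetherian_mpoly/noetherian_field.
- by apply: multihomog_ideal_add => // _ [j _ ->]; exists (d j); apply: generic_poly_multihomog.
- exact: generic_poly_multihomog.
- by move=> v vP g; apply: generic_local_regular.
Qed.

End GenericRegularSequence.

(** * Standard monomials and bases of the Koszul complexes *)

Section StandardMonomials.
Variables (R : idomainType) (v : nat).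
Implicit Types (J : ideal {mpoly R[v]}) (std : 'X_{1..v} -> bool).

Definition supp_in std (f : {mpoly R[v]}) : Prop := forall m, m \in msupp f -> std m.

Lemma supp_inP std f : supp_in std f <-> forall m, ~~ std m -> f@_m = 0.
Proof.
split=> [fstd m mN|f0 m].
  by apply: memN_msupp_eq0; apply: contra mN => /fstd.
by rewrite mcoeff_msupp; apply: contraNT => /f0 ->.
Qed.

(** The monomials in [std] form a basis of the quotient by [J]. For multihomogeneous [J] they give
    bases of all components at once, and the same [std] serves after extension to [k[u]]. *)
Definition standard_basis J std : Prop :=
  (forall f, exists g, supp_in std g /\ J (f - g)) /\
  (forall f, J f -> supp_in std f -> f = 0).

Lemma supp_inD std f g : supp_in std f -> supp_in std g -> supp_in std (f + g).
Proof.
move=> /supp_inP f0 /supp_inP g0; apply/supp_inP => m mN.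
by rewrite mcoeffD f0 // g0 // addr0.
Qed.

Lemma supp_inZ std a f : supp_in std f -> supp_in std (a *: f).
Proof.
by move=> /supp_inP f0; apply/supp_inP => m mN; rewrite mcoeffZ f0 // mulr0.
Qed.

Lemma supp_in0 std : supp_in std 0.
Proof. by move=> m; rewrite msupp0. Qed.

Lemma supp_in_sum std (I : Type) (s : seq I) (Q : pred I) (F : I -> {mpoly R[v]}) :
  (forall i, Q i -> supp_in std (F i)) -> supp_in std (\sum_(i <- s | Q i) F i).
Proof. by move=> Fs; apply: big_ind => //; [exact: supp_in0 | exact: supp_inD]. Qed.

End StandardMonomials.

(* As in Groebner basis theory, [std] avoids the leading monomials of [I]. *)
Theorem standard_basis_exists (k : fieldType) v (I : ideal {mpoly k[v]}) :
  exists std, standard_basis I std.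
Proof.
pose std (m : 'X_{1..v}) := ~~ `[< exists h, [/\ I h, h != 0 & mlead h = m] >].
exists std; split; last first.
  move=> f If fstd; apply/eqP; apply: contraT => f0.
  have /negP := fstd _ (mlead_supp f0); case; apply/asboolP; exists f; split=> //.
pose W f := exists g, supp_in std g /\ I (f - g).
have WD f f' : W f -> W f' -> W (f + f').
  move=> [g [gs Ig]] [g' [gs' Ig']]; exists (g + g'); split; first exact: supp_inD.
  by rewrite opprD addrACA; apply: idealD.
have WZ a f : W f -> W (a *: f).
  move=> [g [gs Ig]]; exists (a *: g); split; first exact: supp_inZ.
  by rewrite -scalerBr -mul_mpolyC; apply: idealM.
have W0 f : I f -> W f by move=> If; exists 0; split; [exact: supp_in0 | rewrite subr0].
have WX m : W 'X_[m].
  elim/(ltmwf (n := v)): m => m IHm; have [ms|] := boolP (std m).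
    exists 'X_[m]; rewrite subrr; split; last exact: ideal0.
    by move=> m'; rewrite msuppX inE => /eqP->.
  rewrite negbK => /asboolP[h [Ih h0 hm]].
  have lc0 : h@_m != 0 by rewrite -hm mleadc_eq0.
  have -> : 'X_[m] = (h@_m)^-1 *: h + (- (h@_m)^-1) *: (h - h@_m *: 'X_[m]).
    by rewrite scaleNr -scalerN opprB -scalerDr addrC subrK scalerA mulVf // scale1r.
  apply: (WD ((h@_m)^-1 *: h)); first by apply/W0; rewrite -mul_mpolyC; apply: idealM.
  apply: (WZ _ (h - h@_m *: 'X_[m])).
  rewrite [h in h - _]mpolyE (bigD1_seq m) ?msupp_uniq ?mcoeff_msupp //= addrAC subrr add0r.
  rewrite big_seq_cond; elim/big_ind: _ => [|x y|m' /andP[m'h m'm]]; last 1 first.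
  - apply/WZ/IHm; rewrite Order.POrderTheory.lt_neqAle m'm -hm /=.
    exact: msupp_le_mlead.
  - exact/W0/ideal0.
  - exact: WD.
move=> f; rewrite [f]mpolyE; elim/big_ind: _ => [|x y|m _].
- exact/W0/ideal0.
- exact: WD.
- exact/WZ/WX.
Qed.

Section ExtendStandard.
Variables (R : idomainType) (N v : nat) (J : ideal {mpoly R[v]}) (std : 'X_{1..v} -> bool).
Hypothesis stdJ : standard_basis J std.
Implicit Types (f g : {mpoly {mpoly R[N]}[v]}).

Lemma ucoef_supp_in mu f : supp_in std f -> supp_in std (ucoef mu f).
Proof.
by move=> /supp_inP f0; apply/supp_inP => m mN; rewrite mcoeff_ucoef f0 ?mcoeff0.
Qed.

Lemma const_supp_in (f : {mpoly R[v]}) : supp_in std f ->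
  supp_in std (map_mpoly (@mpolyC N R) f).
Proof.
move=> /supp_inP f0; apply/supp_inP => m mN.
have -> : (map_mpoly (@mpolyC N R) f)@_m = (f@_m)%:MP by exact: mcoeff_map_mpoly.
by rewrite f0 ?mpolyC0.
Qed.

Lemma standard_basis_ext : standard_basis (ext_ideal N J) std.
Proof.
case: stdJ => [spanJ freeJ]; split=> [f|f Jf fs]; last first.
  apply: ucoef_ext => mu; rewrite ucoef0; apply: freeJ; first exact: Jf.
  exact: ucoef_supp_in.
have [s fE] := ucoef_sum_supp f; have [g gP] := choice spanJ.
exists (\sum_(mu <- s) 'X_[mu] *: map_mpoly (@mpolyC N R) (g (ucoef mu f))); split.
  by apply: supp_in_sum => mu _; apply/supp_inZ/const_supp_in; case: (gP (ucoef mu f)).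
rewrite {1}fE -sumrB; apply: ideal_sum => mu _; rewrite -scalerBr.
have <- : map_mpoly (@mpolyC N R) (ucoef mu f - g (ucoef mu f)) =
   map_mpoly (@mpolyC N R) (ucoef mu f) - map_mpoly (@mpolyC N R) (g (ucoef mu f)).
  exact: (raddfB (map_mpoly (@mpolyC N R))).
rewrite -mul_mpolyC; apply/idealM/ext_idealP/ideal_gen_mem.
by exists (ucoef mu f - g (ucoef mu f)); case: (gP (ucoef mu f)).
Qed.

End ExtendStandard.

Section SubquotientBasis.
Variables (R : nzRingType) (V : lmodType R) (T S : submodule V) (B : finType) (b : B -> V).
Hypothesis bT : forall j, T (b j).
Hypothesis span : forall w, T w -> exists c : B -> R, S (w - \sum_j c j *: b j).
Hypothesis free : forall c : B -> R, S (\sum_j c j *: b j) -> forall j, c j = 0.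

Definition subquot_elt (w : V) (wT : T w) : subquot T S :=
  qmod_pi (submod_restr T S) (SubmodType (asboolI wT)).

Lemma subquot_elt_sum (c : B -> R) :
  exists2 x : submod_type T, val x = \sum_j c j *: b j &
    \sum_j c j *: subquot_elt (bT j) = qmod_pi (submod_restr T S) x.
Proof.
elim/big_rec2: _ => [|j y w _ [x xE ->]]; first by exists 0.
exists (c j *: SubmodType (asboolI (bT j)) + x); first by rewrite /= xE.
have -> : c j *: subquot_elt (bT j) =
    qmod_pi (submod_restr T S) (c j *: SubmodType (asboolI (bT j))) by exact: qmod_scaleE.
exact: qmod_addE.
Qed.

Lemma subquot_basis : is_basis (fun j => subquot_elt (bT j)).
Proof.
elim/qmod_ind=> w; have [c Sc] := span (submod_typeP w).
exists [ffun j => c j]; split.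
  rewrite (eq_bigr (fun j => c j *: subquot_elt (bT j))) => [|j _]; last by rewrite ffunE.
  have [x xE ->] := subquot_elt_sum c; apply/qmod_piP.
  by rewrite /= xE.
move=> c' wE; apply/ffunP => j; rewrite ffunE; apply/eqP; rewrite -subr_eq0; apply/eqP.
move: j; apply: free; have [x xE cE] := subquot_elt_sum c'.
move: wE; rewrite cE => /qmod_piP /=; rewrite xE => Sc'.
have -> : \sum_j (c j - c' j) *: b j =
   (val w - \sum_j c' j *: b j) - (val w - \sum_j c j *: b j).
  rewrite opprB addrC addrA subrK -sumrB; apply: eq_bigr => j _; exact: scalerBl.
by apply: submodD => //; apply: submodN.
Qed.

End SubquotientBasis.

Section KoszulBasis.
Variables (q : nat) (n : 'I_q -> nat) (A : idomainType).
Local Notation nv := (nvars n).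
Local Notation P := {mpoly A[nv]}.
Variables (J : ideal P) (std : 'X_{1..nv} -> bool).
Hypotheses (homJ : multihomog_ideal J) (stdJ : standard_basis J std).

Lemma mdeg_multideg (m : 'X_{1..nv}) : mdeg (multideg m) = mdeg m.
Proof.
rewrite !mdegE (partition_big (@block q n) predT) //=; apply: eq_bigr => p _.
by rewrite mnmE.
Qed.

Lemma part_supp_in nu (f : P) : supp_in std f -> supp_in std (multihomog_part nu f).
Proof.
move=> /supp_inP f0; apply/supp_inP => m mN.
by rewrite mcoeff_part f0 // if_same.
Qed.

Lemma homog_expand (K : nat) nu (f : P) : (mdeg nu < K)%N -> multihomog nu f ->
  supp_in std f -> f = \sum_(m : 'X_{1..nv < K} | std m && (multideg m == nu)) f@_m *: 'X_[m].
Proof.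
move=> nuK fnu fstd; rewrite {1}(@mpolywE _ _ K f); last first.
  rewrite msizeE; apply/bigmax_leqP_seq => m mf _.
  by rewrite -mdeg_multideg (fnu m mf).
rewrite [LHS](bigID (fun m : 'X_{1..nv < K} => std m && (multideg m == nu))) /=.
rewrite [X in _ + X]big1 ?addr0 // => m; rewrite negb_and => /orP[mN|mnu].
  by move/supp_inP: fstd => ->; rewrite ?scale0r.
by move/multihomogP: fnu => ->; rewrite ?scale0r.
Qed.

(** The bound [K] makes the type of monomials finite. Any [K] above [mdeg nu] gives the same count,
    so one bound serves all terms of a Koszul complex. *)
Definition hdim_at (K : nat) (nu : 'X_{1..q}) : nat :=
  #|[set m : 'X_{1..nv < K} | std m && (multideg m == nu)]|.

Definition hdim nu : nat := hdim_at (mdeg nu).+1 nu.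

Lemma hdim_atE K nu : (mdeg nu < K)%N -> hdim_at K nu = hdim nu.
Proof.
move=> nuK; rewrite /hdim /hdim_at.
have E K' : #|[set m : 'X_{1..nv < K'} | std m && (multideg m == nu)]| =
    size [seq val m | m <- enum [set m : 'X_{1..nv < K'} | std m && (multideg m == nu)]].
  by rewrite size_map -cardE.
rewrite !E; apply: perm_size; apply: uniq_perm; rewrite ?map_inj_uniq ?enum_uniq //; try exact: val_inj.
have mem K' : (mdeg nu < K')%N -> forall m : 'X_{1..nv},
    (m \in [seq val m | m <- enum [set m : 'X_{1..nv < K'} | std m && (multideg m == nu)]])
    = std m && (multideg m == nu).
  move=> nuK' m; apply/mapP/idP => [[m' ] /[!(mem_enum, inE)] H ->//|H].
  have mK' : (mdeg m < K')%N by have /andP[_ /eqP mE] := H; rewrite -mdeg_multideg mE.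
  by exists (BMultinom mK'); rewrite // mem_enum inE.
by move=> m; rewrite !mem.
Qed.

Section Koszul.
Variables (r : nat) (d : 'I_r.+1 -> 'X_{1..q}) (nu : 'X_{1..q}).
Local Notation chain := {ffun {set 'I_r.+1} -> P}.
Local Notation term := (koszul_term n A d nu).
Local Notation rel := (koszul_rel r J).
Local Notation K := (mdeg nu).+1.
Local Notation pair := ({set 'I_r.+1} * 'X_{1..nv < K})%type.

Definition degS (S : {set 'I_r.+1}) : 'X_{1..q} := (\sum_(i in S) d i)%MM.

Definition koszul_index (p : nat) : {set pair} :=
  [set x : pair | [&& #|x.1| == p, std x.2 & (degS x.1 + multideg x.2 == nu)%MM]].

Definition koszul_elt (x : pair) : chain := [ffun S => if S == x.1 then 'X_[x.2] else 0].

Lemma koszul_elt_term p x : x \in koszul_index p -> term p (koszul_elt x).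
Proof.
rewrite inE => /and3P[/eqP xp _ /eqP xnu] S; rewrite ffunE.
case: eqP => [->|_]; last by split=> // m; rewrite msupp0.
by split=> // m; rewrite msuppX inE => /eqP->.
Qed.

Lemma sum_koszul_elt p (c : pair -> A) S :
  (\sum_(x in koszul_index p) c x *: koszul_elt x) S =
  if #|S| == p then
    \sum_(m : 'X_{1..nv < K} | std m && (degS S + multideg m == nu)%MM) c (S, m) *: 'X_[m]
  else 0.
Proof.
rewrite sum_ffunE (eq_bigr (fun x => if x.1 == S then c x *: 'X_[x.2] else 0)) => [|x _]; last first.
  by rewrite !ffunE eq_sym; case: eqP; rewrite ?scaler0.
rewrite -big_mkcondr /=.
transitivity (\sum_(S' | (S' == S) && (#|S'| == p))
    \sum_(m : 'X_{1..nv < K} | std m && (degS S' + multideg m == nu)%MM) c (S', m) *: 'X_[m]).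
  rewrite pair_big_dep /=; apply: eq_big => [[S' m]|[S' m] _] //.
  by rewrite inE /=; case: (S' == S); rewrite ?andbT ?andbF.
case: ifP => Sp; last by rewrite big_pred0 // => S'; case: eqP => // ->.
by rewrite (big_pred1 S) // => S' /=; case: eqP => // ->.
Qed.

Lemma degS_sub S (m : 'X_{1..nv}) : (degS S <= nu)%MM ->
  (degS S + multideg m == nu)%MM = (multideg m == (nu - degS S)%MM).
Proof.
move=> dS; rewrite -{1}(submK dS) addmC eqm_add2r //.
Qed.

(** The reduction [G] to standard monomials need not be multihomogeneous; as [J] is, only its
    monomials of the right multidegree count. *)
Lemma koszul_coord p w (G : chain) : (forall S, (degS S <= nu)%MM) -> term p w ->
  (forall S, supp_in std (G S)) -> rel (w - G) ->
  rel (w - \sum_(x in koszul_index p) (G x.1)@_(x.2) *: koszul_elt x).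
Proof.
move=> dS wT Gstd wG S; rewrite chainB sum_koszul_elt; have [wp wnu] := wT S.
have := wG S; rewrite chainB; case: ifP => [_|/eqP/wp->] JG; last first.
  by rewrite subrr; apply: ideal0.
have wh : multihomog (nu - degS S)%MM (w S).
  by move=> m /wnu <-; rewrite addmC addmK.
have := homJ JG (nu - degS S)%MM; rewrite partB (part_id wh).
set g := multihomog_part _ _ => Jg.
have gstd : supp_in std g by apply: part_supp_in.
have gh : multihomog (nu - degS S)%MM g by apply: part_multihomog.
have nuK : (mdeg (nu - degS S)%MM < K)%N.
  by rewrite ltnS -{2}(submK (dS S)) mdegD leq_addr.
rewrite (homog_expand nuK gh gstd) in Jg.
rewrite (eq_bigl (fun m : 'X_{1..nv < K} => std m && (multideg m == (nu - degS S)%MM))); last first.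
  by move=> m; rewrite degS_sub.
rewrite (eq_bigr (fun m : 'X_{1..nv < K} => g@_m *: 'X_[m])) // => m /andP[_ mnu].
by rewrite /g mcoeff_part mnu.
Qed.

Lemma koszul_index_free p (c : pair -> A) :
  rel (\sum_(x in koszul_index p) c x *: koszul_elt x) ->
  forall x, x \in koszul_index p -> c x = 0.
Proof.
move=> Jc [S m]; rewrite inE /= => /and3P[Sp mstd mnu].
have := Jc S; rewrite sum_koszul_elt Sp; case: stdJ => _ free /free.
rewrite (_ : (c (S, m) = 0) = ((\sum_(m0 : 'X_{1..nv < K} | std m0 && (degS S + multideg m0 == nu)%MM) c (S, m0) *: 'X_[m0])@_m = 0)).
  move=> ->; first by rewrite mcoeff0.
  apply: supp_in_sum => m' /andP[m'std _]; apply: supp_inZ => m''.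
  by rewrite msuppX inE => /eqP->.
congr (_ = _); rewrite raddf_sum (bigD1 m) ?mstd //= mcoeffZ mcoeffX eqxx mulr1.
rewrite big1 ?addr0 // => m' /andP[_ m'm].
by rewrite mcoeffZ mcoeffX (inj_eq val_inj) (negbTE m'm) mulr0.
Qed.

Definition koszul_size p : nat := #|koszul_index p|.

Definition koszul_pair p (i : 'I_(koszul_size p)) : pair := enum_val i.

Lemma koszul_pairP p (i : 'I_(koszul_size p)) : koszul_pair i \in koszul_index p.
Proof. exact: enum_valP. Qed.

Definition koszul_basis p (i : 'I_(koszul_size p)) : koszul_mod d J nu p :=
  subquot_elt rel (koszul_elt_term (koszul_pairP i)).

Hypothesis dS : forall S, (degS S <= nu)%MM.

Lemma standard_chain w : exists G : chain, (forall S, supp_in std (G S)) /\ rel (w - G).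
Proof.
case: stdJ => span _; have [g gP] := choice span.
exists [ffun S => g (w S)]; split=> S; first by rewrite ffunE; case: (gP (w S)).
by rewrite chainB ffunE; case: (gP (w S)).
Qed.

Lemma koszul_basisP p : is_basis (@koszul_basis p).
Proof.
apply: (subquot_basis (b := fun i => koszul_elt (koszul_pair i))) => [w wT|c Jc i].
  have [G [Gstd wG]] := standard_chain w.
  exists (fun i => (G (@koszul_pair p i).1)@_((koszul_pair i).2)).
  have := koszul_coord dS wT Gstd wG.
  by rewrite (big_enum_val (fun x : pair => (G x.1)@_(x.2) *: koszul_elt x)).
pose c' x := \sum_(i : 'I_(koszul_size p) | koszul_pair i == x) c i.
have c'E j : c' (koszul_pair j) = c j.
  rewrite /c' (big_pred1 j) // => j'; rewrite (inj_eq _) //; exact: enum_val_inj.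
rewrite -c'E; apply: koszul_index_free (koszul_pairP i).
rewrite (big_enum_val (fun x : pair => c' x *: koszul_elt x)).
rewrite (eq_bigr (fun j => c j *: koszul_elt (koszul_pair j))) // => j _.
by rewrite -[enum_val j]/(koszul_pair j) c'E.
Qed.

Lemma koszul_size_sum p : koszul_size p = (\sum_(S : {set 'I_r.+1} | #|S| == p) hdim (nu - degS S)%MM)%N.
Proof.
rewrite /koszul_size -sum1_card.
rewrite (eq_bigr (fun S : {set 'I_r.+1} => \sum_(m : 'X_{1..nv < K} | std m && (degS S + multideg m == nu)%MM) 1)%N) => [|S _].
  by rewrite pair_big_dep /=; apply: eq_bigl => -[S m]; rewrite inE.
have nuK : (mdeg (nu - degS S)%MM < K)%N.
  by rewrite ltnS -{2}(submK (dS S)) mdegD leq_addr.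
rewrite -(hdim_atE nuK) /hdim_at -sum1_card; apply: eq_bigl => m.
by rewrite inE degS_sub.
Qed.

Lemma koszul_size_gt p : (r.+1 < p)%N -> koszul_size p = 0%N.
Proof.
move=> rp; apply: eq_card0 => -[S m]; rewrite inE /=; case: eqP => // Sp.
by have := max_card (mem S); rewrite Sp card_ord leqNgt rp.
Qed.

End Koszul.

End KoszulBasis.

(** * Finite differences of Hilbert polynomials *)

Section FiniteDifference.
Variable q : nat.
Local Notation Q := {mpoly rat[q]}.
Implicit Types (H : Q) (delta nu : 'X_{1..q}) (phi psi : 'X_{1..q} -> rat).

Definition mshift delta : 'I_q -> Q := fun i => 'X_i - (delta i)%:R%:MP.

Lemma msizeD_leq (H H' : Q) s : (msize H <= s)%N -> (msize H' <= s)%N -> (msize (H + H') <= s)%N.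
Proof. by move=> Hs Hs'; apply: leq_trans (msizeD_le _ _) _; rewrite geq_max Hs. Qed.

(** Degrees at most [a] and the same part of degree [a]: [msize] of a nonzero polynomial is its
    degree plus one. *)
Definition top_eq (a : nat) (F G : Q) : Prop :=
  [/\ (msize F <= a.+1)%N, (msize G <= a.+1)%N & (msize (F - G) <= a)%N].

Lemma msizeM_leq (F G : Q) a b : (msize F <= a)%N -> (msize G <= b)%N -> (msize (F * G) <= (a + b).-1)%N.
Proof.
move=> Fa Gb; have [->|F0] := eqVneq F 0; first by rewrite mul0r msize0.
have [->|G0] := eqVneq G 0; first by rewrite mulr0 msize0.
by rewrite msizeM // -!subn1 leq_sub2r // leq_add.
Qed.

Lemma top_eqM a b (F G F' G' : Q) : top_eq a F G -> top_eq b F' G' -> top_eq (a + b) (F * F') (G * G').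
Proof.
move=> [Fa Ga FG] [Fb Gb FG']; split.
- by have := msizeM_leq Fa Fb; rewrite addSn addnS.
- by have := msizeM_leq Ga Gb; rewrite addSn addnS.
have -> : F * F' - G * G' = F * (F' - G') + (F - G) * G' by ring.
apply: msizeD_leq.
  by have := msizeM_leq Fa FG'; rewrite addSn.
by have := msizeM_leq FG Gb; rewrite addnS.
Qed.

Lemma top_eq_shift delta (m : 'X_{1..q}) :
  top_eq (mdeg m) 'X_[m] (mmap1 (mshift delta) m).
Proof.
have top1 i : top_eq 1 'X_i (mshift delta i).
  have C1 (c : rat) : (msize (c%:MP : Q) <= 1)%N by rewrite msizeC; case: eqP.
  split; rewrite /mshift ?msizeX ?mdeg1 //.
    apply: msizeD_leq; first by rewrite msizeX mdeg1.
    by rewrite msizeN; apply: leq_trans (C1 _) _.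
  by rewrite opprB addrC subrK.
have topX i e : top_eq e ('X_i ^+ e) (mshift delta i ^+ e).
  elim: e => [|e IHe]; first by split; rewrite !expr0 ?subrr ?msize1 ?msize0.
  by rewrite !exprS -add1n; apply: top_eqM.
rewrite mpolyXE_id /mmap1 mdegE; elim: (index_enum _) => [|i s IHs].
  by rewrite !big_nil; split; rewrite ?subrr ?msize1 ?msize0.
by rewrite !big_cons; apply: top_eqM.
Qed.

Definition shift_poly delta H : Q := mmap (@mpolyC q rat) (mshift delta) H.

(** A translation of the variables leaves the part of highest degree unchanged. *)
Lemma msize_difference delta H : (msize (H - shift_poly delta H) <= (msize H).-1)%N.
Proof.
have -> : H - shift_poly delta H = \sum_(m <- msupp H) H@_m *: ('X_[m] - mmap1 (mshift delta) m).
  rewrite {1}[H]mpolyE /shift_poly /mmap -sumrB; apply: eq_bigr => m _.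
  by rewrite scalerBr mul_mpolyC.
apply: leq_trans (msize_sum _ _ _) _; apply/bigmax_leqP_seq => m mH _.
apply: leq_trans (msizeZ_le _ _) _; have [_ _ le] := top_eq_shift delta m.
by apply: leq_trans le _; rewrite -ltnS prednK ?msize_mdeg_lt //; apply: leq_ltn_trans (msize_mdeg_lt mH).
Qed.

Lemma msize_shift delta H : (msize (shift_poly delta H) <= msize H)%N.
Proof.
have -> : shift_poly delta H = H - (H - shift_poly delta H) by rewrite subKr.
apply: msizeD_leq => //; rewrite msizeN; apply: leq_trans (msize_difference _ _) _.
exact: leq_pred.
Qed.

Lemma meval_shift delta H nu : (delta <= nu)%MM ->
  (shift_poly delta H).@[fun p => (nu p)%:R] = H.@[fun p => ((nu - delta)%MM p)%:R].
Proof.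
move=> /mnm_lepP le; elim/mpolyind: H => [|c m H _ _ IHH].
  by rewrite /shift_poly mmap0 !meval0.
have -> : shift_poly delta (c *: 'X_[m] + H) = c%:MP * mmap1 (mshift delta) m + shift_poly delta H.
  by rewrite /shift_poly mmapD mmapZ mmapX.
rewrite !mevalD IHH mevalZ mevalM mevalC; congr (_ * _ + _).
rewrite mevalX /mmap1 rmorph_prod; apply: eq_bigr => i _.
rewrite rmorphXn /=; congr (_ ^+ _); rewrite /mshift mevalB mevalXU mevalC.
by rewrite mnmBE natrB.
Qed.

(** As [s] bounds [msize], the eventual polynomial has degree less than [s]; for [s = 0] the
    function is eventually zero. *)
Definition polylike (s : nat) phi : Prop :=
  exists2 H : Q, (msize H <= s)%N & eventually (fun nu => phi nu = H.@[fun p => (nu p)%:R]).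

Lemma polylike_shift s phi delta : polylike s phi -> polylike s (fun nu => phi (nu - delta)%MM).
Proof.
move=> [H Hs Hphi]; exists (shift_poly delta H); first exact: leq_trans (msize_shift _ _) Hs.
have := eventually_and (eventually_sub delta Hphi) (eventually_ge delta).
by apply: eventually_imp => nu [-> le]; rewrite meval_shift.
Qed.

Lemma polylike_difference s phi delta : polylike s phi ->
  polylike s.-1 (fun nu => phi nu - phi (nu - delta)%MM).
Proof.
move=> [H Hs Hphi]; exists (H - shift_poly delta H).
  apply: leq_trans (msize_difference _ _) _; by rewrite -!subn1 leq_sub2r.
have := eventually_and (eventually_and Hphi (eventually_sub delta Hphi)) (eventually_ge delta).
by apply: eventually_imp => nu [[-> ->] le]; rewrite mevalB meval_shift.
Qed.

Lemma polylike0 phi : polylike 0 phi -> eventually (fun nu => phi nu = 0).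
Proof.
move=> [H]; rewrite leqn0 msize_poly_eq0 => /eqP-> ; apply: eventually_imp => nu ->.
by rewrite meval0.
Qed.

Lemma polylike1 phi : polylike 1 phi -> exists c, eventually (fun nu => phi nu = c).
Proof.
move=> [H /msize1_polyC-> Hphi]; exists H@_0%MM; apply: eventually_imp Hphi => nu ->.
by rewrite mevalC.
Qed.

Variables (r : nat) (d : 'I_r.+1 -> 'X_{1..q}).
Local Notation degS S := (\sum_(i in S) d i)%MM.

(** Iterated finite difference: the product over [i] in [T] of the operators identity minus shift by
    [d i], expanded. *)
Definition alt_sum (T : {set 'I_r.+1}) phi nu : rat :=
  \sum_(S : {set 'I_r.+1} | S \subset T) (-1) ^+ #|S| * phi (nu - degS S)%MM.

Lemma alt_sum_with i (T : {set 'I_r.+1}) phi nu : i \notin T ->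
  \sum_(S : {set 'I_r.+1} | (S \subset i |: T) && (i \in S)) (-1) ^+ #|S| * phi (nu - degS S)%MM
  = - alt_sum T phi (nu - d i)%MM.
Proof.
move=> iT; rewrite (reindex_onto (fun S => i |: S) (fun S => S :\ i)) /=; last first.
  by move=> S /andP[_ iS]; rewrite setD1K.
rewrite -sumrN; apply: eq_big => [S|S].
  rewrite setU11 andbT; apply/andP/idP => [[/subsetP ST /eqP SE]|ST].
    apply/subsetP => j jS; have iS : i \notin S by rewrite -SE !inE eqxx.
    by have := ST j; rewrite !inE jS orbT => /(_ isT)/orP[/eqP ji|//]; rewrite -ji jS in iS.
  split; first exact: setUS.
  by rewrite setU1K //; apply: contra iT => /(subsetP ST).
move=> /andP[_ /eqP SE]; have iS : i \notin S by rewrite -SE !inE eqxx.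
rewrite cardsU1 iS /= add1n exprS mulN1r mulNr big_setU1 //=; congr (- (_ * phi _)).
by rewrite submDA.
Qed.

Lemma alt_sumU i (T : {set 'I_r.+1}) phi nu : i \notin T ->
  alt_sum (i |: T) phi nu = alt_sum T phi nu - alt_sum T phi (nu - d i)%MM.
Proof.
move=> iT; rewrite -alt_sum_with //.
rewrite /alt_sum (bigID (fun S : {set 'I_r.+1} => i \in S)) /= addrC; congr (_ + _).
apply: eq_bigl => S; apply/andP/idP => [[ST iS]|ST].
  apply/subsetP => j jS; have := subsetP ST j jS; rewrite !inE => /orP[/eqP ji|//].
  by rewrite -ji jS in iS.
by split; [exact: subset_trans ST (subsetU1 _ _) | apply: contra iT => /(subsetP ST)].
Qed.

Lemma polylike_alt_sum s (T : {set 'I_r.+1}) phi : polylike s phi -> polylike (s - #|T|) (alt_sum T phi).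
Proof.
move=> polyphi; have [m] := ubnP #|T|; elim: m T => // m IHm T; rewrite ltnS => Tm.
have [->|/set0Pn[i iT]] := eqVneq T set0.
  rewrite cards0 subn0; case: polyphi => H Hs Hphi; exists H => //.
  apply: eventually_imp Hphi => nu <-; rewrite /alt_sum (big_pred1 set0).
    by rewrite cards0 expr0 mul1r big_set0 subm0.
  by move=> S; rewrite subset0.
have Ti : (#|T| = #|T :\ i|.+1)%N by rewrite (cardsD1 i) iT.
have [|H Hs Hphi] := polylike_difference (d i) (IHm (T :\ i) _); first by rewrite -Ti.
exists H; first by rewrite Ti subnS.
apply: eventually_imp Hphi => nu <-; rewrite -{1}(setD1K iT) alt_sumU //.
by rewrite !inE eqxx.
Qed.

Lemma alt_sum_all_zero phi : polylike r.+1 phi ->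
  eventually (fun nu => alt_sum setT phi nu = 0).
Proof.
move=> /(polylike_alt_sum setT); rewrite cardsT card_ord subnn; exact: polylike0.
Qed.

(* Each element [i] of [S] contributes an alternating sum over the subsets of the
   complement of [i], which is a finite difference of order [r]. *)
Lemma weighted_alt_sum_const phi : polylike r.+1 phi -> exists c,
  eventually (fun nu => \sum_(S : {set 'I_r.+1}) (-1) ^+ #|S| * #|S|%:R * phi (nu - degS S)%MM = c).
Proof.
move=> polyphi.
have cst i : exists c, eventually (fun nu => alt_sum [set~ i] phi (nu - d i)%MM = c).
  apply: polylike1; apply: polylike_shift; have := polylike_alt_sum [set~ i] polyphi.
  by rewrite cardsC1 card_ord /= subSnn.
have [c cE] := choice cst; exists (- \sum_i c i).
apply: eventually_imp (eventually_all cE) => nu cnu.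
transitivity (\sum_(S : {set 'I_r.+1}) \sum_(i in S) (-1) ^+ #|S| * phi (nu - degS S)%MM).
  by apply: eq_bigr => S _; rewrite sumr_const -mulr_natr; ring.
rewrite (exchange_big_dep predT) //= -sumrN; apply: eq_bigr => i _; rewrite -cnu.
rewrite -alt_sum_with ?setC11 //; apply: eq_bigl => S.
have -> : i |: [set~ i] = setT by apply/setP => j; rewrite !inE orbN.
by rewrite subsetT.
Qed.

End FiniteDifference.

(** * Ranks of free modules and [rdim] *)

Lemma free_of_rank_leq (R : comNzRingType) (V : lmodType R) h h' :
  free_of_rank V h -> free_of_rank V h' -> (h <= h')%N.
Proof.
move=> [b bP] [b' b'P].
pose M := \matrix_(i, j) basis_coord b' (b i) j; pose N := \matrix_(i, j) basis_coord b (b' i) j.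
apply: (@mulmx1_min _ _ _ M N); apply/matrixP => i j; rewrite !mxE.
have : b i = \sum_l (M *m N) i l *: b l.
  rewrite {1}(basis_coordE b'P (b i)) (eq_bigr (fun k => \sum_l (M i k * N k l) *: b l)) => [|k _].
    rewrite exchange_big; apply: eq_bigr => l _; rewrite mxE scaler_suml; by apply: eq_bigr.
  rewrite mxE [X in _ *: X](basis_coordE bP) scaler_sumr; apply: eq_bigr => l _.
  by rewrite scalerA mxE.
have {1}-> : b i = \sum_l (1%:M : 'M[R]_h) i l *: b l.
  rewrite (bigD1 i) //= mxE eqxx scale1r big1 ?addr0 // => l /negbTE li.
  by rewrite mxE eq_sym li scale0r.
by move/(basis_coord_inj bP) => /(_ j); rewrite !mxE => <-.
Qed.

Lemma free_of_rank_uniq (R : comNzRingType) (V : lmodType R) h h' :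
  free_of_rank V h -> free_of_rank V h' -> h = h'.
Proof. by move=> Vh Vh'; apply/eqP; rewrite eqn_leq !(@free_of_rank_leq _ V). Qed.

Section LocalizedBasis.
Variables (A : idomainType) (D : mulset A) (V : lmodType A).

Lemma locring_fraction_subproof (a t : A) : D t -> a%:F / t%:F \in locring_pred D.
Proof. by move=> Dt; apply/asboolP; exists a, t. Qed.

Definition locring_fraction (a t : A) (Dt : D t) : locring D :=
  Locring (locring_fraction_subproof a Dt).

Lemma locmod_sumE (I : Type) (s : seq I) (c : I -> locring D) (a : I -> A) (v : I -> V) t (Dt : D t) :
  (forall i, val (c i) = (a i)%:F / t%:F) ->
  \sum_(i <- s) c i *: locmk (v i) (mulset1 D) = locmk (\sum_(i <- s) a i *: v i) Dt.
Proof.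
move=> cE; elim: s => [|i s IHs]; first by rewrite !big_nil locmk0.
rewrite !big_cons IHs [c i *: _](locmod_scaleE Dt _ _ (cE i)) [LHS]locmod_addE; apply: locmk_eq.
by rewrite !scalerDr !scalerA; congr (_ *: _ + _ *: _); ring.
Qed.

Lemma common_denominator h (c : 'I_h -> locring D) :
  exists (t : A) (a : 'I_h -> A), D t /\ forall i, val (c i) = (a i)%:F / t%:F.
Proof.
have /choice[w wP] i := locring_fracP (c i).
have DP (Q : pred 'I_h) : D (\prod_(i | Q i) (w i).2).
  by elim/big_ind: _ => [|x y|i _]; [exact: mulset1 | exact: mulsetM | case: (wP i)].
exists (\prod_i (w i).2), (fun i => (w i).1 * \prod_(j | j != i) (w j).2); split=> // i.
have [Di ->] := wP i; have -> : \prod_i (w i).2 = (w i).2 * \prod_(j | j != i) (w j).2 by exact: bigD1.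
rewrite !tofracM.
have /mulset_n0 wi0 := Di; have /mulset_n0 wp0 := DP (fun j => j != i).
by rewrite invfM mulrACA divff ?mulr1 ?tofrac_eq0.
Qed.

Lemma locmod_basis h (b : 'I_h -> V) : is_basis b ->
  is_basis (fun i => locmk (b i) (mulset1 D)).
Proof.
move=> bP; elim/locmod_ind=> v t Dt.
exists [ffun i => locring_fraction (basis_coord b v i) Dt]; split.
  rewrite (@locmod_sumE _ _ _ (basis_coord b v) _ _ Dt) => [|i]; last by rewrite ffunE.
  by rewrite -basis_coordE.
move=> c; have [t' [a [Dt' cE]]] := common_denominator c.
rewrite (locmod_sumE _ _ _ cE) => /locmkP[u [Du uE]].
apply/ffunP => i; rewrite ffunE; apply: val_inj; rewrite /= cE.
have /mulset_n0 u0 := Du; have /mulset_n0 t0 := Dt; have /mulset_n0 t'0 := Dt'.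
apply/eqP; rewrite eqr_div ?tofrac_eq0 // -!tofracM tofrac_eq; apply/eqP.
apply: (mulfI u0); move: uE; rewrite {1}(basis_coordE bP v) !scaler_sumr.
rewrite (eq_bigr (fun i => (u * (t' * basis_coord b v i)) *: b i)) => [|l _]; last by rewrite !scalerA mulrA.
rewrite [RHS](eq_bigr (fun i => (u * (t * a i)) *: b i)) => [|l _]; last by rewrite !scalerA mulrA.
by move=> /(basis_coord_inj bP)/(_ i); rewrite [t' * _]mulrC [t * _]mulrC.
Qed.

Lemma free_of_rank_locmod h : free_of_rank V h -> free_of_rank (locmod D V) h.
Proof. by move=> [b /locmod_basis bP]; exists (fun i => locmk (b i) (mulset1 D)). Qed.

End LocalizedBasis.

Section ComponentBasis.
Variables (q : nat) (n : 'I_q -> nat) (A : idomainType).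
Local Notation nv := (nvars n).
Local Notation P := {mpoly A[nv]}.
Variables (J : ideal P) (std : 'X_{1..nv} -> bool).
Hypotheses (homJ : multihomog_ideal J) (stdJ : standard_basis J std).

Lemma gcomp_free nu : free_of_rank (gcomp J nu) (hdim std nu).
Proof.
pose T := [set m : 'X_{1..nv < (mdeg nu).+1} | std m && (multideg m == nu)].
have bT (i : 'I_#|T|) : homog_submod n A nu 'X_[(enum_val i : 'X_{1..nv < (mdeg nu).+1})].
  have := enum_valP i; rewrite inE => /andP[_ /eqP iE] m; rewrite msuppX inE => /eqP->.
  exact: iE.
exists (fun i => subquot_elt (ideal_submod J) (bT i)); apply: subquot_basis => [w wT|c Jc i].
  have [g [gstd Jg]] := (proj1 stdJ) w.
  have := homJ Jg nu; rewrite partB (part_id wT); set g' := multihomog_part _ _ => Jg'.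
  have gE : g' = \sum_(m : 'X_{1..nv < (mdeg nu).+1} | std m && (multideg m == nu)) g'@_m *: 'X_[m].
    by apply: homog_expand => //; [exact: part_multihomog | exact: part_supp_in].
  exists (fun i : 'I_#|T| => g'@_(enum_val i)).
  rewrite -(big_enum_val (fun m : 'X_{1..nv < (mdeg nu).+1} => g'@_m *: 'X_[m])) /=.
  rewrite (eq_bigl (fun m : 'X_{1..nv < (mdeg nu).+1} => std m && (multideg m == nu))).
    by rewrite -gE.
  by move=> m; rewrite inE.
have f0 : \sum_j c j *: ('X_[(enum_val j : 'X_{1..nv < (mdeg nu).+1})] : P) = 0.
  apply: (proj2 stdJ) => //; apply: supp_in_sum => j _; apply: supp_inZ => m.
  rewrite msuppX inE => /eqP->; have := enum_valP j; rewrite inE.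
  by case/andP.
have := congr1 (mcoeff (enum_val i : 'X_{1..nv < (mdeg nu).+1})) f0; rewrite mcoeff0 raddf_sum (bigD1 i) //=.
rewrite mcoeffZ mcoeffX eqxx mulr1 big1 ?addr0 // => j ji.
by rewrite mcoeffZ mcoeffX (inj_eq val_inj) (inj_eq enum_val_inj) (negbTE ji) mulr0.
Qed.

Lemma componentwise_free_std : componentwise_free J.
Proof. by split=> // nu; exists (hdim std nu); apply: gcomp_free. Qed.

(** Since [rdim] is read off the count of standard monomials, it is the same for [I] and for its
    extension to [k[u]]. *)
Lemma has_rdim_std e : has_rdim J e <->
  exists2 H : {mpoly rat[q]}, (msize H)%:Z - 1 = e &
    eventually (fun nu => H.@[fun p => (nu p)%:R] = (hdim std nu)%:R).
Proof.
split=> -[H He Hnu]; exists H => //; apply: eventually_imp Hnu => nu.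
  move=> [h hP ->]; congr (_%:R); apply: free_of_rank_uniq hP _.
  exact/free_of_rank_locmod/gcomp_free.
by move=> HE; exists (hdim std nu) => //; apply/free_of_rank_locmod/gcomp_free.
Qed.

End ComponentBasis.

(** * Extension of scalars and generic linear forms *)

Section MatrixCoefficients.
Variables (A : idomainType) (m : nat).
Local Notation A' := {mpoly A[m]}.

Definition mx_coef mu a b (y : 'M[A']_(a, b)) : 'M[A]_(a, b) := map_mx (mcoeff mu) y.
Definition mx_const a b (D : 'M[A]_(a, b)) : 'M[A']_(a, b) := map_mx (@mpolyC m A) D.

Lemma mx_coefM mu a b c (y : 'M[A']_(a, b)) (D : 'M_(b, c)) :
  mx_coef mu (y *m mx_const D) = mx_coef mu y *m D.
Proof.
apply/matrixP => i j; rewrite !mxE raddf_sum; apply: eq_bigr => l _.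
by rewrite !mxE mulrC [LHS]mcoeffCM mulrC.
Qed.

Lemma mx_coef0 mu a b : mx_coef mu (0 : 'M_(a, b)) = 0.
Proof. by apply/matrixP => i j; rewrite !mxE mcoeff0. Qed.

Lemma mx_const_sub a b (y : 'rV[A']_b) (D : 'M_(a, b)) :
  (forall mu, exists z, mx_coef mu y = z *m D) -> exists z, y = z *m mx_const D.
Proof.
move=> /choice[z zE]; pose K := (\sum_j msize (y 0%R j))%N.
exists (\sum_(mu : 'X_{1..m < K}) 'X_[mu] *: mx_const (z mu)).
apply/rowP => j; rewrite mulmx_suml summxE.
rewrite [LHS](@mpolywE _ _ K); last by rewrite /K (bigD1 j) //= leq_addr.
apply: eq_bigr => mu _; rewrite -scalemxAl -map_mxM -zE !mxE.
by rewrite mulrC mul_mpolyC.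
Qed.

Lemma mx_constM a b c (y : 'M[A]_(a, b)) (D : 'M_(b, c)) :
  mx_const (y *m D) = mx_const y *m mx_const D.
Proof. exact: map_mxM. Qed.

End MatrixCoefficients.

Section PresentationExt.
Variables (q : nat) (n : 'I_q -> nat) (A : idomainType) (m : nat).
Local Notation nv := (nvars n).
Local Notation P := {mpoly A[nv]}.
Local Notation P' := {mpoly {mpoly A[m]}[nv]}.
Variables (J : ideal P) (nu : 'X_{1..q}).
Hypothesis homJ : multihomog_ideal J.
Local Notation J' := (ext_ideal m J).

Lemma ucoef_multihomog mu (f : P') : multihomog nu f -> multihomog nu (ucoef mu f).
Proof.
move=> /multihomogP f0; apply/multihomogP => w wN.
by rewrite mcoeff_ucoef f0 ?mcoeff0.
Qed.

Lemma const_multihomog (f : P) : multihomog nu f ->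
  multihomog nu (map_mpoly (@mpolyC m A) f).
Proof.
move=> /multihomogP f0; apply/multihomogP => w wN.
by rewrite mcoeff_map_mpoly f0 ?mpolyC0.
Qed.

(** Extension of scalars to a polynomial ring over [A]: exactness and the description of the kernel
    are checked on the coefficient of each monomial in the new indeterminates. *)
Lemma cayley_presented_ext s N M : cayley_presented (gcomp J nu) s N M ->
  cayley_presented (gcomp J' nu) s (N%:MP) (M%:MP).
Proof.
move=> [rho D S g rho0s DD exactD dataS gD gZ gsurj gker NE ME].
pose D' j := mx_const m (D j); pose S' j := mx_const m (S j).
have detE j : \det (cayley_mx D' S' j) = (\det (cayley_mx D S j))%:MP.
  by rewrite -det_map_mx /cayley_mx map_col_mx map_mxM.
(* [w l] is a polynomial representing the image of the basis vector [l]; [W] and [W'] lift [g] and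
   its extension to polynomials. *)
pose w l : P := val (repr (g (delta_mx 0 l))).
have wh l : homog_submod n A nu (w l) := @submod_typeP _ _ (homog_submod n A nu) _.
pose W (y : 'rV_(rho 1 + rho 0)) : P := \sum_l y 0 l *: w l.
have gW (y : 'rV_(rho 1 + rho 0)) (x : submod_type (homog_submod n A nu)) : val x = W y ->
    g y = qmod_pi (submod_restr _ (ideal_submod J)) x.
  have g0 : g 0 = 0 by rewrite -(scale0r 0) gZ scale0r.
  move=> xE; have -> : g y = \sum_l y 0 l *: subquot_elt (ideal_submod J) (wh l).
    rewrite {1}[y]row_sum_delta (big_morph g gD g0); apply: eq_bigr => l _; rewrite gZ; congr (_ *: _).
    by rewrite -[LHS]reprK; congr (qmod_pi _ _); apply: val_inj.
  have [x' x'E ->] := subquot_elt_sum (ideal_submod J) wh (fun l => y 0 l).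
  by congr (qmod_pi _ _); apply: val_inj; rewrite xE x'E.
pose W' (y : 'rV_(rho 1 + rho 0)) : P' := \sum_l y 0 l *: map_mpoly (@mpolyC m A) (w l).
have W'h y : homog_submod n _ nu (W' y).
  apply: (big_ind (homog_submod n {mpoly A[m]} nu)) => [|a b|l _]; [exact: submod0 | exact: submodD |].
  by apply: (@submodZ _ _ (homog_submod n {mpoly A[m]} nu)); apply: const_multihomog; apply: wh.
have ucoefW mu y : ucoef mu (W' y) = W (mx_coef mu y).
  rewrite ucoef_sum; apply: eq_bigr => l _; rewrite mxE; apply/mpolyP => i.
  rewrite mcoeff_ucoef !mcoeffZ mcoeff_map_mpoly.
  by rewrite mulrC [LHS]mcoeffCM mulrC.
have W'D y y' : W' (y + y') = W' y + W' y'.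
  by rewrite -big_split; apply: eq_bigr => l _; rewrite mxE scalerDl.
have W'Z a y : W' (a *: y) = a *: W' y.
  by rewrite scaler_sumr; apply: eq_bigr => l _; rewrite mxE scalerA.
pose g' y : gcomp J' nu := subquot_elt (ideal_submod J') (W'h y).
have JW y : J (W y) <-> exists z, y = z *m D 0.
  have Wh : homog_submod n _ nu (W y).
    apply: (big_ind (homog_submod n A nu)) => [|a b|l _]; [exact: submod0 | exact: submodD |].
    by apply: (@submodZ _ _ (homog_submod n A nu)); apply: wh.
  by rewrite -gker (gW y (SubmodType (asboolI Wh))) // qmod_pi_eq0.
have g'0 y : g' y = 0 <-> J' (W' y).
  by rewrite qmod_pi_eq0.
have W'const h y : J (h - W y) -> J' (map_mpoly (@mpolyC m A) h - W' (mx_const m y)).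
  move=> Jh mu; have -> : ucoef mu (map_mpoly (@mpolyC m A) h - W' (mx_const m y)) =
     ucoef mu (map_mpoly (@mpolyC m A) h) - ucoef mu (W' (mx_const m y)) by exact: raddfB.
  rewrite ucoef_const ucoefW; case: eqP => [->|/eqP mu0].
    by have -> : mx_coef 0%MM (mx_const m y) = y by apply/matrixP => i l; rewrite !mxE mpolyCK.
  have -> : mx_coef mu (mx_const m y) = 0.
    by apply/matrixP => i l; rewrite !mxE mcoeffC (negbTE mu0) mulr0.
  rewrite /W big1 ?subr0; first exact: ideal0.
  by move=> l _; rewrite mxE scale0r.
apply: (@CayleyPresented _ _ _ _ _ rho D' S' g') => //.
- by move=> j; rewrite -mx_constM DD /mx_const map_mx0.
- move=> j x js xD; apply: mx_const_sub => mu; apply: exactD => //.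
  by rewrite -mx_coefM xD mx_coef0.
- by move=> j js; rewrite detE mpolyC_eq0; apply: dataS.
- by move=> x y; rewrite [RHS]qmod_addE; congr (qmod_pi _ _); apply: val_inj; apply: W'D.
- by move=> a y; rewrite [RHS]qmod_scaleE; congr (qmod_pi _ _); apply: val_inj; apply: W'Z.
- elim/qmod_ind=> x; have /choice[y yE] mu : exists y, J (ucoef mu (val x) - W y).
    have xh : homog_submod n A nu (ucoef mu (val x)) := ucoef_multihomog (submod_typeP x).
    have [y yE] := gsurj (subquot_elt (ideal_submod J) xh); exists y.
    have Wh : homog_submod n _ nu (W y).
      apply: (big_ind (homog_submod n A nu)) => [|a b|l _]; [exact: submod0 | exact: submodD |].
      by apply: (@submodZ _ _ (homog_submod n A nu)); apply: wh.
    by move: yE; rewrite (gW y (SubmodType (asboolI Wh))) // => /esym/qmod_piP.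
  have [t xE] := ucoef_sum_supp (val x).
  exists (\sum_(mu <- t) 'X_[mu] *: mx_const m (y mu)); apply/esym/qmod_piP.
  rewrite /= {1}xE; have W'0 : W' 0 = 0 by rewrite -(scale0r 0) W'Z scale0r.
  rewrite (big_morph W' W'D W'0) -sumrB; apply: (@ideal_sum _ J') => mu _.
  by rewrite W'Z -scalerBr -mul_mpolyC; apply/idealM/W'const.
- move=> y; rewrite g'0; split=> [J'y|[z ->]].
    by apply: mx_const_sub => mu; apply/JW; rewrite -ucoefW; apply: J'y.
  by move=> mu; rewrite ucoefW; apply/JW; exists (mx_coef mu z); rewrite mx_coefM.
- by rewrite NE rmorph_prod; apply: eq_bigr => j _; rewrite detE.
- by rewrite ME rmorph_prod; apply: eq_bigr => j _; rewrite detE.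
Qed.

End PresentationExt.

Lemma has_chain_inj (R : nzRingType) (V W : lmodType R) (h : {linear V -> W}) l :
  injective h -> has_chain V l -> has_chain W l.
Proof.
move=> hinj [U Uchain].
unshelve eexists (fun i => @Submodule R W (fun y => exists2 x, U i x & y = h x) _ _ _).
- by exists 0; rewrite ?linear0 //; apply: submod0.
- by move=> _ _ [x Ux ->] [y Uy ->]; exists (x + y); rewrite ?linearD //; apply: submodD.
- by move=> a _ [x Ux ->]; exists (a *: x); rewrite ?linearZ //; apply: submodZ.
move=> i il; have [sub [x Ux xN]] := Uchain i il; split=> [_ [y Uy ->]|].
  by exists y => //; apply: sub.
exists (h x); first by exists x.
by move=> [y Uy /hinj xy]; apply: xN; rewrite xy.
Qed.

Section LocalizedInjection.
Variables (A : idomainType) (D : mulset A) (V W : lmodType A) (f : {linear V -> W}).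

Lemma locmap_is_linear : linear (@locmap A D V W f).
Proof.
move=> a; elim/locmod_ind=> v s Ds; elim/locmod_ind=> w t Dt.
have [Da aE] := locring_fracE a.
rewrite [a *: locmk v _](locmod_scaleE Da _ _ aE) [X in locmap f X]locmod_addE !locmapE.
rewrite [a *: locmk _ _](locmod_scaleE Da _ _ aE) [RHS]locmod_addE.
have fZ b x : f (b *: x) = b *: f x by exact: linearZ.
by apply: locmk_eq; rewrite linearD !fZ.

Qed.
HB.instance Definition _ := GRing.isLinear.Build (locring D) (locmod D V) (locmod D W) _
  (@locmap A D V W f) locmap_is_linear.

Lemma local_length_inj l l' : injective f ->
  has_length (locmod D V) l -> has_length (locmod D W) l' -> (l <= l')%N.
Proof.
move=> finj [Vl _] [_ maxl']; apply: maxl'.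
apply: (has_chain_inj (h := @locmap A D V W f)) Vl.
elim/locmod_ind=> v s Ds; elim/locmod_ind=> w t Dt.
move=> /=; rewrite [locmap f (locmk v Ds)]locmapE [locmap f (locmk w Dt)]locmapE => /locmkP[u [Du uE]]; apply/locmkP; exists u; split=> //.
have fZ b x : f (b *: x) = b *: f x by exact: linearZ.
by apply: finj; rewrite !fZ.
Qed.

End LocalizedInjection.

Section MultiplicationMap.
Variables (q : nat) (n : 'I_q -> nat) (A : idomainType).
Local Notation P := {mpoly A[nvars n]}.
Variables (J : ideal P) (mu nu : 'X_{1..q}) (L : P).
Hypothesis Lmu : multihomog mu L.

Definition mul_by (h : P) : P := L * h.
Lemma mul_by_is_linear : linear mul_by.
Proof. by move=> a x y; rewrite /mul_by mulrDr scalerAr. Qed.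
HB.instance Definition _ := GRing.isLinear.Build A P P _ mul_by mul_by_is_linear.

Lemma mul_by_homog h : homog_submod n A nu h -> homog_submod n A (mu + nu)%MM (mul_by h).
Proof. by move=> hnu; apply: multihomogM. Qed.

Lemma mul_by_ideal h : ideal_submod J h -> ideal_submod J (mul_by h).
Proof. exact: idealM. Qed.

Definition gcomp_mul : gcomp J nu -> gcomp J (mu + nu)%MM :=
  @subquot_map _ P P _ _ _ (ideal_submod J) mul_by mul_by_homog.

Lemma gcomp_mul_is_linear : linear gcomp_mul.
Proof. exact: subquot_map_is_linear mul_by_ideal. Qed.
HB.instance Definition _ := GRing.isLinear.Build A (gcomp J nu) (gcomp J (mu + nu)%MM) _
  gcomp_mul gcomp_mul_is_linear.

Lemma gcomp_mul_inj : (forall g, multihomog nu g -> J (L * g) -> J g) -> injective gcomp_mul.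
Proof.
move=> Lreg x y xy; apply/eqP; rewrite -subr_eq0; apply/eqP.
have {xy} : gcomp_mul (x - y) = 0 by rewrite linearB /= xy subrr.
elim/qmod_ind: (x - y) => w; rewrite /gcomp_mul (subquot_mapE _ mul_by_ideal).
move=> /qmod_pi_eq0 /= /Lreg Jw; apply/qmod_pi_eq0; apply: Jw.
exact: (@submod_typeP _ _ (homog_submod n A nu) w).
Qed.

End MultiplicationMap.

Section GenericLinearForm.
Variables (A : idomainType) (q : nat) (n : 'I_q -> nat).
Local Notation nv := (nvars n).
Variables (J : ideal {mpoly A[nv]}) (p : 'I_q).
Hypothesis noethA : noetherian A.
Hypothesis homJ : multihomog_ideal J.
Local Notation J' := (ext_ideal nv J).

Definition block_var := {w : 'I_nv | block w == p}.

(** There is one parameter for each of the [nv] variables; those attached to block [p] are the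
    coefficients. *)
Definition linear_form : {mpoly {mpoly A[nv]}[nv]} :=
  generic_form A (fun w : block_var => U_(val w))%MM (fun w => val w).

Lemma ext_ideal_homog : multihomog_ideal J'.
Proof.
move=> f Jf nu mu; have -> : ucoef mu (multihomog_part nu f) = multihomog_part nu (ucoef mu f).
  apply/mpolyP => m; rewrite mcoeff_ucoef !mcoeff_part mcoeff_ucoef.
  by case: ifP; rewrite ?mcoeff0.
exact: homJ.
Qed.

Lemma multideg_var (w : 'I_nv) : multideg U_(w)%MM = U_(block w)%MM.
Proof.
apply/mnmP => p'; rewrite mnmE mnm1E.
have [E|E] := eqVneq (block w) p'.
  rewrite (bigD1 w) /= ?E // mnm1E eqxx big1 // => w' /andP[_ /negbTE w'w].
  by rewrite mnm1E eq_sym w'w.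
rewrite big1 // => w' w'p'; rewrite mnm1E; case: eqP => // ww'.
by move: w'p'; rewrite -ww' (negbTE E).
Qed.

Lemma linear_form_homog : multihomog U_(p)%MM linear_form.
Proof.
apply: multihomog_sum => w _; apply: multihomogZ => m; rewrite msuppX inE => /eqP->.
by rewrite multideg_var (eqP (valP w)).
Qed.

(** Every selection contains a variable of block [p], which occurs in the form with its own
    parameter, so [generic_regular] applies on each chart. *)
Lemma linear_form_regular : filter_regular J' linear_form.
Proof.
apply: (@filter_regular_local q n _ _ _ U_(p)%MM).
- by apply/noetherian_mpoly/noetherian_mpoly.
- exact: ext_ideal_homog.
- exact: linear_form_homog.
move=> v vP g; have vp : block (v p) == p by apply/eqP.
move=> /(@generic_regular _ _ _ _ _ _ (exist _ (v p) vp : block_var) val_inj)[s Js].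
exists s; have -> : (sel_mon v *+ s = (sel_mon v - U_(v p)) *+ s + U_(v p) *+ s)%MM.
  apply/mnmP => w; rewrite mnmDE !mulmnE -mulnDl mnmBE subnK //.
  by rewrite /sel_mon mnm_sumE (bigD1 p) //= leq_addr.
by rewrite mpolyXD -mulrA; apply: idealM.
Qed.

(* Under the presentations, [mult pi N1 - mult pi M1] and
   [mult pi N2 - mult pi M2] are the local lengths in two consecutive multidegrees. *)
Theorem mult_le_shift s : (0 < s)%N -> eventually (fun nu => forall N1 M1 N2 M2,
  cayley_presented (gcomp J nu) s N1 M1 ->
  cayley_presented (gcomp J (U_(p) + nu)%MM) s N2 M2 ->
  forall pi, prime_elt pi -> separated pi -> (mult pi N1 + mult pi M2 <= mult pi N2 + mult pi M1)%N).
Proof.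
move=> s_gt0; apply: eventually_imp linear_form_regular => nu Lreg N1 M1 N2 M2 pres1 pres2 pi piP seppi.
have piP' := prime_mpolyC nv piP.
have seppi' := separated_mpolyC (m := nv) seppi.
have [N10 M10] := cayley_presented_neq0 pres1; have [N20 M20] := cayley_presented_neq0 pres2.
have [l1 len1 E1] := cayley_presented_length s_gt0 piP' seppi' (cayley_presented_ext nv pres1).
have [l2 len2 E2] := cayley_presented_length s_gt0 piP' seppi' (cayley_presented_ext nv pres2).
have l12 : (l1 <= l2)%N.
  apply: (local_length_inj (f := @gcomp_mul _ _ _ J' _ nu _ linear_form_homog) _ len1 len2).
  exact: gcomp_mul_inj.
move: E1 E2; rewrite !mult_mpolyC // => <- <-.
by rewrite addnAC !leq_add2r.
Qed.

End GenericLinearForm.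

(** * Degree of the resultant *)

Section KoszulMatrix.
Variables (A : idomainType) (q : nat) (n : 'I_q -> nat).
Local Notation nv := (nvars n).
Local Notation P := {mpoly A[nv]}.
Variables (r : nat) (d : 'I_r.+1 -> 'X_{1..q}) (f : 'I_r.+1 -> P).
Hypothesis fd : forall i, multihomog (d i) (f i).
Variables (J : ideal P) (std : 'X_{1..nv} -> bool).
Hypotheses (homJ : multihomog_ideal J) (stdJ : standard_basis J std).
Variable pr : {additive A -> A}.
Hypotheses (prK : forall a, pr (pr a) = pr a).
Hypothesis Jpr : forall g, J g -> J (map_mpoly pr g).

(** [pr] will be the projection of [k[u]] onto linear forms, which fixes the coefficients of the
    [U i] and preserves the extended ideal. It serves to make the matrices of the differentials
    linear in [u]. *)
Definition coef_fixed (g : P) : Prop := forall m, pr g@_m = g@_m.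
Hypothesis f_fixed : forall i, coef_fixed (f i).

Lemma coef_fixed_map g : coef_fixed g -> map_mpoly pr g = g.
Proof. by move=> gh; apply/mpolyP => m; rewrite mcoeff_map_mpoly. Qed.

Lemma koszul_diff_fixed (w : {ffun {set 'I_r.+1} -> P}) S :
  (forall S, w S = 0 \/ exists m, w S = 'X_[m]) -> coef_fixed (koszul_diff f w S).
Proof.
move=> wX m; rewrite ffunE raddf_sum raddf_sum; apply: eq_bigr => i _ /=.
have fwh : pr (f i * w (i |: S))@_m = (f i * w (i |: S))@_m.
  have [->|[m' ->]] := wX (i |: S); first by rewrite mulr0 mcoeff0 raddf0.
  by rewrite mulrC mcoeffXM; case: ifP => _; rewrite ?f_fixed ?raddf0.
rewrite /koszul_sign -signr_odd -mulrA; case: (odd _); last by rewrite expr0 mul1r.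
by rewrite expr1 mulN1r mcoeffN raddfN fwh.
Qed.

Variable nu : 'X_{1..q}.
Hypothesis dS : forall S, (degS d S <= nu)%MM.
Local Notation eps := (@koszul_basis q n A J std r d nu).
Local Notation size j := (koszul_size std d nu j).

Lemma koszul_matrix : exists D : forall j, 'M[A]_(size j.+1, size j),
  (forall j (i : 'I_(size j.+1)), koszul_map fd (eps i) = \sum_(l < size j) D j i l *: eps l) /\
  (forall j i l, pr (D j i l) = D j i l).
Proof.
have entry j (i : 'I_(size j.+1)) : exists c : 'I_(size j) -> A,
    koszul_map fd (eps i) = \sum_l c l *: eps l /\ forall l, pr (c l) = c l.
  have et := koszul_elt_term A (koszul_pairP i).
  pose w := koszul_diff f (koszul_elt A (koszul_pair i)).
  have wt : koszul_term n A d nu j w by apply: koszul_diff_term.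
  have [G0 [G0std wG0]] := standard_chain stdJ w.
  (* Projecting the coefficients of a standard representative gives another one, as those of [w] are
     fixed and [J] is stable; the resulting coordinates are fixed by [pr]. *)
  pose G := [ffun S => map_mpoly pr (G0 S)].
  have Gstd S : supp_in std (G S).
    apply/supp_inP => m mN; rewrite ffunE mcoeff_map_mpoly.
    by have /supp_inP -> := G0std S; rewrite ?raddf0.
  have wG : koszul_rel r J (w - G).
    move=> S; rewrite chainB [G S]ffunE -(@coef_fixed_map (w S)).
      by rewrite -raddfB; apply: Jpr; rewrite -chainB; apply: wG0.
    apply: koszul_diff_fixed => S'; rewrite ffunE.
    by case: ifP => _; [right; exists (koszul_pair i).2 | left].
  exists (fun l => (G (koszul_pair l).1)@_((koszul_pair l).2)); split; last first.
    by move=> l; rewrite ffunE mcoeff_map_mpoly prK.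
  have [x xE ->] := subquot_elt_sum (koszul_rel r J)
    (fun l : 'I_(size j) => koszul_elt_term A (koszul_pairP l))
    (fun l => (G (koszul_pair l).1)@_((koszul_pair l).2)).
  rewrite /koszul_basis koszul_mapE; apply/qmod_piP => /=; rewrite xE.
  have := koszul_coord homJ dS wt Gstd wG.
  by rewrite (big_enum_val (fun x : {set 'I_r.+1} * 'X_{1..nv < (mdeg nu).+1} => (G x.1)@_(x.2) *: koszul_elt A x)).
pose D j := \matrix_(i, l) sval (cid (entry j i)) l.
exists D; split=> j i => [|l]; last by rewrite mxE; case: (svalP (cid (entry j i))).
by have [E _] := svalP (cid (entry j i)); apply: etrans E _; apply: eq_bigr => l _; rewrite mxE.
Qed.

End KoszulMatrix.

Section KoszulResultant.
Variables (A : idomainType) (q : nat) (n : 'I_q -> nat).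
Local Notation nv := (nvars n).
Local Notation P := {mpoly A[nv]}.
Variables (r : nat) (d : 'I_r.+1 -> 'X_{1..q}) (f : 'I_r.+1 -> P).
Hypothesis fd : forall i, multihomog (d i) (f i).
Variables (J : ideal P) (std : 'X_{1..nv} -> bool).
Hypotheses (homJ : multihomog_ideal J) (stdJ : standard_basis J std).
Hypothesis regJ : filter_regular_seq f J.
Hypothesis poly_hdim : polylike r.+1 (fun nu => (hdim std nu)%:R).
Local Notation size nu j := (koszul_size std d nu j).

Lemma sum_koszul_size nu (F : nat -> rat) : (forall S, (degS d S <= nu)%MM) ->
  \sum_(j < r.+2) F j * (size nu j)%:R =
  \sum_(S : {set 'I_r.+1}) F #|S| * (hdim std (nu - degS d S)%MM)%:R.
Proof.
move=> dS; have ltS (S : {set 'I_r.+1}) : (#|S| < r.+2)%N.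
  by rewrite ltnS; apply: leq_trans (max_card _) _; rewrite card_ord.
rewrite [RHS](partition_big (fun S : {set 'I_r.+1} => Ordinal (ltS S)) predT) //=.
apply: eq_bigr => j _; rewrite koszul_size_sum // natr_sum mulr_sumr.
by apply: eq_big => [S|S /eqP->].
Qed.

Lemma eventually_degS : eventually (fun nu => forall S, (degS d S <= nu)%MM).
Proof.
apply: eventually_imp (eventually_ge (total_deg d)) => nu le S; apply: lepm_trans le.
rewrite /total_deg /degS [X in (_ <= X)%MM](bigID (fun i => i \in S)) /=; exact: lem_addr.
Qed.

(** Expanded over subsets, this is the [r.+1]-fold difference, along the [d i], of a function that
    is eventually a polynomial of degree at most [r]. *)
Lemma koszul_euler : eventually (fun nu =>
  \sum_(j < r.+2) (-1) ^+ j * (size nu j)%:Z = 0).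
Proof.
have := eventually_and eventually_degS (alt_sum_all_zero d poly_hdim).
apply: eventually_imp => nu [dS alt0]; apply/eqP; rewrite -(intr_eq0 rat) rmorph_sum /=.
apply/eqP; rewrite -[RHS]alt0 /alt_sum.
rewrite (eq_bigr (fun j : 'I_r.+2 => (-1) ^+ j * (size nu j)%:R)) => [|j _]; last first.
  by rewrite rmorphM rmorphXn.
rewrite (sum_koszul_size (fun j => (-1) ^+ j)) //.
by apply: eq_bigl => S; rewrite subsetT.
Qed.

Section Cokernel.
Variable J' : ideal P.
Hypothesis J'E : forall x, J' x <-> ideal_add J (fun g => exists i, g = f i) x.

Lemma koszul_presented : eventually (fun nu => forall x,
  is_cayley_det (koszul fd J nu) r.+1 x ->
  exists N M u : A, [/\ u \is a GRing.unit, x = u%:F * (N%:F / M%:F)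
                    & cayley_presented (gcomp J' nu) r.+1 N M]).
Proof.
have J'E' x : J' x <-> lower_ideal f J r.+1 x.
  rewrite J'E; split; apply: ideal_gen_min => g [Jg|[i]]; try by apply: ideal_gen_mem; left.
    by move=> ->; apply: ideal_gen_mem; right; exists i.
  by move=> _ ->; apply: ideal_gen_mem; right; exists i.
have := eventually_and (koszul_complex_exact fd homJ regJ) (eventually_ge (total_deg d)).
apply: eventually_imp => nu [exact_nu le] x.
have augD (y z : koszul_mod d J nu 0) : koszul_aug J' (y + z) = koszul_aug J' y + koszul_aug J' z :> gcomp J' nu.
  by have := koszul_aug_is_linear J'E' (nu := nu) 1 y z; rewrite !scale1r.
have aug0 : koszul_aug J' (0 : koszul_mod d J nu 0) = 0.
  by apply: (addrI (koszul_aug J' (0 : koszul_mod d J nu 0))); rewrite -augD !addr0.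
apply: (@cayley_det_presented A (koszul fd J nu) r.+1 x isT _ _ (gcomp J' nu) (@koszul_aug _ _ _ _ _ J J' nu)).
- by move=> y; apply: koszul_mod_gt.
- by move=> j y _; apply: exact_nu.
- exact: augD.
- move=> a y; have := koszul_aug_is_linear J'E' (nu := nu) a y 0.
  by rewrite aug0 !addr0.
- exact: koszul_aug_surj J'E' nu.
- exact: koszul_aug_ker.
Qed.

End Cokernel.

Variable pr : {additive A -> A}.
Hypotheses (prK : forall a, pr (pr a) = pr a).
Hypothesis Jpr : forall g, J g -> J (map_mpoly pr g).
Hypothesis f_fixed : forall i, coef_fixed pr (f i).

Lemma koszul_cayley_det : eventually (fun nu => generically_exact (koszul fd J nu) /\
  exists (rho : nat -> nat) (phi : forall j, 'M[A]_(rho j)),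
    [/\ forall j, size nu j = (rho j.+1 + rho j)%N, rho r.+2 = 0%N,
        forall j, \det (phi j) != 0, forall j i l, pr (phi j i l) = phi j i l
      & is_cayley_det (koszul fd J nu) r.+1
          (\prod_(1 <= j < r.+2) (\det (phi j))%:F ^ ((-1) ^+ j.+1))]).
Proof.
have := eventually_and (eventually_and (koszul_complex_exact fd homJ regJ) koszul_euler)
  eventually_degS.
apply: eventually_imp => nu [[exact_nu euler] dS].
have [D [DE Dpr]] := koszul_matrix fd homJ stdJ prK Jpr f_fixed dS.
have basisP j : is_basis (@koszul_basis _ _ _ J std _ d nu j) by apply: koszul_basisP.
have gt j : (r.+1 < j)%N -> size nu j = 0%N by apply: koszul_size_gt.
split; first exact: (generically_exact_complex (C := koszul fd J nu) basisP gt DE exact_nu euler).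
exists (cayley_rho D), (cayley_phi (C := koszul fd J nu) basisP gt DE exact_nu euler); split.
- exact: (cayley_rho_size (C := koszul fd J nu) basisP gt DE exact_nu euler).
- exact: (cayley_rho_gt D gt).
- exact: cayley_phi_det.
- by case=> [|j] i l; [case: i | rewrite mxE].
- exact: cayley_det_exists.
Qed.

End KoszulResultant.

Section HomogeneousDegree.
Variables (k : fieldType) (N : nat).
Local Notation ku := {mpoly k[N]}.
Implicit Types a b p : ku.

Lemma prod_homog (I : Type) (s : seq I) (F : I -> ku) :
  (forall i, F i \is 1.-homog) -> \prod_(i <- s) F i \is (size s).-homog.
Proof.
move=> F1; elim: s => [|i s IHs]; first by rewrite big_nil dhomog1.
by rewrite big_cons; apply: (dhomogM (F1 i) IHs).
Qed.

Lemma det_homog m (M : 'M[ku]_m) : (forall i j, M i j \is 1.-homog) -> \det M \is m.-homog.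
Proof.
move=> M1; apply: rpred_sum => s _.
have Mh : \prod_(i < m) M i (s i) \is m.-homog.
  by have := prod_homog (enum 'I_m) (fun i => M1 i (s i)); rewrite big_enum size_enum_ord.
by case: (odd_perm s); rewrite ?expr0 ?mul1r ?expr1 ?mulN1r ?dhomogN.
Qed.

Lemma msize_homog e p : p != 0 -> p \is e.-homog -> msize p = e.+1.
Proof.
move=> p0 ph; rewrite (dhomog_uniq p0 ph (dhomog_msize ph)) prednK //.
by rewrite lt0n msize_poly_eq0.
Qed.

Lemma msize_frac_prod (s : seq nat) (f : nat -> ku) (rho : nat -> nat) a b :
  (forall j, f j != 0) -> (forall j, msize (f j) = (rho j).+1) -> a != 0 -> b != 0 ->
  a%:F = b%:F * \prod_(j <- s) (f j)%:F ^ ((-1) ^+ j.+1) ->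
  (msize a)%:Z = (msize b)%:Z + \sum_(j <- s) (-1) ^+ j.+1 * (rho j)%:Z.
Proof.
move=> f0 frho; have sizeM c j : c != 0 -> (msize (c * f j))%:Z = (msize c)%:Z + (rho j)%:Z.
  move=> c0; have := @msizeM_succ _ _ c (f j) (mulf_neq0 c0 (f0 j)).
  by rewrite frho addnS => -[<-].
elim: s a b => [|j s IHs] a b a0 b0.
  by rewrite !big_nil mulr1 addr0 => /eqP; rewrite tofrac_eq => /eqP->.
have fj0 : (f j)%:F != 0 by rewrite tofrac_eq0.
rewrite !big_cons exprS -signr_odd; case: (odd j).
  rewrite expr1 mulrNN mulr1 expr1z mulrA -tofracM mul1r => /IHs -> //; last exact: mulf_neq0.
  by rewrite sizeM // addrA.
rewrite expr0 mulr1 mulN1r => abE.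
have /IHs E : (a * f j)%:F = b%:F * \prod_(j <- s) (f j)%:F ^ ((-1) ^+ j.+1).
  by rewrite tofracM abE exprN1 -!mulrA; congr (_ * _); rewrite mulrCA mulVf ?mulr1.
have := E (mulf_neq0 a0 (f0 j)) b0; rewrite sizeM // => aE.
by apply: (addIr (rho j)%:Z); rewrite aE; ring.
Qed.

Lemma divides_msize a b : b != 0 -> divides a b -> msize a = msize b -> associated b a.
Proof.
move=> b0 [c bE] sab; exists c => //.
have cb : (msize c + msize b = 1 + msize b)%N by rewrite -{1}sab msizeM_succ -?bE.
have cC : c = (c@_0%MM)%:MP by apply: msize1_polyC; rewrite (addIn cb).
move: b0; rewrite bE mulf_eq0 => /norP[c0 _].
by rewrite cC; apply: mpolyC_unit; move: c0; rewrite cC mpolyC_eq0 mpolyCK.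
Qed.

End HomogeneousDegree.

(** Summation by parts: the degree, an alternating sum of the ranks [rho j], is expressed by the
    sizes of the Koszul terms weighted by [j], to which [weighted_alt_sum_const] applies. *)
Lemma weighted_size_sum (size rho : nat -> nat) m : (forall j, size j = (rho j.+1 + rho j)%N) ->
  rho m.+1 = 0%N ->
  \sum_(1 <= j < m.+1) (-1) ^+ j.+1 * (rho j)%:Z = - \sum_(j < m.+1) (-1) ^+ j * j%:Z * (size j)%:Z.
Proof.
move=> sizeE rhom; suff E l : \sum_(1 <= j < l.+1) (-1) ^+ j.+1 * (rho j)%:Z =
    (-1) ^+ l * l%:Z * (rho l.+1)%:Z - \sum_(j < l.+1) (-1) ^+ j * j%:Z * (size j)%:Z.
  by rewrite E rhom mulr0 sub0r.
elim: l => [|l IHl]; first by rewrite big_geq // big_ord1 mulr0 !mul0r subr0.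
rewrite big_nat_recr // big_ord_recr IHl /= sizeE PoszD -[in (l.+1)%:Z]addn1 PoszD !exprS.
by ring.
Qed.

Lemma mult_fraction (A : idomainType) (c u N M : A) : u \is a GRing.unit -> N != 0 -> M != 0 ->
  c%:F = u%:F * (N%:F / M%:F) -> c != 0 /\ forall p, prime_elt p -> separated p ->
  (mult p c + mult p M = mult p N)%N.
Proof.
move=> uU N0 M0 cE; have u0 : u != 0 by apply: contraTneq uU => ->; rewrite unitr0.
have cM : c * M = u * N.
  by apply/eqP; rewrite -tofrac_eq !tofracM cE mulrA divfK ?tofrac_eq0.
have : c * M != 0 by rewrite cM mulf_neq0.
rewrite mulf_eq0 => /norP[c0 _]; split=> // p pP sepp.
by rewrite -multM // cM multM // mult_unit.
Qed.

Lemma is_cayley_det_unit (A : idomainType) (C : complex A) s x v : v \is a GRing.unit ->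
  is_cayley_det C s x -> is_cayley_det C s (v%:F * x).
Proof.
move=> vU [rho [b [phi [h1 h2 h3 h4 [u uU ->]]]]]; exists rho, b, phi; split=> //.
by exists (v * u); rewrite ?unitrM ?vU // tofracM mulrA.
Qed.

(** Every multidegree above a base point [nu0] is reached from it by unit steps. Along such a path
    the values divide one another, and having equal degree they are associated. *)
Lemma eventually_constant (k : fieldType) N q (G : 'X_{1..q} -> {mpoly k[N]} -> Prop) (w : rat) :
  (forall nu c v, v \is a GRing.unit -> G nu c -> G nu (v * c)) ->
  eventually (fun nu => exists2 c, G nu c & (msize c)%:R = w) ->
  eventually (fun nu => forall p c c', G nu c -> G (U_(p) + nu)%MM c' -> c' != 0 /\ divides c c') ->
  exists c, eventually (fun nu => G nu c).
Proof.
move=> G_unit exG divG; have [nu0 all_nu] := eventually_and exG divG.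
have [[c0 G0 size0] _] := all_nu nu0 (lepm_refl _); exists c0; exists nu0 => nu le.
suff [v vU Gv] : exists2 v : {mpoly k[N]}, v \is a GRing.unit & G nu (v * c0).
  have vVU : v^-1 \is a GRing.unit by rewrite unitrV.
  by have := G_unit _ _ _ vVU Gv; rewrite mulKr.
have [m] := ubnP (mdeg (nu - nu0)%MM); elim: m nu le => // m IHm nu le lt_m.
have [->|neq] := eqVneq nu nu0; first by exists 1; rewrite ?unitr1 // mul1r.
have [p ltp] : exists p, (nu0 p < nu p)%N.
  apply: contrapT => /forallNP leN; case/eqP: neq; apply/mnmP => p.
  by apply/eqP; rewrite eqn_leq (elimT mnm_lepP le) andbT leqNgt; apply/negP/leN.
pose mu := (nu - U_(p))%MM.
have nuE : nu = (U_(p) + mu)%MM.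
  rewrite addmC submK //; apply/mnm_lepP => i; rewrite mnm1E.
  by case: eqP => // <-; apply: leq_trans ltp.
have le_mu : (nu0 <= mu)%MM.
  apply/mnm_lepP => i; rewrite mnmBE mnm1E; case: eqP => [<-|_]; last first.
    by rewrite subn0; apply: (elimT mnm_lepP le).
  by rewrite subn1 -ltnS prednK // (leq_trans _ ltp).
have [|v vU Gv] := IHm mu le_mu.
  rewrite -ltnS; apply: leq_trans lt_m; rewrite ltnS.
  have -> : (nu - nu0 = U_(p) + (mu - nu0))%MM.
    apply/mnmP => i; rewrite nuE mnmBE !mnmDE mnmBE addnBA //.
    exact: (elimT mnm_lepP le_mu).
  by rewrite mdegD mdeg1.
have [[c Gc size_c] _] := all_nu nu le; have [_ div_mu] := all_nu mu le_mu.
rewrite nuE in Gc *; have [c_neq0 [y cE]] := div_mu p _ _ Gv Gc.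
have div_c : divides c0 c by exists (y * v); rewrite cE mulrA.
have eq_size : msize c0 = msize c by apply/eqP; rewrite -(Num.Theory.eqr_nat rat) size0 size_c.
have [u uU c0E] := divides_msize c_neq0 div_c eq_size.
by exists u => //; rewrite -c0E.
Qed.

(** * Rémond's resultant form and the Koszul resultant *)

Section Resultant.
Variables (k : fieldType) (q : nat) (n : 'I_q -> nat).
Variables (I : ideal {mpoly k[nvars n]}) (r : nat) (d : 'I_r.+1 -> 'X_{1..q}).
Hypotheses (homI : multihomog_ideal I) (rdimI : has_rdim I r).
Local Notation ku := {mpoly k[num_u n d]}.
Local Notation J := (base_change d I).
Local Notation fd := (generic_poly_multihomog n k d).
Local Notation K nu := (koszul fd J nu).

Lemma standard_base_change std : standard_basis I std -> standard_basis J std.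
Proof.
move=> /(standard_basis_ext (num_u n d))[span free]; split=> [f|f /base_changeE Jf].
  by have [g [gs Jg]] := span f; exists g; split=> //; apply/base_changeE.
exact: free.
Qed.

Lemma standard_basis_polylike : exists std, [/\ standard_basis I std, standard_basis J std
  & polylike r.+1 (fun nu => (hdim std nu)%:R)].
Proof.
have [std stdI] := standard_basis_exists I; exists std; split=> //.
  exact: standard_base_change.
have [H Hr HE] := (has_rdim_std homI stdI r).1 rdimI; exists H.
  by move/eqP: Hr; rewrite subr_eq -PoszD eqz_nat addn1 => /eqP->.
by apply: eventually_imp HE => nu ->.
Qed.

Lemma has_rdim_base_change : has_rdim J r.
Proof.
have [std [stdI stdJ _]] := standard_basis_polylike.
by apply/(has_rdim_std (base_change_homog homI) stdJ); apply/(has_rdim_std homI stdI).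
Qed.

Lemma componentwise_free_base_change : componentwise_free J.
Proof.
have [std [_ stdJ _]] := standard_basis_polylike.
exact: componentwise_free_std (base_change_homog homI) stdJ.
Qed.

Lemma generic_coef_homog i m : pihomog mdeg 1 (generic_poly n k d i)@_m = (generic_poly n k d i)@_m.
Proof.
apply: pihomog_dE; rewrite raddf_sum; apply: rpred_sum => t _ /=.
rewrite mcoeffZ mcoeffX mulr_natr; apply: rpredMn.
by rewrite /uvar dhomogX /= mdeg1.
Qed.

Lemma base_change_upart e g : J g -> J (map_mpoly (pihomog mdeg e) g).
Proof. by move=> /base_changeE Jg; apply/base_changeE/upart_ext. Qed.

Lemma resultant_presented : eventually (fun nu => forall c : ku,
  is_cayley_det (K nu) r.+1 c%:F -> exists N M : ku, [/\ c != 0,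
    forall p, prime_elt p -> (mult p c + mult p M = mult p N)%N
  & cayley_presented (remond_comp d I nu) r.+1 N M]).
Proof.
have [std [_ stdJ poly_h]] := standard_basis_polylike.
have pres := koszul_presented fd (base_change_homog homI) (generic_filter_regular d homI)
  (fun x => iff_refl _).
apply: eventually_imp pres => nu pres c /pres[N [M [u [uU cE presN]]]].
have [N0 M0] := cayley_presented_neq0 presN; have [c0 cM] := mult_fraction uU N0 M0 cE.
by exists N, M; split=> // p pP; apply/cM/separated_mpoly.
Qed.

Lemma resultant_at : exists w : rat, eventually (fun nu => generically_exact (K nu) /\
  exists2 c : ku, is_cayley_det (K nu) r.+1 c%:F & (msize c)%:R = w).
Proof.
have [std [_ stdJ poly_h]] := standard_basis_polylike; have homJ : multihomog_ideal J := base_change_homog homI.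
have regU := generic_filter_regular d homI.
(* [msize] is the degree plus one, and the degree is the opposite of the weighted alternating
   sum. *)
have [w wE] := weighted_alt_sum_const d poly_h; exists (1 - w).
have pres := koszul_presented fd homJ regU (fun x => iff_refl _).
have cay := koszul_cayley_det fd homJ stdJ regU poly_h (@pihomog_id _ _ mdeg 1)
  (@base_change_upart 1) generic_coef_homog.
have := eventually_and (eventually_and pres cay) (eventually_and wE (eventually_degS d)).
apply: eventually_imp => nu [[pres_nu [gex [rho [phi [sizeE rho_r phi0 phi1 det_x]]]]] [wnu dS]].
split=> //; have [N [M [u [uU xE presN]]]] := pres_nu _ det_x.
have [N0 M0] := cayley_presented_neq0 presN.
(* Lengths are nonnegative, so [M] has at most the multiplicity of [N] at every prime: the Cayley
   determinant, so far a fraction, lies in [k[u]]. *)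
have [y NE] : divides M N.
  apply: divides_mult => //; first exact: irreducibles_prime_mpoly.
  - exact: factorizable_mpoly.
  - by move=> p; apply: separated_mpoly.
  move=> p pP; have [l _ <-] := cayley_presented_length (ltn0Sn r) pP (separated_mpoly pP) presN.
  exact: leq_addl.
have cE : (u * y)%:F = \prod_(1 <= j < r.+2) (\det (phi j))%:F ^ ((-1) ^+ j.+1).
  by rewrite xE NE !tofracM mulfK ?tofrac_eq0.
exists (u * y); first by rewrite cE.
have c0 : u * y != 0.
  have u0 : u != 0 by apply: contraTneq uU => ->; rewrite unitr0.
  have y0 : y != 0 by apply: contraNneq N0 => y0; rewrite NE y0 mul0r.
  exact: mulf_neq0.
have det1h j : msize (\det (phi j)) = (rho j).+1.
  apply: msize_homog => //; apply: det_homog => i l.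
  by rewrite homog_piE phi1.
have := msize_frac_prod phi0 det1h c0 (oner_neq0 _) (etrans cE (esym (mul1r _))).
rewrite (weighted_size_sum sizeE rho_r) msize1 => degE.
have -> : (msize (u * y))%:R = ((msize (u * y))%:Z)%:~R :> rat by [].
rewrite degE rmorphB /= -wnu -(sum_koszul_size std (fun j => (-1) ^+ j * j%:R) dS) rmorph_sum.
congr (_ - _); apply: eq_bigr => j _.
by rewrite !rmorphM rmorphXn /=.
Qed.

Lemma resultant_const : exists c : ku, eventually (fun nu =>
  generically_exact (K nu) /\ is_cayley_det (K nu) r.+1 c%:F).
Proof.
have [w at_w] := resultant_at.
suff [c cE] : exists c : ku, eventually (fun nu => is_cayley_det (K nu) r.+1 c%:F).
  exists c; apply: eventually_and cE; apply: eventually_imp at_w => nu; exact: proj1.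
apply: (@eventually_constant _ _ _ _ w).
- by move=> nu c v vU; rewrite tofracM; apply: is_cayley_det_unit.
- apply: eventually_imp at_w => nu; exact: proj2.
have homU : multihomog_ideal (ideal_add J (fun g => exists i, g = generic_poly n k d i)).
  apply: multihomog_ideal_add (base_change_homog homI) _ => _ [i ->]; exists (d i).
  exact: generic_poly_multihomog.
have noeth_ku : noetherian ku by apply/noetherian_mpoly/noetherian_field.
have shift := eventually_all (fun p => mult_le_shift p noeth_ku homU (ltn0Sn r)).
have [nu0 pres] := resultant_presented.
apply: eventually_imp (eventually_and (eventually_ge nu0) shift) => nu [le shift_nu] p c c'.
move=> /(pres nu le)[N1 [M1 [c0 mult1 pres1]]].
move=> /(pres _ (lepm_trans le (lem_addl _ _)))[N2 [M2 [c'0 mult2 pres2]]]; split=> //.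
apply: divides_mult => //; first exact: irreducibles_prime_mpoly.
- exact: factorizable_mpoly.
- by move=> pi; apply: separated_mpoly.
move=> pi piP; have := shift_nu p _ _ _ _ pres1 pres2 pi piP (separated_mpoly piP).
rewrite -(mult1 pi piP) -(mult2 pi piP).
by rewrite addnAC !leq_add2r.
Qed.

End Resultant.

(** Existence is stated on both sides, so that the comparison of representatives is not vacuous; the
    scalar [a] is explicit because the units of [k[u]] are the nonzero constants. *)
Theorem theorem2p14 (k : fieldType) (q : nat) (n : 'I_q -> nat)
    (I : ideal {mpoly k[nvars n]}) (r : nat) (d : 'I_r.+1 -> 'X_{1..q}) :
  (0 < q)%N -> (forall p, (0 < n p)%N) ->
  multihomog_ideal I -> has_rdim I r -> (forall i, d i != 0%MM) ->
  [/\ filter_regular_seq (generic_poly n k d) (base_change d I),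
      exists c, is_resultant_form d I c,
      exists c, is_resultant (generic_poly_multihomog n k d)
                             (base_change d I) c
    & forall c c', is_resultant_form d I c ->
        is_resultant (generic_poly_multihomog n k d) (base_change d I) c' ->
        exists2 a : k, a != 0 & c = a *: c'].
Proof.
move=> _ _ homI rdimI _; have regU := generic_filter_regular d homI.
have [irr fac] := (@irreducibles_prime_mpoly k (num_u n d), @factorizable_mpoly k (num_u n d)).
have sep (p : {mpoly k[num_u n d]}) (pP : prime_elt p) := separated_mpoly pP.
have [c cE] := resultant_const d homI rdimI.
have pres := resultant_presented d homI rdimI.
have lengths nu (N M c' : {mpoly k[num_u n d]}) :
    (forall p, prime_elt p -> (mult p c' + mult p M = mult p N)%N) ->
    cayley_presented (remond_comp d I nu) r.+1 N M -> forall p, prime_elt p ->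
    has_local_length (remond_comp d I nu) p (mult p c').
  move=> cN presN p pP; exists pP.
  have [l len] := cayley_presented_length (ltn0Sn r) pP (sep p pP) presN.
  by rewrite -(cN p pP) => /addIn <-.
split=> //.
- exists c; apply: eventually_imp (eventually_and cE pres) => nu [[_ det_c] /(_ c det_c)].
  move=> [N [M [c0 cN presN]]]; split; first exact: (cayley_presented_torsion presN).
  by apply: is_content_of_lengths => //; apply: lengths presN.
- exists c; split=> //; first exact: componentwise_free_base_change.
  exact: has_rdim_base_change.
move=> c1 c2 form1 [_ _ _ res2].
(* One common multidegree suffices: there [c1] is the content of the cokernel and [c2] a Cayley
   determinant, whose multiplicities are the local lengths. *)
have [nu0 all_nu] := eventually_and (eventually_and form1 res2) pres.
have [[[_ content1] [_ det2]] /(_ c2 det2)] := all_nu nu0 (lepm_refl _).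
move=> [N [M [c20 c2N presN]]].
have [_ /mpoly_unitP[a a0 ->] ->] : associated c1 c2.
  by apply: (is_content_uniq irr fac sep content1 c20); apply: lengths presN.
by exists a; rewrite // mul_mpolyC.
Qed.
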